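(* Let $d\ge 2$ and let $S\subset\mathbb{R}^d$ be a smooth embedded hypersurface (a $(d-1)$-dimensional submanifold, possibly with boundary $\partial S$) whose interior $\operatorname{Int}S$ has non-vanishing Gaussian curvature at every point. Let $$D:=S\times\mathbb{R}=\{(x,h)\,:\,x\in S,\ h\in\mathbb{R}\}\subset\mathbb{R}^{d+1}$$ be the cylinder generated by $S$. Then $\dim_F(D)=d-1$.
   Context: For a Borel set $A\subset\mathbb{R}^n$, $\mathcal{M}(A)$ denotes the set of nonzero finite (positive) Borel measures $\mu$ on $\mathbb{R}^n$ supported on $A$. The Fourier transform of $\mu$ is $\widehat{\mu}(\xi)=\int e^{-2\pi i x\cdot\xi}\,d\mu(x)$. The Fourier dimension of $A$ is $$\dim_F(A):=\sup\Big\{s\in[0,n]\,:\,\exists\,\mu\in\mathcal{M}(A)\text{ with }\sup_{\xi\in\mathbb{R}^n}|\xi|^{s/2}|\widehat{\mu}(\xi)|<\infty\Big\}.$$ *)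

(* Defs.v *)
From HB Require Import structures.
From mathcomp Require Import all_boot all_order all_algebra.
From mathcomp Require Import all_classical all_reals all_analysis.
Set Implicit Arguments.
Unset Strict Implicit.
Unset Printing Implicit Defensive.
Import Order.TTheory GRing.Theory Num.Theory.
Import numFieldNormedType.Exports.
Local Open Scope classical_set_scope.
Local Open Scope ring_scope.

(* Points of R^n are row vectors 'rV[R]_n.  The (max-)norm topology of
   'rV[R]_n coincides with the Euclidean topology, so open sets, continuity
   and directional derivatives are the usual ones.  The Euclidean norm and
   the dot product are defined explicitly below. *)

Definition ev {R : realType} (n : nat) (j : 'I_n) : 'rV[R]_n := delta_mx 0 j.

Definition partial {R : realType} (n : nat) (j : 'I_n) (f : 'rV[R]_n -> R)
  : 'rV[R]_n -> R := fun y => derive f y (ev j).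

Definition iter_partial {R : realType} (n : nat) (js : seq 'I_n)
  (f : 'rV[R]_n -> R) : 'rV[R]_n -> R :=
  foldr (fun j g => partial j g) f js.

Definition smooth_on {R : realType} (n : nat) (V : set 'rV[R]_n)
  (f : 'rV[R]_n -> R) : Prop :=
  forall (js : seq 'I_n) (y : 'rV[R]_n), V y ->
    (forall j : 'I_n, derivable (iter_partial js f) y (ev j)) /\
    {for y, continuous (iter_partial js f)}.

Definition drop_coord {R : realType} (d : nat) (i : 'I_d) (x : 'rV[R]_d)
  : 'rV[R]_d.-1 := col' i x.

Definition interior_chart {R : realType} (d : nat) (S : set 'rV[R]_d)
  (p : 'rV[R]_d) (i : 'I_d) (U : set 'rV[R]_d) (V : set 'rV[R]_d.-1)
  (g : 'rV[R]_d.-1 -> R) : Prop :=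
  [/\ open U, U p, open V, smooth_on V g &
      S `&` U = [set x | [/\ U x, V (drop_coord i x) &
                              x 0 i = g (drop_coord i x)]]].

(* Boundary chart of S at p: near p, S is the graph of a smooth g over the
   smooth domain {h >= 0} (h smooth, h = 0 and dh <> 0 at the base point). *)
Definition boundary_chart {R : realType} (d : nat) (S : set 'rV[R]_d)
  (p : 'rV[R]_d) (i : 'I_d) (U : set 'rV[R]_d) (V : set 'rV[R]_d.-1)
  (g h : 'rV[R]_d.-1 -> R) : Prop :=
  [/\ open U, U p, open V, smooth_on V g & smooth_on V h] /\
  h (drop_coord i p) = 0 /\
  (exists j : 'I_d.-1, partial j h (drop_coord i p) != 0) /\
      S `&` U = [set x | [/\ U x, V (drop_coord i x), 0 <= h (drop_coord i x) &
                              x 0 i = g (drop_coord i x)]].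

Definition interior_point {R : realType} (d : nat) (S : set 'rV[R]_d)
  (p : 'rV[R]_d) : Prop :=
  exists i U V g, interior_chart S p i U V g.

Definition boundary_point {R : realType} (d : nat) (S : set 'rV[R]_d)
  (p : 'rV[R]_d) : Prop :=
  exists i U V g h, boundary_chart S p i U V g h.

Definition smooth_hypersurface {R : realType} (d : nat) (S : set 'rV[R]_d)
  : Prop :=
  forall p, S p -> interior_point S p \/ boundary_point S p.

Definition graph_gauss_curvature {R : realType} (n : nat)
  (g : 'rV[R]_n -> R) (y : 'rV[R]_n) : R :=
  \det (\matrix_(j < n, k < n) partial j (partial k g) y) /
  (1 + \sum_(j < n) (partial j g y) ^+ 2) `^ ((n%:R + 2) / 2).

Definition nonvanishing_gauss_curvature {R : realType} (d : nat)
  (S : set 'rV[R]_d) : Prop :=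
  forall p i U V g, S p -> interior_chart S p i U V g ->
    graph_gauss_curvature g (drop_coord i p) != 0.

Definition cylinder {R : realType} (d : nat) (S : set 'rV[R]_d)
  : set 'rV[R]_(d + 1) :=
  [set z | S (lsubmx z)].

Definition dotp {R : realType} (n : nat) (x y : 'rV[R]_n) : R :=
  \sum_(i < n) x 0 i * y 0 i.

Definition enorm {R : realType} (n : nat) (x : 'rV[R]_n) : R :=
  Num.sqrt (\sum_(i < n) x 0 i ^+ 2).

Definition BorelR (R : realType) (n : nat) :=
  g_sigma_algebraType (@open 'rV[R]_n).

(* real and imaginary parts of  mu^(xi) = \int e^{-2 pi i x.xi} dmu(x) *)
Definition fourier_re {R : realType} (n : nat)
  (mu : {measure set (BorelR R n) -> \bar R}) (xi : 'rV[R]_n) : R :=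
  Rintegral mu setT (fun x : BorelR R n => cos (2 * pi * dotp x xi)).

Definition fourier_im {R : realType} (n : nat)
  (mu : {measure set (BorelR R n) -> \bar R}) (xi : 'rV[R]_n) : R :=
  - Rintegral mu setT (fun x : BorelR R n => sin (2 * pi * dotp x xi)).

Definition fourier_abs {R : realType} (n : nat)
  (mu : {measure set (BorelR R n) -> \bar R}) (xi : 'rV[R]_n) : R :=
  Num.sqrt (fourier_re mu xi ^+ 2 + fourier_im mu xi ^+ 2).

(* supp mu (the closed support) is contained in A *)
Definition supported_on {R : realType} (n : nat)
  (mu : {measure set (BorelR R n) -> \bar R}) (A : set 'rV[R]_n) : Prop :=
  forall x : 'rV[R]_n,
    (forall U : set 'rV[R]_n, open U -> U x -> (0 < mu U)%E) -> A x.

Definition in_M {R : realType} (n : nat) (A : set 'rV[R]_n)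
  (mu : {measure set (BorelR R n) -> \bar R}) : Prop :=
  [/\ (mu setT < +oo)%E, mu setT != 0%E & supported_on mu A].

Definition fourier_exponents {R : realType} (n : nat) (A : set 'rV[R]_n)
  : set R :=
  [set s | 0 <= s <= n%:R /\
     exists mu : {measure set (BorelR R n) -> \bar R}, in_M A mu /\
       exists C : R, forall xi : 'rV[R]_n,
         enorm xi `^ (s / 2) * fourier_abs mu xi <= C].

Definition fourier_dim {R : realType} (n : nat) (A : set 'rV[R]_n) : \bar R :=
  ereal_sup [set s%:E | s in fourier_exponents A].

(* Main.v *)
Require Import Defs.
From HB Require Import structures.
From mathcomp Require Import all_boot all_order all_algebra.
From mathcomp Require Import all_classical all_reals all_analysis.
From mathcomp Require Import measurable_realfun.
From mathcomp Require Import ring lra zify.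
Set Implicit Arguments.
Unset Strict Implicit.
Unset Printing Implicit Defensive.
Import Order.TTheory GRing.Theory Num.Theory.
Import numFieldNormedType.Exports.
Local Open Scope classical_set_scope.
Local Open Scope ring_scope.

(** Write [d = n + 1].

    Lower bound.  Near a point of nonzero curvature [S] is the graph of some [g] with invertible
    Hessian.  Push a compactly supported density on [R^n * R] forward to the cylinder over this
    graph.  Its Fourier transform is an oscillatory integral with phase
    [x . eta + tau g(x)].  If [eta] dominates [tau], repeated integration by parts gives decay
    of order [n].  Otherwise Weyl differencing over a grid of about [tau^n] shifts [v] leaves
    correlations with phase [tau (g(x + v) - g(x))], whose gradient is of size [tau |v|];
    integrating these by parts and summing over the grid gives decay of order [s / 2] for
    every [s < n].

    Upper bound.  Suppose [mu] on the cylinder decays with exponent [s > n].  Summing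
    [|mu^(p - q)|^2] over integer frequencies [p], [q] in [[0, N)^d * {0}] bounds by
    [N^(2d - s)] the integral of the convolution of [mu] with a squared Dirichlet kernel.
    This convolution is at least of order [N^(2d) mu(A)] on every set [A] whose projection to
    [R^d] has diameter [O(1/N)].  Since [S] is covered locally by [O(N^n)] such sets, [mu]
    vanishes near every point of its support. *)

(** The dimension is a supremum, so the lower bound only needs exponents [s < n] and can afford a
    loss. This is why Weyl differencing can replace the sharp stationary phase estimate, which would
    need a normal form of the phase. Two shifts [D] grid steps apart have correlation [O(D^-n)];
    summed over an [n]-dimensional grid this costs a logarithm. Weakening it to [D^-s], and that to
    a product of one-dimensional weights, makes the sum factor over the coordinates. The energy sum
    of the upper bound is estimated with the same weights.

    The axial variable is harmless below, since [g] does not depend on it and a dominant axial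
    frequency falls under integration by parts. Above it is the obstacle: the cylinder has Hausdorff
    dimension [d], so comparison with Hausdorff dimension gives no more than [d]. Frequencies with
    last coordinate 0 see only the projection of [mu] to [R^d], which lives on a set of dimension
    [n]. *)

(** * Sup-norm topology and Borel sets of row vectors *)

Section rV_basics.
Variable R : realType.

Lemma rV_norm_le n (x : 'rV[R]_n) (r : R) : 0 <= r ->
  `|x| <= r <-> (forall i, `|x 0 i| <= r).
Proof.
move=> r0; rewrite [`|x|]mx_normrE; split => [h i|h].
  apply: le_trans h.
  exact: (le_bigmax_cond _ (fun ij : 'I_1 * 'I_n => `|x ij.1 ij.2|) (isT : xpredT (0, i))).
by apply/bigmax_leP; split => // -[a b] _ /=; rewrite (ord1 a).
Qed.

Lemma rV_norm_coord n (x : 'rV[R]_n) i : `|x 0 i| <= `|x|.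
Proof. by move: i; apply/rV_norm_le. Qed.

Lemma rV_norm_lt n (x : 'rV[R]_n) (r : R) : 0 < r ->
  `|x| < r <-> (forall i, `|x 0 i| < r).
Proof.
move=> r0; rewrite [`|x|]mx_normrE; split => [h i|h].
  apply: le_lt_trans h.
  exact: (le_bigmax_cond _ (fun ij : 'I_1 * 'I_n => `|x ij.1 ij.2|) (isT : xpredT (0, i))).
by apply/bigmax_ltP; split => // -[a b] _ /=; rewrite (ord1 a).
Qed.

Lemma openP_norm n (U : set 'rV[R]_n) :
  open U <-> (forall x, U x -> exists2 r : R, 0 < r & forall y, `|y - x| < r -> U y).
Proof.
rewrite openE; split => [oU x /oU|h x /h [r r0 hr]].
  rewrite /interior -nbhs_ballE => -[r /= r0 hr]; exists r => // y yx.
  by apply: hr; rewrite -ball_normE /= distrC.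
rewrite /interior -nbhs_ballE; exists r => //= y; rewrite -ball_normE /= => yx.
by apply: hr; rewrite distrC.
Qed.

Lemma continuousP_norm n (f : 'rV[R]_n -> R) (x : 'rV[R]_n) : {for x, continuous f} <->
  (forall e : R, 0 < e -> exists2 r : R, 0 < r & forall y, `|y - x| < r -> `|f y - f x| < e).
Proof.
split => [/cvgrPdist_lt fx e e0|h].
  have := fx e e0; rewrite -nbhs_ballE => -[r /= r0 hr]; exists r => // y yx.
  by rewrite distrC; apply: hr; rewrite -ball_normE /= distrC.
move=> A /nbhs_ballP [e /= e0 hA]; have [r r0 hr] := h e e0.
apply/nbhs_ballP; exists r => //= y; rewrite -ball_normE /= => yx.
by apply: hA; rewrite -ball_normE /= distrC; apply: hr; rewrite distrC.
Qed.

Lemma open_ball_norm n (c : 'rV[R]_n) (r : R) : open [set x | `|x - c| < r].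
Proof.
apply/openP_norm => x /= xr; exists (r - `|x - c|); rewrite ?subr_gt0// => y yx.
by rewrite -(subrKA x) (le_lt_trans (ler_normD _ _))// -ltrBrDr.
Qed.

Lemma closed_ball_norm n (c : 'rV[R]_n) (r : R) : closed [set x | `|x - c| <= r].
Proof.
rewrite -[X in closed X]setCK; apply: open_closedC; apply/openP_norm => x /= /negP.
rewrite -ltNge => xr; exists (`|x - c| - r); rewrite ?subr_gt0// => y yx.
apply/negP; rewrite -ltNge.
have : `|x - c| <= `|x - y| + `|y - c| by rewrite -{1}(subrKA y) ler_normD.
by rewrite (distrC x y); move: yx; lra.
Qed.

Lemma compact_ball_norm n (c : 'rV[R]_n) (r : R) : compact [set x | `|x - c| <= r].
Proof.
apply: bounded_closed_compact; last exact: closed_ball_norm.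
exists (`|c| + r); split; first exact: num_real.
move=> M ltM x /= xr; apply: le_trans (ltW ltM).
have : `|x| <= `|x - c| + `|c| by rewrite -{1}(subrK c x) ler_normD.
lra.
Qed.

Lemma open_measurableB n (U : set (BorelR R n)) : open (U : set 'rV[R]_n) -> measurable U.
Proof. by move=> oU; exact: sub_sigma_algebra. Qed.

Lemma closed_measurableB n (U : set (BorelR R n)) : closed (U : set 'rV[R]_n) -> measurable U.
Proof.
move=> oU; rewrite -[U]setCK; apply: measurableC; apply: open_measurableB.
exact: closed_openC.
Qed.

(** Reduces Borel measurability to countably many rational boxes. The inclusion of the box in [U] is
    part of each set, so the union can run over all pairs [(q, k)]: boxes not inside [U] contribute
    nothing. *)
Lemma open_bigcup_ball n (U : set 'rV[R]_n) : open U ->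
  U = \bigcup_(qk : 'rV[rat]_n * nat)
       [set y : 'rV[R]_n | (forall y : 'rV[R]_n, (forall i, `|y 0 i - ratr (qk.1 0 i)| < qk.2.+1%:R^-1) -> U y) /\
                (forall i, `|y 0 i - ratr (qk.1 0 i)| < qk.2.+1%:R^-1)].
Proof.
move=> /openP_norm oU; apply/seteqP; split => [x Ux|x [[q k] _ [/= h1 h2]]]; last exact: h1.
have [r r0 hr] := oU _ Ux.
have [k hk] : exists k, k.+1%:R^-1 < r / 2 :> R.
  have [k] := @ltr_add_invr R 0 (r / 2) ltac:(lra); rewrite add0r => hk; by exists k.
have k0 : 0 < k.+1%:R^-1 :> R by rewrite invr_gt0.
have hq i : exists q : rat, `|x 0 i - ratr q| < k.+1%:R^-1.
  move: k0; set e := _^-1 => k0; have lt : x 0 i - e < x 0 i + e by lra.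
  have [q] := rat_in_itvoo lt.
  rewrite in_itv /= => /andP[q1 q2]; exists q; rewrite ltr_norml; apply/andP; split; lra.
have [q Hq] := choice hq.
exists (\row_i q i, k) => //=; split => [y hy|i]; last by rewrite mxE.
apply: hr; apply/rV_norm_lt => // i.
have := hy i; rewrite !mxE => {}hy; have := Hq i => Hqi.
have : `|y 0 i - x 0 i| <= `|y 0 i - ratr (q i)| + `|x 0 i - ratr (q i)|.
  by rewrite (distrC (x 0 i)) -(subrKA (ratr (q i))) ler_normD.
by move: hk hy Hqi; set e := k.+1%:R^-1; lra.
Qed.

Lemma measurable_fun_rV d (T : measurableType d) n (f : T -> BorelR R n) :
  (forall i, measurable_fun setT (fun t => f t 0 i)) -> measurable_fun setT f.
Proof.
move=> mf; apply: (@measurability _ _ T (BorelR R n) setT f (@open 'rV[R]_n)) => //.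
move=> _ [U oU <-]; rewrite setTI (open_bigcup_ball oU).
rewrite preimage_bigcup; apply: countable_bigcupT_measurable => // -[q k] /=.
have [hU|hU] := pselect (forall y : 'rV[R]_n, (forall i, `|y 0 i - ratr (q 0 i)| < k.+1%:R^-1) -> U y).
- rewrite [X in measurable X](_ : _ = \bigcap_i
    ((fun t => f t 0 i) @^-1` [set` `](ratr (q 0 i) - k.+1%:R^-1 : R), (ratr (q 0 i) + k.+1%:R^-1)[])).
    apply: fin_bigcap_measurable => // i _; rewrite -[X in measurable X]setTI; exact: mf.
  apply/seteqP; split => [t /= [_ h] i _ /=|t h /=].
    by have := h i; rewrite in_itv /= ltr_distl.
  by split=> // i; have := h i Logic.I; rewrite /= in_itv /= ltr_distl.
- rewrite [X in measurable X](_ : _ = set0); first exact: measurable0.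
  by apply/seteqP; split => [t [] //|].
Qed.

Lemma open_continuous_measurableB n (D : set 'rV[R]_n) (f : 'rV[R]_n -> R) : open D ->
  (forall x, D x -> {for x, continuous f}) -> measurable_fun (D : set (BorelR R n)) f.
Proof.
move=> oD cf; apply: (@measurability _ _ (BorelR R n) (measurableTypeR R) D f _ (RGenOpens.measurableE R)) => _ [_ [a [b ->]] <-].
set U := `]a, b[%classic; have oU : open U by exact: interval_open.
apply: open_measurableB; apply/openP_norm => x [Dx Ux].
have := cf _ Dx => cfx.
have [r r0 hr] := (openP_norm _).1 oD _ Dx.
have : nbhs x (f @^-1` U).
  by apply: cfx; exact: open_nbhs_nbhs.
rewrite -nbhs_ballE => -[r' /= r'0 hr']; exists (Num.min r r'); first by rewrite lt_min r0 r'0.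
move=> y; rewrite lt_min => /andP[yr yr']; split; first exact: hr.
by apply: hr'; rewrite -ball_normE /= distrC.
Qed.

Lemma continuous_measurableB n (f : 'rV[R]_n -> R) :
  continuous f -> measurable_fun (setT : set (BorelR R n)) f.
Proof. move=> cf; have oT : open (setT : set 'rV[R]_n) by exact: openT.
by apply: (open_continuous_measurableB oT) => x _; exact: cf. Qed.

Lemma coord_measurableB n (i : 'I_n) : measurable_fun (setT : set (BorelR R n)) (fun x => x 0 i).
Proof. apply: continuous_measurableB; exact: coord_continuous. Qed.

End rV_basics.

(** * Lebesgue measure on row vectors and measures with a density *)

Definition image_measure d d' (T1 : measurableType d) (T2 : measurableType d') (R : realType)
  (m : {measure set T1 -> \bar R}) (f : T1 -> T2) (mf : measurable_fun setT f) :
  {measure set T2 -> \bar R}.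
Proof. refine [the measure T2 R of pushforward m f]; exact: mf. Defined.

(** The proof of sigma-finiteness is a parameter of the alias, so that the structure required by
    product measures can be inferred for a measure that comes out of an existential. *)
Definition sigma_finite_copy d (T : measurableType d) (R : realType)
  (mu : {measure set T -> \bar R}) (_ : sigma_finite setT mu) : set T -> \bar R := mu.

HB.instance Definition _ d (T : measurableType d) (R : realType)
  (mu : {measure set T -> \bar R}) (h : sigma_finite setT mu) :=
  Measure.on (sigma_finite_copy h).
HB.instance Definition _ d (T : measurableType d) (R : realType)
  (mu : {measure set T -> \bar R}) (h : sigma_finite setT mu) :=
  Measure_isSigmaFinite.Build _ _ _ (sigma_finite_copy h) h.

Section lebesgue_rV.
Variable R : realType.
Local Notation leb := (@lebesgue_measure R).

Lemma lebesgue_translation (v : R) (A : set (measurableTypeR R)) : measurable A ->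
  leb ((fun x => x + v) @^-1` A) = leb A.
Proof.
move=> mA.
have mf : measurable_fun setT ((fun x => x + v) : measurableTypeR R -> measurableTypeR R).
  exact: measurable_funD.
pose mu : {measure set (measurableTypeR R) -> \bar R} := 
  image_measure leb mf.
apply/esym; apply: (@lebesgue_measure_unique R mu) => // X [[a b] _ <-].
rewrite /mu /= /pushforward.
transitivity (leb `](a - v), (b - v)]%classic); last first.
  by congr (leb _); apply/seteqP; split => x /=; rewrite !in_itv /= ltrBlDr lerBrDr.
rewrite !lebesgue_measure_itv /= !lte_fin ltrD2r.
case: ifP => // _; rewrite -!EFinB; congr EFin; ring.
Qed.

Definition row_cons m (tx : (measurableTypeR R * BorelR R m)%type) : BorelR R m.+1 :=
  row_mx (const_mx tx.1 : 'M[R]_(1, 1)) tx.2 : 'rV[R]_(1 + m).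

Lemma row_cons0 m t : @row_cons m t 0 ord0 = t.1.
Proof.
rewrite /row_cons (_ : ord0 = lshift m (ord0 : 'I_1)); last exact/val_inj.
exact: (etrans (row_mxEl _ _ _ _) (mxE _ _ _ _)).
Qed.

Lemma row_consS m t (i : 'I_m) : @row_cons m t 0 (lift ord0 i) = t.2 0 i.
Proof.
rewrite /row_cons (_ : lift ord0 i = rshift 1 i); last exact/val_inj.
exact: row_mxEr.
Qed.

Lemma measurable_row_cons m : measurable_fun setT (@row_cons m).
Proof.
apply: measurable_fun_rV => i; case: (unliftP ord0 i) => [j ->|->].
  rewrite (_ : (fun t => row_cons t 0 (lift ord0 j)) = (fun x : 'rV[R]_m => x 0 j) \o snd); last first.
    by apply/funext => t /=; rewrite row_consS.
  apply: (@measurableT_comp _ _ _ _ _ _ (fun x : BorelR R m => (x : 'rV[R]_m) 0 j) _ snd).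
    exact: coord_measurableB.
  exact: measurable_snd.
rewrite (_ : (fun t => row_cons t 0 ord0) = fst); last by apply/funext => t; rewrite row_cons0.
exact: measurable_fst.
Qed.

Lemma measurable_translateB m (v : 'rV[R]_m) :
  measurable_fun setT ((fun x : 'rV[R]_m => x + v) : BorelR R m -> BorelR R m).
Proof.
apply: measurable_fun_rV => i.
rewrite (_ : (fun _ => _) = (fun x : 'rV_m => x 0 i + v 0 i)); last first.
  by apply/funext => t; rewrite mxE.
by apply: measurable_funD => //; exact: coord_measurableB.
Qed.

Definition translation_invariant m (mu : set (BorelR R m) -> \bar R) :=
  forall (v : 'rV[R]_m) (A : set (BorelR R m)), measurable A ->
  mu ((fun x : 'rV[R]_m => x + v) @^-1` A) = mu A.

(** Lebesgue measure, built by induction as a product and kept through three properties: invariance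
    yields integration by parts, finiteness on balls yields integrability, positivity on balls makes
    the density of the lower bound nonzero. *)
Lemma lebesgue_rV_exists m : exists mu : {measure set (BorelR R m) -> \bar R},
  [/\ translation_invariant mu,
      forall r : R, (mu [set x : 'rV[R]_m | `|x| <= r]%R < +oo)%E &
      forall r : R, 0 < r -> (0 < mu [set x : 'rV[R]_m | `|x| < r]%R)%E].
Proof.
elim: m => [|m [mu [tmu fmu pmu]]].
  (* In dimension 0 the space is a point and its measure is the Dirac mass. *)
  exists (@dirac _ (BorelR R 0) (0 : 'rV[R]_0) R); split => [v A mA|r|r r0].
  - rewrite /= !diracE; congr (_%:E); congr (_%:R); congr nat_of_bool.
    have -> : v = 0 by apply/matrixP => i [].
    by apply/idP/idP; rewrite !inE /= addr0.
  - by rewrite /= diracE ltry.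
  - rewrite /= diracE mem_set /= ?lte_fin ?ltr01//.
    by rewrite normr0.
have sfmu : sigma_finite setT mu.
  exists (fun k : nat => [set x : 'rV[R]_m | `|x| <= k%:R]).
    apply/seteqP; split => // x _; exists (Num.truncn `|x|).+1 => //=.
    by apply/ltW; rewrite truncnS_gt.
  move=> k; split; last exact: fmu.
  apply: closed_measurableB.
  have := @closed_ball_norm R m 0 k%:R; congr closed.
  by apply/funext => x /=; rewrite subr0.
pose mu' : {sigma_finite_measure set (BorelR R m) -> \bar R} :=
  [the {sigma_finite_measure set _ -> \bar R} of sigma_finite_copy sfmu].
have mu'E A : mu' A = mu A by [].
have mrc := @measurable_row_cons m.
pose pm := (leb \x mu')%E.
pose nu : {measure set (BorelR R m.+1) -> \bar R} := image_measure pm mrc.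
have nuE A : nu A = pm (@row_cons m @^-1` A) by [].
exists nu; split => [v A mA|r|r r0].
- rewrite !nuE.
  pose T (tx : (measurableTypeR R * BorelR R m)%type) : measurableTypeR R * BorelR R m :=
    (tx.1 + v 0 ord0, (tx.2 : 'rV[R]_m) + \row_i v 0 (lift ord0 i)).
  have mT : measurable_fun setT T.
    apply: measurable_fun_pair => /=.
      by apply: measurable_funD => //; exact: measurable_fst.
    apply: (@measurableT_comp _ _ _ _ _ _ (fun x : BorelR R m => (x : 'rV[R]_m) + \row_i v 0 (lift ord0 i) : BorelR R m)).
      exact: measurable_translateB.
    exact: measurable_snd.
  rewrite [X in pm X](_ : _ = T @^-1` (@row_cons m @^-1` A)); last first.
    apply/seteqP; suff rT : forall t, (@row_cons m t : 'rV_m.+1) + v = row_cons (T t).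
      by split => t /=; rewrite rT.
    move=> t; apply/rowP => i; rewrite mxE; case: (unliftP ord0 i) => [j ->|->].
      by rewrite !row_consS /= !mxE.
    by rewrite !row_cons0.
  pose m' : {measure set (measurableTypeR R * BorelR R m) -> \bar R} := image_measure pm mT.
  (* Uniqueness of product measures reduces invariance to rectangles, where it holds factor by
     factor. *)
  apply/esym; apply: (@product_measure_unique _ _ _ _ R leb mu' m'); last first.
    by rewrite -[X in measurable X]setTI; exact: measurable_row_cons.
  move=> B C mB mC; rewrite /m' -[LHS]/(pm (T @^-1` (B `*` C))).
  rewrite [X in pm X](_ : _ = ((fun x => x + v 0 ord0) @^-1` B) `*`
     ((fun x : 'rV[R]_m => x + \row_i v 0 (lift ord0 i)) @^-1` C)); last by apply/seteqP; split.
  rewrite /pm product_measure1E; last 2 first.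
    by rewrite -[X in measurable X]setTI; exact: measurable_funD.
    by rewrite -[X in measurable X]setTI; exact: measurable_translateB.
  congr (_ * _)%E; first exact: lebesgue_translation.
  by rewrite !mu'E; exact: tmu.
- have [r0|r0] := leP 0 r; last first.
    rewrite (_ : [set _ | _] = set0) ?measure0//.
    by apply/seteqP; split => // x /= xr; have := normr_ge0 x; lra.
  rewrite nuE [X in pm X](_ : _ = `[-r, r]%classic `*` [set x : 'rV[R]_m | `|x| <= r]).
    rewrite /pm product_measure1E//.
      have lf : leb `[-r, r]%classic \is a fin_num.
        by rewrite lebesgue_measure_itv /=; case: ifP.
      by apply: lte_mul_pinfty => //; exact: fmu.
    apply: closed_measurableB.
    have := @closed_ball_norm R m 0 r; congr closed.
    by apply/funext => x /=; rewrite subr0.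
  apply/seteqP; split => -[t x] /=.
    move=> /rV_norm_le h; have {}h := h r0; split.
      by have := h ord0; rewrite row_cons0 /= in_itv /= ler_norml.
    by apply/rV_norm_le => // i; have := h (lift ord0 i); rewrite row_consS.
  rewrite in_itv /= -ler_norml => -[h1 /rV_norm_le h2]; apply/rV_norm_le => // i.
  case: (unliftP ord0 i) => [j ->|->]; first by rewrite row_consS; exact: h2.
  by rewrite row_cons0.
- rewrite nuE [X in pm X](_ : _ = `]-r, r[%classic `*` [set x : 'rV[R]_m | `|x| < r]).
    rewrite /pm product_measure1E//.
      apply: mule_gt0; last exact: pmu.
      pose I : set R := `]-r, r[%classic; rewrite -/I -[X in (_ < X)%E]/(leb I).
      by rewrite lebesgue_measure_itv /= lte_fin ifT -?EFinB ?lte_fin; lra.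
    apply: open_measurableB.
    have := @open_ball_norm R m 0 r; congr open.
    by apply/funext => x /=; rewrite subr0.
  apply/seteqP; split => -[t x] /=.
    move=> /rV_norm_lt h; have {}h := h r0; split.
      by have := h ord0; rewrite row_cons0 /= in_itv /= ltr_norml.
    by apply/rV_norm_lt => // i; have := h (lift ord0 i); rewrite row_consS.
  rewrite in_itv /= -ltr_norml => -[h1 /rV_norm_lt h2]; apply/rV_norm_lt => // i.
  case: (unliftP ord0 i) => [j ->|->]; first by rewrite row_consS; exact: h2.
  by rewrite row_cons0.
Qed.

End lebesgue_rV.

Section density.
Import HBNNSimple.

(** On simple functions the formula is additivity over level sets; monotone convergence does the
    rest. *)
Lemma density_measure_exists d (T : measurableType d) (R : realType)
  (m : {measure set T -> \bar R}) (psi : T -> R) :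
  measurable_fun setT psi -> (forall x, 0 <= psi x) ->
  exists nu : {measure set T -> \bar R},
    (forall A, measurable A -> nu A = (\int[m]_(x in A) (psi x)%:E)%E) /\
    (forall f : T -> \bar R, measurable_fun setT f -> (forall x, (0 <= f x)%E) ->
      (\int[nu]_x f x = \int[m]_x (f x * (psi x)%:E))%E).
Proof.
move=> mpsi psi0.
have mE : measurable_fun setT (EFin \o psi) by exact/measurable_EFinP.
pose nu0 (A : set T) : \bar R := (\int[m]_(x in A) (psi x)%:E)%E.
have nu0_0 : nu0 set0 = 0%E by rewrite /nu0 integral_set0.
have nu0_ge0 A : (0 <= nu0 A)%E by apply: integral_ge0 => x _; rewrite lee_fin.
have nu0_add : semi_sigma_additive nu0.
  by apply: semi_sigma_additive_nng_induced => // x; rewrite lee_fin.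
pose nu : {measure set T -> \bar R} :=
  HB.pack nu0 (isMeasure.Build _ _ _ nu0 nu0_0 nu0_ge0 nu0_add).
exists nu; split => [A mA //|f mf f0].
pose f_ := nnsfun_approx measurableT mf.
have f_cvg x : (fun k => (f_ k x)%:E) @ \oo --> f x by exact: cvg_nnsfun_approx.
have f_nd x : {homo (fun k => (f_ k x)%:E) : a b / (a <= b)%N >-> (a <= b)%E}.
  by move=> a b ab; rewrite lee_fin; exact/lefP/nd_nnsfun_approx.
clearbody f_.
have nuE A : nu A = nu0 A by [].
clearbody nu.
have f_sfun k : (\int[nu]_x (f_ k x)%:E = \int[m]_x ((f_ k x)%:E * (psi x)%:E))%E.
  rewrite integralT_nnsfun sintegralE.
  transitivity (\int[m]_x (\sum_(r \in range (f_ k)) (r%:E * (\1_(f_ k @^-1` [set r]) x * psi x)%:E)))%E; last first.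
    apply: eq_integral => x _; rewrite fimfunE -fsumEFin// ge0_mule_fsuml//; last first.
      by move=> r; rewrite lee_fin; apply: nnfun_muleindic_ge0.
    by apply: eq_fsbigr => r _; rewrite !EFinM muleA.
  rewrite ge0_integral_fsum//; last 2 first.
  - move=> r; apply: measurable_funeM; apply/measurable_EFinP.
    by apply: measurable_funM => //; exact: measurable_indic.
  - move=> r x _; rewrite EFinM muleA.
    by apply: mule_ge0; [rewrite -EFinM; exact: nnfun_muleindic_ge0|rewrite lee_fin].
  apply: eq_fsbigr => r; rewrite inE => -[x _ <-].
  rewrite ge0_integralZl//; last 3 first.
  - apply/measurable_EFinP; apply: measurable_funM => //; exact: measurable_indic.
  - by move=> y _; rewrite lee_fin mulr_ge0.
  - by rewrite lee_fin.
  congr (_ * _)%E; rewrite nuE /nu0 integral_mkcond; apply: eq_integral => y _.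
  rewrite /patch indicE; case: ifP => yr; rewrite ?mul1r ?mul0r//.
transitivity (limn (fun k => \int[nu]_x (f_ k x)%:E))%E.
  rewrite -monotone_convergence//=; last 2 first.
  - by move=> k; exact/measurable_EFinP.
  - by move=> k x _; rewrite lee_fin.
  by apply: eq_integral => x _; rewrite (cvg_lim _ (f_cvg x)).
under [X in limn X]eq_fun do rewrite f_sfun.
rewrite -monotone_convergence//=; last 3 first.
- by move=> k; apply: emeasurable_funM => //; exact/measurable_EFinP.
- by move=> k x _; rewrite mule_ge0// lee_fin.
- by move=> x _ a b ab; rewrite lee_wpmul2r// ?lee_fin//; exact: f_nd.
apply: eq_integral => x _; apply/cvg_lim => //.
rewrite muleC; under eq_fun do rewrite muleC.
by apply: cvgeZl => //; exact: f_cvg.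
Qed.

End density.

(** * Integration by parts *)

Section directional_derivatives.
Variable R : realType.

(** Both difference quotients are the same function of [h]. One-variable calculus thus applies along
    a line, without total differentiability. *)
Lemma is_derive_lineP m (f : 'rV[R]_m -> R) (x v : 'rV[R]_m) (t : R) (df : R) :
  is_derive (x + t *: v) v f df <-> is_derive t 1 (fun s : R => f (x + s *: v)) df.
Proof.
have E : (fun h : R => h^-1 *: (((fun s : R => f (x + s *: v)) \o shift t) (h *: 1) - f (x + t *: v))) =
         (fun h : R => h^-1 *: ((f \o shift (x + t *: v)) (h *: v) - f (x + t *: v))).
  apply/funext => h /=; congr (_ *: (f _ - _)).
  by rewrite -[h *: 1]/(h * 1) mulr1 scalerDl addrCA.
by split => -[d1 d2]; split; move: d1 d2; rewrite /derivable /derive E.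
Qed.

Lemma is_derive_comp_real m (f : 'rV[R]_m -> R) (g : R -> R) (x v : 'rV[R]_m) (df dg : R) :
  is_derive (f x) 1 g dg -> is_derive x v f df -> is_derive x v (g \o f) (dg * df).
Proof.
move=> hg hf; have xE : x = x + 0 *: v by rewrite scale0r addr0.
rewrite xE; apply/is_derive_lineP.
apply: (@is_derive1_comp R g (fun s => f (x + s *: v))); first by rewrite -xE.
by apply/is_derive_lineP; rewrite -xE.
Qed.

(** The conditions on [s] say that it lies between 0 and [a], whatever the sign of [a]. *)
Lemma mvt_line m (f : 'rV[R]_m -> R) (x v : 'rV[R]_m) (a L : R) :
  (forall s : R, `|s| <= `|a| -> 0 <= s * a ->
     derivable f (x + s *: v) v /\ `|'D_v f (x + s *: v)| <= L) ->
  `|f (x + a *: v) - f x| <= L * `|a|.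
Proof.
pose F s := f (x + s *: v); pose dF s := 'D_v f (x + s *: v).
have key p q : p <= q -> (forall s, p <= s <= q -> derivable f (x + s *: v) v /\ `|'D_v f (x + s *: v)| <= L) ->
    `|F q - F p| <= L * (q - p).
  move=> pq H; have dFs s : p <= s <= q -> is_derive s 1 F (dF s).
    by move=> /H[d _]; apply/is_derive_lineP; exact: derivableP.
  have [||c cin ->] := @MVT_segment R F dF p q pq.
  - by move=> s; rewrite in_itv /= => /andP[s1 s2]; apply: dFs; rewrite !ltW.
  - apply: derivable_within_continuous => s; rewrite in_itv /= => sin.
    by have [] := dFs _ sin.
  rewrite normrM [X in _ * X]ger0_norm ?subr_ge0// ler_wpM2r ?subr_ge0//.
  by move: cin; rewrite in_itv /= => /H[].
have F0 : F 0 = f x by rewrite /F scale0r addr0.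
move=> H; have [a0|a0] := leP 0 a.
  have -> : `|a| = a - 0 by rewrite subr0 ger0_norm.
  rewrite -/(F a) -F0; apply: key => // s /andP[s0 sa].
  by apply: H; [rewrite ger0_norm// ger0_norm|exact: mulr_ge0].
have -> : `|a| = 0 - a by rewrite sub0r ltr0_norm.
rewrite -/(F a) -F0 distrC.
apply: key; first exact: ltW.
move=> s /andP[sa s0]; apply: H; first by rewrite ler0_norm// ltr0_norm// lerN2.
by rewrite mulr_le0// ltW.
Qed.

(** The coordinates of [x] are replaced by those of [y] one at a time. The intermediate points stay
    in the sup-norm ball because it is a box; each of the [n] moves costs at most [L |y - x|]. *)
Lemma lipschitz_ball n (f : 'rV[R]_n -> R) (c : 'rV[R]_n) (r L : R) : 0 <= L ->
  (forall x : 'rV[R]_n, `|x - c| <= r -> forall j, derivable f x (ev j) /\ `|partial j f x| <= L) ->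
  forall x y : 'rV[R]_n, `|x - c| <= r -> `|y - c| <= r -> `|f y - f x| <= n%:R * L * `|y - x|.
Proof.
move=> L0 H x y xr yr.
have r0 : 0 <= r by apply: le_trans xr.
pose z (k : nat) : 'rV[R]_n := \row_i (if (i < k)%N then y 0 i else x 0 i).
have z0 : z 0%N = x by apply/rowP => i; rewrite mxE.
have zn : z n = y by apply/rowP => i; rewrite mxE ltn_ord.
rewrite -{1}zn -{1}z0 -(telescope_sumr (fun k => f (z k)))// big_mkord.
apply: le_trans (ler_norm_sum _ _ _) _.
have -> : n%:R * L * `|y - x| = \sum_(k < n) (L * `|y - x|).
  by rewrite sumr_const card_ord -[RHS]mulr_natl mulrA.
apply: ler_sum => k _.
have zS : z k.+1 = z k + (y 0 k - x 0 k) *: ev k.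
  apply/rowP => i; rewrite !mxE eqxx /= ltnS; case: ltngtP => ik.
  - by rewrite (_ : (i == k) = false) ?mulr0 ?addr0// -val_eqE ltn_eqF.
  - by rewrite (_ : (i == k) = false) ?mulr0 ?addr0// -val_eqE gtn_eqF.
  - by rewrite (val_inj ik) eqxx mulr1 subrKC.
apply: le_trans (_ : L * `|y 0 k - x 0 k| <= _); last first.
  by rewrite ler_wpM2l//; have := rV_norm_coord (y - x) k; rewrite !mxE.
rewrite zS; apply: mvt_line => s s1 s2; apply: H.
have [xc yc] := ((rV_norm_le (x - c) r0).1 xr, (rV_norm_le (y - c) r0).1 yr).
apply/rV_norm_le => // i; have := xc i; have := yc i; rewrite !mxE eqxx /=.
case: (altP (i =P k)) => [->|ik]; last by rewrite mulr0 addr0; case: ifP.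
rewrite ltnn mulr1 !ler_norml => /andP[h1 h2] /andP[h3 h4].
have [d0|d0] := leP 0 (y 0 k - x 0 k).
  have [d1|d1] := ltP 0 (y 0 k - x 0 k); last first.
    have e0 : y 0 k - x 0 k = 0 by apply/eqP; rewrite eq_le d0 d1.
    have s0 : s = 0 by move: s1; rewrite e0 normr0 normr_le0 => /eqP.
    by rewrite s0 addr0; apply/andP; split; lra.
  have s0 : 0 <= s by move: s2; rewrite pmulr_lge0.
  move: s1; rewrite !ger0_norm// => s1.
  by apply/andP; split; lra.
have s0 : s <= 0 by move: s2; rewrite nmulr_lge0.
move: s1; rewrite ler0_norm// ltr0_norm// => s1.
by apply/andP; split; lra.
Qed.

Lemma near_eq_continuous m (f g : 'rV[R]_m -> R) (x : 'rV[R]_m) :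
  (\forall y \near x, f y = g y) -> {for x, continuous f} -> {for x, continuous g}.
Proof.
move=> h; have h2 := nbhs_singleton h; rewrite /prop_for /continuous_at -h2 => hf.
by apply: cvg_trans hf; exact: (@near_eq_cvg _ _ (nbhs x) (nbhs_filter x)).
Qed.

End directional_derivatives.

Section amplitudes.
Variables (R : realType) (m : nat).
Variables (B O : set 'rV[R]_m) (v : 'rV[R]_m).
Hypotheses (cB : closed B) (oO : open O) (BO : B `<=` O).
Local Notation D := (fun f : 'rV[R]_m -> R => fun x => 'D_v f x).

(** A [C^k] bound in the single direction [v], for functions supported in [B]: repeated integration
    by parts never leaves that direction. *)
Fixpoint amplitude (k : nat) (M : R) (a : 'rV[R]_m -> R) : Prop :=
  [/\ forall x, ~ B x -> a x = 0, continuous a, forall x, `|a x| <= M &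
   if k is k'.+1 then (forall x, derivable a x v) /\ amplitude k' M (D a) else True].

(** The same bound on the open set [O] alone. Nothing is asked outside, where the graph function may
    be undefined; products with an amplitude vanish there. *)
Fixpoint multiplier (k : nat) (M : R) (c : 'rV[R]_m -> R) : Prop :=
  [/\ forall x, O x -> {for x, continuous c}, forall x, O x -> `|c x| <= M &
   if k is k'.+1 then (forall x, O x -> derivable c x v) /\ multiplier k' M (D c) else True].

Lemma amplitudeW k M a : amplitude k.+1 M a -> amplitude k M a.
Proof. by elim: k M a => [|k IH] M a [? ? ? [? ?]]; split => //; split => //; exact: IH. Qed.

Lemma multiplierW k M a : multiplier k.+1 M a -> multiplier k M a.
Proof. by elim: k M a => [|k IH] M a [? ? [? ?]]; split => //; split => //; exact: IH. Qed.

Lemma amplitude0 k M a : amplitude k M a -> amplitude 0 M a.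
Proof. by elim: k => [//|k IH] /amplitudeW. Qed.

Lemma multiplier0 k M a : multiplier k M a -> multiplier 0 M a.
Proof. by elim: k => [//|k IH] /multiplierW. Qed.

Lemma amplitude_le k M M' a : M <= M' -> amplitude k M a -> amplitude k M' a.
Proof.
move=> MM; elim: k a => [|k IH] a [h1 h2 h3 h4]; split => //; try by move=> x; exact: le_trans (h3 x) MM.
by case: h4 => h5 h6; split => //; exact: IH.
Qed.

Lemma multiplier_le k M M' a : M <= M' -> multiplier k M a -> multiplier k M' a.
Proof.
move=> MM; elim: k a => [|k IH] a [h1 h2 h4]; split => //; try by move=> x Ox; exact: le_trans (h2 x Ox) MM.
by case: h4 => h5 h6; split => //; exact: IH.
Qed.

Lemma near_O x : O x -> \forall y \near x, O y.
Proof. by move=> Ox; exact: open_nbhs_nbhs. Qed.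

Lemma near_notB x : ~ B x -> \forall y \near x, ~ B y.
Proof. by move=> Bx; apply: (@open_nbhs_nbhs _ x (~` B)); split => //; exact: closed_openC. Qed.

Lemma multiplier_ext k M c c' : (forall x, O x -> c x = c' x) ->
  multiplier k M c -> multiplier k M c'.
Proof.
have nearE (f g : 'rV[R]_m -> R) : (forall x, O x -> f x = g x) -> forall x, O x -> \forall y \near x, f y = g y.
  move=> fg x Ox; have := near_O Ox; apply: filterS => y; exact: fg.
have ctn (f g : 'rV[R]_m -> R) x : (forall x, O x -> f x = g x) -> O x -> {for x, continuous f} -> {for x, continuous g}.
  by move=> fg Ox; apply: near_eq_continuous; exact: nearE.
elim: k c c' => [|k IH] c c' cc' [h1 h2 h3]; split => //.
- by move=> x Ox; apply: ctn (h1 x Ox).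
- by move=> x Ox; rewrite -cc'//; exact: h2.
- by move=> x Ox; apply: ctn (h1 x Ox).
- by move=> x Ox; rewrite -cc'//; exact: h2.
case: h3 => h3 h4; split.
  by move=> x Ox; apply: (near_eq_derivable (f := c)) (h3 x Ox); exact: nearE.
apply: IH h4 => x Ox; apply: near_eq_derive; exact: nearE.
Qed.

Lemma amplitudeD k M M' a b : amplitude k M a -> amplitude k M' b ->
  amplitude k (M + M') (fun x => a x + b x).
Proof.
elim: k a b => [|k IH] a b [h1 h2 h3 h4] [g1 g2 g3 g4]; split.
all: try by move=> x Bx; rewrite h1// g1// addr0.
all: try by move=> x; exact: (continuousD (h2 x) (g2 x)).
all: try by move=> x; rewrite (le_trans (ler_normD _ _))// lerD.
all: try by [].
case: h4 g4 => h4 h5 [g4 g5]; split; first by move=> x; apply: derivableD.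
have -> : D (fun x => a x + b x) = (fun x => D a x + D b x).
  by apply/funext => x; rewrite deriveD.
exact: IH.
Qed.

Lemma multiplierD k M M' a b : multiplier k M a -> multiplier k M' b ->
  multiplier k (M + M') (fun x => a x + b x).
Proof.
elim: k a b => [|k IH] a b [h2 h3 h4] [g2 g3 g4]; split.
all: try by move=> x Ox; exact: (continuousD (h2 x Ox) (g2 x Ox)).
all: try by move=> x Ox; rewrite (le_trans (ler_normD _ _))// lerD// ?h3// g3.
all: try by [].
case: h4 g4 => h4 h5 [g4 g5]; split; first by move=> x Ox; apply: derivableD; [exact: h4|exact: g4].
apply: multiplier_ext (IH _ _ h5 g5) => x Ox.
by rewrite -deriveD//; [exact: h4|exact: g4].
Qed.

Lemma multiplier_cst k (c : R) : multiplier k `|c| (fun=> c).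
Proof.
elim: k c => [|k IH] c; split => //; try by move=> x _; exact: cst_continuous.
split; first by move=> x _; exact: derivable_cst.
have -> : D (fun=> c) = (fun=> 0) by apply/funext => x; rewrite derive_cst.
by apply: multiplier_le (IH 0); rewrite normr0.
Qed.

(** Each order of differentiation doubles the number of Leibniz terms, whence [2 ^+ k]. *)
Lemma multiplierM k M M' a b : multiplier k M a -> multiplier k M' b ->
  multiplier k (2 ^+ k * (M * M')) (fun x => a x * b x).
Proof.
elim: k M M' a b => [|k IH] M M' a b; move=> [h2 h3 h4] [g2 g3 g4]; split.
all: try by move=> x Ox; exact: (continuousM (h2 x Ox) (g2 x Ox)).
- by move=> x Ox; rewrite expr0 mul1r normrM ler_pM// ?h3// g3.
- by [].
- move=> x Ox; rewrite normrM (le_trans (ler_pM _ _ (h3 x Ox) (g3 x Ox)))//.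
  rewrite ler_peMl ?exprn_ege1// ?ler1n// mulr_ge0//.
    by apply: le_trans (h3 x Ox).
  by apply: le_trans (g3 x Ox).
case: h4 g4 => h4 h5 [g4 g5]; split; first by move=> x Ox; apply: derivableM; [exact: h4|exact: g4].
have ha : multiplier k M a by apply: multiplierW; split.
have hb : multiplier k M' b by apply: multiplierW; split.
rewrite exprS -mulrA mulr_natl mulr2n.
apply: multiplier_ext (multiplierD (IH _ _ _ _ ha g5) (IH _ _ _ _ h5 hb)) => x Ox.
by rewrite deriveM; [rewrite /GRing.scale /=; ring|exact: h4|exact: g4].
Qed.

(** The bound is fixed before [c], since the later estimates must be uniform over all frequencies.
    The induction writes the derivative of [1 / c] as the product of [-1], ['D_v c] and two copies
    of [1 / c]. *)
Lemma multiplierV k (M c0 : R) : 0 < c0 -> exists M', forall c, multiplier k M c ->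
  (forall x, O x -> c0 <= `|c x|) -> multiplier k M' (fun x => (c x)^-1).
Proof.
move=> c00.
have nz (c : 'rV[R]_m -> R) x : (forall x, O x -> c0 <= `|c x|) -> O x -> c x != 0.
  by move=> h /h; rewrite -normr_gt0; exact: lt_le_trans.
have bd (c : 'rV[R]_m -> R) x : (forall x, O x -> c0 <= `|c x|) -> O x -> `|(c x)^-1| <= c0^-1.
  move=> h Ox; rewrite normfV lef_pV2//; first exact: h.
  by rewrite posrE (lt_le_trans c00)// h.
elim: k => [|k [M' IH]].
  exists c0^-1 => c [h1 h2 _] h; split => // x Ox; last exact: bd.
  by apply: continuousV; [exact: nz|exact: h1].
exists (Num.max c0^-1 (2 ^+ k * ((2 ^+ k * (`|-1| * M)) * (2 ^+ k * (M' * M'))))) => c hc h.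
have hV := IH c (multiplierW hc) h.
case: hc => h1 h2 [h3 h4]; split.
- by move=> x Ox; apply: continuousV; [exact: nz|exact: h1].
- by move=> x Ox; rewrite le_max bd.
split; first by move=> x Ox; apply: derivableV; [exact: nz|exact: h3].
have := multiplierM (multiplierM (multiplier_cst k (-1)) h4) (multiplierM hV hV).
move=> /(multiplier_le (_ : _ <= Num.max c0^-1 _)) H.
apply: multiplier_ext (H _ _); last by rewrite le_max lexx orbT.
move=> x Ox; rewrite deriveV; [|exact: nz|exact: h3].
rewrite mulN1r -exprVn expr2 /GRing.scale /=; ring.
Qed.

(** Off [O] the multiplier is arbitrary, but the product vanishes in a whole neighbourhood because
    [B] is closed and contained in [O]. *)
Lemma amplitudeM_derivable k a c M M' : amplitude k.+1 M a -> multiplier k.+1 M' c ->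
  forall x, is_derive x v (fun x => a x * c x) ('D_v a x * c x + a x * 'D_v c x).
Proof.
move=> [h1 h2 h3 [h4 /amplitude0[h5 _ _ _]]] [g1 g2 [g3 _]] x.
have [Ox|Ox] := pselect (O x).
  split; first by apply: derivableM => //; exact: g3.
  rewrite deriveM; [rewrite /GRing.scale /=; ring|exact: h4|exact: g3].
have Bx : ~ B x by move=> /BO.
rewrite h1// h5// !mul0r addr0.
have h0 : is_derive x v (fun _ : 'rV[R]_m => 0 : R) 0.
  by split; [exact: (derivable_cst (0 : R))|exact: (derive_cst (0 : R))].
apply: near_eq_is_derive h0.
by have := near_notB Bx; apply: filterS => y /= By; rewrite h1// mul0r.
Qed.

Lemma amplitude_ge0 k M a : amplitude k M a -> 0 <= M.
Proof. by case: k => [|k] [_ _ h _]; exact: le_trans (h 0). Qed.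

Lemma amplitudeM k M M' a c : 0 <= M' -> amplitude k M a -> multiplier k M' c ->
  amplitude k (2 ^+ k * (M * M')) (fun x => a x * c x).
Proof.
have ctn (a' c' : 'rV[R]_m -> R) : (forall x, ~ B x -> a' x = 0) -> continuous a' ->
  (forall x, O x -> {for x, continuous c'}) -> continuous (fun x : 'rV[R]_m => a' x * c' x).
  move=> h1 h2 h3 x; have [Ox|Ox] := pselect (O x).
    exact: (continuousM (h2 x) (h3 x Ox)).
  have Bx : ~ B x by move=> /BO.
  apply: (near_eq_continuous (f := cst 0)); last exact: cst_continuous.
  by have := near_notB Bx; apply: filterS => y /= By; rewrite h1// mul0r.
have bnd (a' c' : 'rV[R]_m -> R) (M1 M2 : R) : 0 <= M2 -> (forall x, ~ B x -> a' x = 0) ->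
   (forall x, `|a' x| <= M1) ->
   (forall x, O x -> `|c' x| <= M2) -> forall x, `|a' x * c' x| <= M1 * M2.
  move=> M20 h1 h2 h3 x; rewrite normrM; have [Ox|Ox] := pselect (O x).
    by apply: ler_pM => //; exact: h3.
  rewrite h1 ?normr0 ?mul0r ?mulr_ge0//; last by move=> /BO.
  exact: le_trans (h2 x).
move=> M'0; elim: k M a c => [|k IH] M a c ha hc; have M0 := amplitude_ge0 ha.
  case: ha hc => [h1 h2 h3 _] [g1 g2 _]; split => //.
  - by move=> x Bx; rewrite h1// mul0r.
  - exact: ctn.
  - by move=> x; rewrite expr0 mul1r; exact: bnd.
have dac := amplitudeM_derivable ha hc.
have [ha' hc'] := (amplitudeW ha, multiplierW hc).
case: ha hc => [h1 h2 h3 [h4 h5]] [g1 g2 [g3 g4]]; split => //.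
- by move=> x Bx; rewrite h1// mul0r.
- exact: ctn.
- move=> x; rewrite (le_trans (bnd _ _ _ _ M'0 h1 h3 g2 x))//.
  by rewrite ler_peMl ?exprn_ege1// ?ler1n// mulr_ge0.
split; first by move=> x; have [] := dac x.
have -> : D (fun x => a x * c x) = (fun x => D a x * c x + a x * D c x).
  by apply/funext => x; have [_] := dac x.
by rewrite exprS -mulrA mulr_natl mulr2n; apply: amplitudeD; exact: IH.
Qed.

End amplitudes.

Section compact_integrals.
Variables (R : realType) (m : nat).
Variable lam : {measure set (BorelR R m) -> \bar R}.
Hypothesis lam_trans : translation_invariant lam.
Hypothesis lam_fin : forall r : R, (lam [set x : 'rV[R]_m | (`|x| <= r)%R] < +oo)%E.
Implicit Types (a : 'rV[R]_m -> R) (r M : R).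

Definition nice r M a :=
  [/\ continuous a, forall x, r < `|x| -> a x = 0 & forall x, `|a x| <= M].

Let ball0 r : set (BorelR R m) := [set x : 'rV[R]_m | `|x| <= r].

Definition vol r : R := fine (lam (ball0 r)).

Lemma measurable_ball0 r : measurable (ball0 r).
Proof.
apply: closed_measurableB; have := @closed_ball_norm R m 0 r; congr closed.
by apply/funext => x /=; rewrite subr0.
Qed.

Lemma vol_ge0 r : 0 <= vol r.
Proof. by rewrite /vol fine_ge0. Qed.

Lemma nice_measurable r M a : nice r M a -> measurable_fun (setT : set (BorelR R m)) a.
Proof. by move=> [h _ _]; exact: continuous_measurableB. Qed.

Lemma nice_patch r M a : nice r M a -> (a : BorelR R m -> R) \_ (ball0 r) = a.
Proof.
move=> [_ h _]; apply/funext => x; rewrite /patch; case: ifPn => //.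
by rewrite notin_setE /ball0 /= => /negP; rewrite -ltNge => /h ->.
Qed.

Lemma nice_integrable_ball r M a : nice r M a -> lam.-integrable (ball0 r) (EFin \o a).
Proof.
move=> na; apply: measurable_bounded_integrable.
- exact: measurable_ball0.
- exact: lam_fin.
- exact: measurable_funTS (nice_measurable na).
- case: na => _ _ h; exists M; split; first exact: num_real.
  by move=> M' MM' x _; apply: le_trans (h x) (ltW MM').
Qed.

Lemma cst_integrable_ball r (c : R) : lam.-integrable (ball0 r) (EFin \o fun=> c).
Proof.
apply: measurable_bounded_integrable => //; first exact: measurable_ball0.
  exact: lam_fin.
by exists `|c|; split => [|M' MM' x _]; [exact: num_real|exact: ltW].
Qed.

Lemma nice_integrable r M a : nice r M a -> lam.-integrable setT (EFin \o a).
Proof.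
move=> na; rewrite (_ : EFin \o a = (EFin \o a) \_ (ball0 r)).
  by apply/(integrable_mkcond _ (measurable_ball0 r)); exact: nice_integrable_ball na.
by rewrite restrict_EFin (nice_patch na).
Qed.

Lemma nice_Rintegral_ball r M a : nice r M a ->
  \int[lam]_x a x = \int[lam]_(x in ball0 r) a x.
Proof. by move=> na; rewrite [RHS]Rintegral_mkcond (nice_patch na). Qed.

Lemma nice_Rintegral_le r M a : nice r M a -> `|\int[lam]_x a x| <= M * vol r.
Proof.
move=> na; rewrite (nice_Rintegral_ball na).
apply: le_trans (le_normr_Rintegral _ _) _.
- exact: measurable_ball0.
- exact: nice_integrable_ball na.
have -> : M * vol r = \int[lam]_(x in ball0 r) M.
  by rewrite Rintegral_cst//; exact: measurable_ball0.
apply: le_Rintegral.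
- exact: measurable_ball0.
- have := nice_integrable_ball na => /integrable_abse; exact.
- exact: cst_integrable_ball.
- by move=> x _; case: na.
Qed.

Lemma niceD r M M' a b : nice r M a -> nice r M' b -> nice r (M + M') (fun x => a x + b x).
Proof.
move=> [h1 h2 h3] [g1 g2 g3]; split.
- by move=> x; exact: (continuousD (h1 x) (g1 x)).
- by move=> x rx; rewrite h2// g2// addr0.
- by move=> x; rewrite (le_trans (ler_normD _ _))// lerD.
Qed.

Lemma niceM r r' M M' a b : nice r M a -> nice r' M' b -> nice r (M * M') (fun x => a x * b x).
Proof.
move=> [h1 h2 h3] [g1 g2 g3]; split.
- by move=> x; exact: (continuousM (h1 x) (g1 x)).
- by move=> x rx; rewrite h2// mul0r.
- by move=> x; rewrite normrM ler_pM.
Qed.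

Lemma niceZ r M a (c : R) : nice r M a -> nice r (`|c| * M) (fun x => c * a x).
Proof.
move=> [h1 h2 h3]; split.
- by move=> x; apply: continuousM; [exact: cst_continuous|exact: h1].
- by move=> x rx; rewrite h2// mulr0.
- by move=> x; rewrite normrM ler_wpM2l.
Qed.

Lemma nice_translate r M a h : nice r M a -> nice (r + `|h|) M (fun x => a (x + h)).
Proof.
move=> [h1 h2 h3]; split => //.
- move=> x; apply/continuousP_norm => e e0.
  have [d d0 hd] := (continuousP_norm _ _).1 (h1 (x + h)) e e0.
  by exists d => // y yx; apply: hd; rewrite opprD addrACA subrr addr0.
- move=> x rx; apply: h2; rewrite -(ltrD2r `|h|) (lt_le_trans rx)//.
  by rewrite -{1}(addrK h x) (le_trans (ler_normB _ _)).
Qed.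

Lemma nice_le r r' M M' a : r <= r' -> M <= M' -> nice r M a -> nice r' M' a.
Proof.
move=> rr MM [h1 h2 h3]; split => // [x rx|x]; first exact/h2/le_lt_trans/rx.
exact: le_trans (h3 x) MM.
Qed.

Lemma Rintegral_translate r M a h : nice r M a ->
  \int[lam]_x a (x + h) = \int[lam]_x a x.
Proof.
move=> na; rewrite /Rintegral; congr fine.
have mh := @measurable_translateB R m h.
have ma : measurable_fun (setT : set (BorelR R m)) (EFin \o a).
  by apply/measurable_EFinP; exact: nice_measurable na.
have := @integral_pushforward _ _ _ _ R _ mh lam setT (EFin \o a) ma _ measurableT.
rewrite preimage_setT => <-; last exact: nice_integrable (nice_translate h na).
apply: eq_measure_integral => A mA _; exact: lam_trans.
Qed.

Lemma Rintegral_nice_sum (I : finType) (F : I -> 'rV[R]_m -> R) (r : R) (M : I -> R) :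
  (forall i, nice r (M i) (F i)) ->
  nice r (\sum_i M i) (fun x => \sum_i F i x) /\
  \int[lam]_x (\sum_i F i x) = \sum_i \int[lam]_x F i x.
Proof.
move=> H.
have key s : nice r (\sum_(i <- s) M i) (fun x => \sum_(i <- s) F i x) /\
    \int[lam]_x (\sum_(i <- s) F i x) = \sum_(i <- s) \int[lam]_x F i x.
  elim: s => [|i s [IH1 IH2]].
    rewrite !big_nil; under eq_fun do rewrite big_nil.
    split; last by rewrite Rintegral_cst// mul0r.
    by split => // [x|x]; [exact: cst_continuous|rewrite normr0].
  have E : (fun x => \sum_(i0 <- i :: s) F i0 x) = (fun x => F i x + \sum_(i0 <- s) F i0 x).
    by apply/funext => x; rewrite big_cons.
  rewrite E !big_cons; split; first exact: niceD.
  rewrite -IH2 RintegralD//; [exact: nice_integrable (H i)|exact: nice_integrable IH1].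
exact: key.
Qed.

(** Nonnegativity of the variance on the ball: [(a - c)^2] is integrated with [c] the mean of
    [a]. *)
Lemma Rintegral_Cauchy_Schwarz r M a : nice r M a ->
  (\int[lam]_x a x) ^+ 2 <= vol r * \int[lam]_x (a x ^+ 2).
Proof.
move=> na; have na2 := niceM na na.
have [v0|v0] := eqVneq (vol r) 0.
  have := nice_Rintegral_le na; rewrite v0 mulr0 normr_le0 => /eqP ->.
  by rewrite expr0n /= mul0r.
have vp : 0 < vol r by rewrite lt_neqAle eq_sym v0 vol_ge0.
set I := \int[lam]_x a x; pose c := I / vol r.
have mB := measurable_ball0 r.
have ia : lam.-integrable (ball0 r) (EFin \o a) by exact: nice_integrable_ball na.
have ia2 : lam.-integrable (ball0 r) (EFin \o (fun x => a x ^+ 2)).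
  by apply: nice_integrable_ball na2.
have ic : lam.-integrable (ball0 r) (EFin \o (fun=> c ^+ 2)).
  by exact: cst_integrable_ball.
have iac : lam.-integrable (ball0 r) (EFin \o (fun x => (- (2 * c)) * a x)).
  exact: nice_integrable_ball (niceZ _ na).
have : 0 <= \int[lam]_(x in ball0 r) ((a x ^+ 2 + (- (2 * c)) * a x) + c ^+ 2).
  apply: Rintegral_ge0 => x _.
  by rewrite [X in 0 <= X](_ : _ = (a x - c) ^+ 2) ?sqr_ge0//; ring.
rewrite RintegralD//; last exact: nice_integrable_ball (niceD na2 (niceZ _ na)).
rewrite RintegralD// RintegralZl// Rintegral_cst//.
rewrite -(nice_Rintegral_ball na) -(nice_Rintegral_ball na2) -/I -/(vol r).
under [X in _ -> _ <= _ * X]eq_Rintegral do rewrite expr2.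
set J := \int[lam]_x _.
rewrite [X in 0 <= X](_ : _ = J - I ^+ 2 / vol r); last by rewrite /c; field.
by rewrite subr_ge0 ler_pdivrMr// mulrC.
Qed.

(** By invariance the difference quotients along [v] have integral zero. The mean value theorem
    bounds them by [M], so dominated convergence passes to the derivative. *)
Lemma Rintegral_derive r M a v : nice r M a -> (forall x, derivable a x v) ->
  nice r M (fun x => 'D_v a x) -> \int[lam]_x 'D_v a x = 0.
Proof.
move=> na da nda.
have M0 : 0 <= M by case: na => _ _ h; exact: le_trans (h 0).
pose t k : R := k.+1%:R^-1.
have t0 k : 0 < t k by rewrite invr_gt0.
(* Increments of at most 1 keep every quotient supported in the ball of radius [r + |v|], so that a
   single dominating function serves. *)
have t1 k : t k <= 1 by rewrite invf_le1// ler1n.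
pose r' := r + `|v|.
pose f k (x : BorelR R m) : R := (t k)^-1 * (a ((x : 'rV[R]_m) + t k *: v) + (-1) * a x).
have rr' k : r + `|t k *: v| <= r'.
  by rewrite lerD2l normrZ (gtr0_norm (t0 k)) ler_piMl.
have nf k : exists M', nice r' M' (f k).
  eexists; apply: niceZ; apply: niceD; last first.
    by apply: (nice_le _ (lexx _) (niceZ _ na)); rewrite lerDl.
  exact: (nice_le (rr' k) (lexx _) (nice_translate _ na)).
have fb k x : `|f k x| <= M.
  rewrite /f mulN1r normrM gtr0_norm ?invr_gt0// mulrC ler_pdivrMr//.
  rewrite -[X in _ <= _ * X]gtr0_norm//; apply: mvt_line => s _ _; split; first exact: da.
  by case: nda.
have f0 k : \int[lam]_x f k x = 0.
  have nt := nice_translate (t k *: v) na.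
  rewrite /f RintegralZl//; last first.
    apply: nice_integrable; apply: (niceD (nice_le (rr' k) (lexx _) nt)).
    by apply: (nice_le _ (lexx _) (niceZ _ na)); rewrite lerDl.
  rewrite RintegralD//; [|exact: nice_integrable nt|exact: nice_integrable (niceZ _ na)].
  rewrite RintegralZl//; last exact: nice_integrable na.
  by rewrite (Rintegral_translate _ na) mulN1r subrr mulr0.
have cvf x : (fun k => f k x) @ \oo --> 'D_v a x.
  have := da x => /cvg_ex [l hl].
  have -> : 'D_v a x = l by apply/cvg_lim.
  move/cvgrPdist_lt : hl => hl; apply/cvgrPdist_lt => e e0.
  have := hl e e0 => /nbhs_ballP [d /= d0 hd].
  near=> k.
  have := hd (t k); rewrite /ball /= sub0r normrN gtr0_norm// => /(_ _ _).
  rewrite /f mulN1r /GRing.scale /= [_ *: v + x]addrC; apply.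
    near: k; exact: (near_infty_natSinv_lt (PosNum d0)).
  by rewrite gt_eqF.
have [|||||_ _ H] := @dominated_convergence _ _ R lam setT measurableT
  (fun k x => (f k x)%:E) (fun x => ('D_v a x)%:E) (fun x => (M * \1_(ball0 r') x)%:E).
- move=> k; have [M' nk] := nf k; apply/measurable_EFinP; exact: nice_measurable nk.
- apply/measurable_EFinP; exact: nice_measurable nda.
- by apply: aeW => x _; apply: cvg_EFin; [exact: nearW|exact: cvf].
- rewrite (_ : (fun _ => _) = (EFin \o fun=> M) \_ (ball0 r')).
    by apply/(integrable_mkcond _ (measurable_ball0 r')); exact: cst_integrable_ball.
  apply/funext => x; rewrite /patch indicE.
  by case: (x \in ball0 r'); rewrite /= ?mulr1 ?mulr0.
- apply: aeW => x k _; rewrite lee_fin indicE.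
  have [xr|xr] := leP `|x : 'rV[R]_m| r'.
    by rewrite mem_set// mulr1; exact: fb.
  have [M' [_ h _]] := nf k; rewrite h// normr0 mulr_ge0//.
rewrite /Rintegral (_ : integral _ _ _ = 0%E)//.
apply/esym; apply: (cvg_unique _ _ H) => //.
rewrite (_ : [sequence _]_n = cst 0%E); first exact: cvg_cst.
apply/funext => k /=; have [M' nk] := nf k.
have := f0 k; rewrite /Rintegral => h0.
have := integrable_fin_num measurableT (nice_integrable nk) => /fineK <-.
by rewrite h0.
Unshelve. all: by end_near. Qed.

End compact_integrals.

Section translations.
Variables (R : realType) (m : nat).

Lemma is_derive_translate (f : 'rV[R]_m -> R) (h x v : 'rV[R]_m) (df : R) :
  is_derive (x + h) v f df <-> is_derive x v (fun x => f (x + h)) df.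
Proof.
have E : (fun t : R => t^-1 *: (((fun x => f (x + h)) \o shift x) (t *: v) - f (x + h))) =
         (fun t : R => t^-1 *: ((f \o shift (x + h)) (t *: v) - f (x + h))).
  by apply/funext => t /=; rewrite addrA.
by split => -[d1 d2]; split; move: d1 d2; rewrite /derivable /derive E.
Qed.

Lemma continuous_translate (f : 'rV[R]_m -> R) (h x : 'rV[R]_m) :
  {for (x + h : 'rV[R]_m), continuous f} ->
  {for x, continuous (fun x : 'rV[R]_m => f (x + h))}.
Proof.
move=> /continuousP_norm H; apply/continuousP_norm => e e0.
have [d d0 hd] := H e e0; exists d => // y yx.
by apply: hd; rewrite opprD addrACA subrr addr0.
Qed.

(** A translate may leave [B], so it is kept as a multiplier only; its product with an amplitude is
    again supported in [B]. *)
Lemma amplitude_translate B O v k M a (h : 'rV[R]_m) : amplitude B v k M a ->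
  multiplier O v k M (fun x => a (x + h)).
Proof.
elim: k a => [|k IH] a [h1 h2 h3 h4]; split => //; try by move=> x _; apply: continuous_translate; exact: h2.
case: h4 => h4 h5.
have dE x : is_derive x v (fun x => a (x + h)) ('D_v a (x + h)).
  by apply/is_derive_translate; exact: derivableP.
split; first by move=> x _; have [] := dE x.
have := IH _ h5; congr (multiplier O v k M).
by apply/funext => x; have [_] := dE x.
Qed.

End translations.

Section nonstationary_phase.
Variables (R : realType) (m : nat).
Variable lam : {measure set (BorelR R m) -> \bar R}.
Hypothesis lam_trans : translation_invariant lam.
Hypothesis lam_fin : forall r : R, (lam [set x : 'rV[R]_m | (`|x| <= r)%R] < +oo)%E.
Variables (B O : set 'rV[R]_m) (v : 'rV[R]_m) (rB : R).
Hypotheses (cB : closed B) (oO : open O) (BO : B `<=` O).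
Hypothesis Br : forall x, B x -> `|x| <= rB.
Local Notation amp := (amplitude B v).
Local Notation mlt := (multiplier O v).

Lemma amplitude_nice k M a : amp k M a -> nice rB M a.
Proof.
by move=> /amplitude0[h1 h2 h3 _]; split => // x rx; apply: h1 => /Br; rewrite leNgt rx.
Qed.

Lemma oscillation_multiplier (T : R -> R) (Phi : 'rV[R]_m -> R) : continuous T ->
  (forall t, `|T t| <= 1) -> (forall x, O x -> {for x, continuous Phi}) ->
  mlt 0 1 (T \o Phi).
Proof.
move=> cT bT cP; split => // x Ox; last exact: bT.
by apply: continuous_comp; [exact: cP|exact: cT].
Qed.

(** Since ['D_v (T o Phi) = w q T'(Phi)], the integrand is [(a / q) 'D_v (T o Phi) / w], and the
    full derivative of [(a / q) T(Phi)] integrates to zero. [T] is left abstract to cover both sine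
    and cosine. *)
Lemma oscillatory_by_parts (T T' : R -> R) (N : nat) (M M1 Mq w : R)
    (a q Phi : 'rV[R]_m -> R) :
  (forall t : R, is_derive t 1 T (T' t)) -> continuous T -> continuous T' ->
  (forall t, `|T t| <= 1) -> (forall t, `|T' t| <= 1) ->
  w != 0 -> 0 <= M1 -> amp N.+1 M a -> mlt N.+1 M1 (fun x => (q x)^-1) -> mlt 0 Mq q ->
  (forall x, O x -> q x != 0) ->
  (forall x, O x -> {for x, continuous Phi}) ->
  (forall x, O x -> is_derive x v Phi (w * q x)) ->
  let b := fun x => 'D_v (fun x => a x * (q x)^-1) x in
  amp N (2 ^+ N.+1 * (M * M1)) b /\
  \int[lam]_x (a x * T' (Phi x)) = - w^-1 * \int[lam]_x (b x * T (Phi x)).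
Proof.
move=> dT cT cT' bT bT' w0 M10 ha hV hq q0 cP dP b.
have hac := amplitudeM cB BO M10 ha hV.
set M2 := 2 ^+ N.+1 * (M * M1) in hac *.
have hb : amp N M2 b by case: hac => _ _ _ [].
split => //.
set ac := fun x => a x * (q x)^-1 in hac b hb *.
have hac1 : amp 1 M2 ac by case: hac => h1 h2 h3 [h4 h5]; split => //; split => //; exact: amplitude0 h5.
have [qc qb _] := hq.
have dTP x : O x -> is_derive x v (T \o Phi) (T' (Phi x) * (w * q x)).
  by move=> Ox; apply: is_derive_comp_real; exact: dP.
have hTP' := oscillation_multiplier cT' bT' cP.
have hTP0 := oscillation_multiplier cT bT cP.
pose K := Num.max 1 (2 ^+ 0 * (1 * (2 ^+ 0 * (`|w| * Mq)))).
have K0 : 0 <= K by rewrite le_max ler01.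
have hTP : mlt 1 K (T \o Phi).
  case: hTP0 => h1 h2 _; split => //; first by move=> x Ox; rewrite le_max h2.
  split; first by move=> x Ox; have [] := dTP x Ox.
  have := multiplierM oO hTP' (multiplierM oO (multiplier_cst O v 0 w) hq).
  move=> /(@multiplier_le _ _ _ _ _ _ K) H.
  apply: (multiplier_ext oO) (H _) => //; last by rewrite le_max lexx orbT.
  by move=> x Ox; have [_ ->] := dTP x Ox.
have hG := amplitudeM cB BO K0 hac1 hTP.
have dG := amplitudeM_derivable cB BO hac1 hTP.
have nG := amplitude_nice hG.
have [_ _ _ [dvG hDG]] := hG.
have nDG := amplitude_nice (hDG : amp 0 _ _).
have := Rintegral_derive lam_trans lam_fin nG dvG nDG.
have nb : nice rB (2 ^+ 0 * (M2 * 1)) (fun x => b x * T (Phi x)).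
  exact: amplitude_nice (amplitudeM cB BO ler01 (amplitude0 hb) hTP0).
have na : nice rB (2 ^+ 0 * (M * 1)) (fun x => a x * T' (Phi x)).
  exact: amplitude_nice (amplitudeM cB BO ler01 (amplitude0 ha) hTP').
have -> : (fun x => 'D_v (fun x => ac x * (T \o Phi) x) x) =
          (fun x => b x * T (Phi x) + w * (a x * T' (Phi x))).
  apply/funext => x; have [_ ->] := dG x.
  congr (_ + _); have [Ox|Ox] := pselect (O x).
    have [_ ->] := dTP x Ox; rewrite /ac; field; exact: q0.
  have a0 : a x = 0 by case: ha => h _ _ _; apply: h => /BO.
  by rewrite /ac a0 !mul0r mulr0.
rewrite RintegralD//; [|exact: nice_integrable nb|exact: nice_integrable (niceZ w na)].
rewrite RintegralZl//; last exact: nice_integrable na.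
set I1 := Rintegral _ _ _; set I2 := Rintegral _ _ _ => H.
have -> : I1 = - (w * I2) by apply/eqP; rewrite -addr_eq0 H.
by rewrite mulrNN mulKf.
Qed.

(** The derivative of the phase is split into a large scalar [w] and a profile [q] that is bounded
    below and has bounded derivatives. Each integration by parts gains [1 / |w|] and uses up one
    derivative of [a]; [C] is chosen before [w], [a], [q] and [Phi]. *)
Lemma nonstationary_phase (N : nat) (M Mq c0 : R) : 0 < c0 -> exists C, forall (w : R)
    (a q Phi : 'rV[R]_m -> R), w != 0 -> amp N M a -> mlt N Mq q ->
  (forall x, O x -> c0 <= `|q x|) ->
  (forall x, O x -> {for x, continuous Phi}) ->
  (forall x, O x -> is_derive x v Phi (w * q x)) ->
  `|\int[lam]_x (a x * cos (Phi x))| <= C / `|w| ^+ N /\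
  `|\int[lam]_x (a x * sin (Phi x))| <= C / `|w| ^+ N.
Proof.
move=> c00.
have bc (t : R) : `|cos t| <= 1 by rewrite ler_norml cos_geN1 cos_le1.
have bs (t : R) : `|sin t| <= 1 by rewrite ler_norml sin_geN1 sin_le1.
have bcN (t : R) : `|- cos t| <= 1 by rewrite normrN.
have bsN (t : R) : `|- sin t| <= 1 by rewrite normrN.
have cc : continuous (@cos R) by exact: continuous_cos.
have cs : continuous (@sin R) by exact: continuous_sin.
have csN : continuous (fun t : R => - sin t) by move=> t; apply: continuousN; exact: cs.
elim: N M => [|N IH] M.
  exists (2 ^+ 0 * (M * 1) * vol lam rB) => w a q Phi w0 ha hq hc cP dP.
  rewrite expr0 divr1; split; apply: (nice_Rintegral_le lam_fin).
    apply: amplitude_nice (amplitudeM cB BO ler01 ha (oscillation_multiplier cc bc cP)).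
  apply: amplitude_nice (amplitudeM cB BO ler01 ha (oscillation_multiplier cs bs cP)).
have [M1 hM1] := multiplierV v oO N.+1 Mq c00.
(* Bound for the amplitude ['D_v (a / q)] left after one integration by parts. *)
have [C hC] := IH (2 ^+ N.+1 * (M * `|M1|)).
exists C => w a q Phi w0 ha hq hc cP dP.
have hV := multiplier_le (ler_norm M1) (hM1 q hq hc).
have q0 x : O x -> q x != 0.
  by move=> /hc; rewrite -normr_gt0; exact: lt_le_trans.
have hq0 := multiplier0 hq.
have [hb E1] := oscillatory_by_parts (@is_derive_sin R) cs cc bs bc w0 (normr_ge0 _) ha hV hq0 q0 cP dP.
have [_ E2] := oscillatory_by_parts (@is_derive_cos R) cc csN bc bsN w0 (normr_ge0 _) ha hV hq0 q0 cP dP.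
have [H1 H2] := hC _ _ _ _ w0 hb (multiplierW hq) hc cP dP.
have na : nice rB (2 ^+ 0 * (M * 1)) (fun x => a x * sin (Phi x)).
  exact: amplitude_nice (amplitudeM cB BO ler01 (amplitude0 ha) (oscillation_multiplier cs bs cP)).
have E3 : \int[lam]_x (a x * - sin (Phi x)) = - \int[lam]_x (a x * sin (Phi x)).
  rewrite -mulN1r -RintegralZl//; last exact: nice_integrable na.
  by apply: eq_Rintegral => x _; ring.
have step (I J : R) : `|I| <= C / `|w| ^+ N -> J = - w^-1 * I -> `|J| <= C / `|w| ^+ N.+1.
  move=> hI ->; rewrite normrM normrN normfV.
  have -> : C / `|w| ^+ N.+1 = `|w|^-1 * (C / `|w| ^+ N) by rewrite exprS invfM mulrCA.
  by apply: ler_wpM2l => //; rewrite invr_ge0.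
split; first exact: step E1.
by rewrite -normrN -E3; exact: step E2.
Qed.

End nonstationary_phase.

(** * Weights and cut-off functions *)

Section power_sums.
Variable R : realType.

(** Concavity of [u^p]. With [u = e^t] the right side is [e^(pt)] times
    [p e^((1-p)t) + (1-p) e^(-pt)], and the second factor is at least 1 by two uses of
    [e^x >= 1 + x]. *)
Lemma powR_bernoulli (u p : R) : 0 <= u -> 0 < p <= 1 -> u `^ p <= 1 + p * (u - 1).
Proof.
move=> u0 /andP[p0 p1]; have [->|un0] := eqVneq u 0.
  by rewrite powR0 ?gt_eqF// sub0r mulrN1 subr_ge0.
have {}u0 : 0 < u by rewrite lt_neqAle eq_sym un0.
rewrite /powR (negbTE un0); set t := ln u; have -> : u = expR t by rewrite lnK.
have E1 : expR t = expR (p * t) * expR ((1 - p) * t) by rewrite -expRD; congr expR; ring.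
have E2 : 1 = expR (p * t) * expR (- (p * t)) :> R by rewrite -expRD subrr expR0.
have -> : 1 + p * (expR t - 1) = expR (p * t) * (p * expR ((1 - p) * t) + (1 - p) * expR (- (p * t))).
  transitivity (p * (expR (p * t) * expR ((1 - p) * t)) + (1 - p) * (expR (p * t) * expR (- (p * t)))).
    by rewrite -E1 -E2; ring.
  ring.
rewrite ler_peMr ?expR_ge0//.
have h1 := expR_ge1Dx ((1 - p) * t); have h2 := expR_ge1Dx (- (p * t)).
have h3 : p * (1 + (1 - p) * t) <= p * expR ((1 - p) * t) by rewrite ler_wpM2l// ltW.
have h4 : (1 - p) * (1 + - (p * t)) <= (1 - p) * expR (- (p * t)) by rewrite ler_wpM2l// subr_ge0.
apply: le_trans (lerD h3 h4); rewrite [X in _ <= X](_ : _ = 1)//; ring.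
Qed.

(** Comparison with the integral of [x^-a], done by telescoping: the Bernoulli inequality at
    [1 - 1/x] bounds one term by an increment of [x^(1-a) / (1-a)]. *)
Lemma sum_powRN (a : R) (M : nat) : 0 <= a < 1 ->
  \sum_(1 <= k < M.+1) k%:R `^ (- a) <= M%:R `^ (1 - a) / (1 - a).
Proof.
move=> /andP[a0 a1]; have p0 : 0 < 1 - a by rewrite subr_gt0.
elim: M => [|M IH]; first by rewrite big_geq// mulr_ge0 ?powR_ge0// invr_ge0 ltW.
rewrite big_nat_recr//= (le_trans (lerD IH (lexx _)))//.
rewrite -lerBrDl -mulrBl ler_pdivlMr//.
set x : R := M.+1%:R; have x0 : 0 < x by rewrite ltr0n.
have -> : M%:R = x * (1 - x^-1) :> R by rewrite mulrBr mulr1 divff ?gt_eqF// /x -natr1 addrK.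
have y0 : 0 <= 1 - x^-1 by rewrite subr_ge0 invf_le1// ler1n.
rewrite (powRM _ (ltW x0) y0).
have h := @powR_bernoulli (1 - x^-1) (1 - a) y0 ltac:(by rewrite p0 gerDl oppr_le0).
have -> : x `^ (- a) = x `^ (1 - a) * x^-1.
  by rewrite -[X in _ * X]powR_inv1 ?(ltW x0)// -powRD ?(gt_eqF x0) ?implybT//; congr (_ `^ _); ring.
apply: le_trans (_ : x `^ (1 - a) - x `^ (1 - a) * (1 + (1 - a) * (1 - x^-1 - 1)) <= _).
  by rewrite le_eqVlt; apply/orP; left; apply/eqP; ring.
by rewrite lerD2l lerN2 ler_wpM2l// powR_ge0.
Qed.

(** [(i - j) + (j - i)] is the distance in truncated subtraction; the maximum with 1 gives the
    diagonal weight 1. *)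
Definition wt (a : R) (i j : nat) : R := (maxn 1 ((i - j) + (j - i)))%:R `^ (- a).

Lemma wt_ge0 a i j : 0 <= wt a i j. Proof. exact: powR_ge0. Qed.

Lemma sum_wt_row (a : R) (M i : nat) : 0 <= a < 1 -> (i < M)%N ->
  \sum_(j < M) wt a i j <= 2 * ((1 + (1 - a)^-1) * M%:R `^ (1 - a)).
Proof.
move=> ha iM; have /andP[a0 a1] := ha; have p0 : 0 < 1 - a by rewrite subr_gt0.
have M0 : (0 < M)%N by exact: leq_ltn_trans iM.
pose f k := wt a 0 k.
have T : \sum_(0 <= k < M) f k <= (1 + (1 - a)^-1) * M%:R `^ (1 - a).
  rewrite big_ltn// mulrDl mul1r lerD//.
    rewrite /f /wt -[maxn _ _]/1%N powR1.
    have E1 : 1 `^ (1 - a) = 1 :> R by rewrite powR1.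
    by rewrite -[leLHS]E1; apply: ge0_ler_powR; rewrite ?nnegrE ?ler0n ?ler1n// ltW.
  case: M M0 {iM} => // M _.
  apply: le_trans (_ : \sum_(1 <= k < M.+1) k%:R `^ (- a) <= _).
    rewrite le_eqVlt; apply/orP; left; apply/eqP; apply: eq_big_nat => k /andP[k1 _].
    by rewrite /f /wt sub0n subn0 add0n (maxn_idPr k1).
  rewrite (le_trans (sum_powRN M ha))// mulrC ler_wpM2l ?invr_ge0 ?(ltW p0)//.
  by apply: ge0_ler_powR; rewrite ?nnegrE ?ler0n ?ler_nat// ltW.
have sub (p q : nat) : (q <= M)%N -> \sum_(p <= k < q) f k <= \sum_(0 <= k < M) f k.
  move=> qM; have [pq|pq] := leqP p q; last first.
    by rewrite big_geq ?(ltnW pq)// sumr_ge0// => k _; exact: wt_ge0.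
  rewrite [leRHS](@big_cat_nat _ _ _ q)//= [X in _ <= X + _](@big_cat_nat _ _ _ p)//=.
  rewrite -addrA addrCA lerDl addr_ge0// sumr_ge0// => k _; exact: wt_ge0.
rewrite -(big_mkord xpredT (fun j => wt a i j)) (@big_cat_nat _ _ _ i.+1)//=.
rewrite mulr_natl mulr2n; apply: lerD; apply: le_trans T.
  rewrite big_nat_rev add0n; apply: le_trans (sub 0 i.+1 iM).
  rewrite le_eqVlt; apply/orP; left; apply/eqP; apply: eq_big_nat => k /andP[_ ki].
  by rewrite /f /wt; congr (_%:R `^ _); congr maxn; lia.
rewrite -{1}(add0n i.+1) big_addn; apply: le_trans (sub 1 (M - i.+1).+1 _); last by lia.
rewrite [leRHS]big_add1 /= le_eqVlt; apply/orP; left; apply/eqP; apply: eq_big_nat => k _.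
by rewrite /f /wt; congr (_%:R `^ _); congr maxn; lia.
Qed.

(** Product weights make the double sum over the grid a product of [n] one-dimensional double sums,
    each with [M] rows of size [O(M^(1-a))]. *)
Lemma sum_wt_ffun (a : R) (n M : nat) : 0 <= a < 1 ->
  \sum_(s : {ffun 'I_n -> 'I_M}) \sum_(t : {ffun 'I_n -> 'I_M}) \prod_i wt a (s i) (t i) <=
  (2 * (1 + (1 - a)^-1)) ^+ n * (M%:R `^ (2 - a)) ^+ n.
Proof.
move=> ha; have /andP[a0 a1] := ha; have p0 : 0 < 1 - a by rewrite subr_gt0.
under eq_bigr => s _ do rewrite -(bigA_distr_bigA (fun (i : 'I_n) (j : 'I_M) => wt a (s i) j)).
rewrite -(bigA_distr_bigA (fun (i : 'I_n) (k : 'I_M) => \sum_(j < M) wt a k j)).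
rewrite prodr_const card_ord -exprMn; apply: lerXn2r; rewrite ?nnegrE.
- by apply: sumr_ge0 => k _; apply: sumr_ge0 => j _; exact: wt_ge0.
- by rewrite !mulr_ge0 ?powR_ge0// addr_ge0// invr_ge0 ltW.
apply: le_trans (_ : \sum_(k < M) 2 * ((1 + (1 - a)^-1) * M%:R `^ (1 - a)) <= _).
  by apply: ler_sum => k _; exact: sum_wt_row.
rewrite sumr_const card_ord -[leLHS]mulr_natl.
have [->|M0] := eqVneq M 0%N.
  by rewrite mul0r !mulr_ge0 ?powR_ge0// addr_ge0// invr_ge0 ltW.
have -> : M%:R `^ (2 - a) = M%:R * M%:R `^ (1 - a) :> R.
  have -> : 2 - a = 1 + (1 - a) by ring.
  rewrite (@powRD _ _ 1) ?powRr1 ?ler0n//.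
  by rewrite pnatr_eq0 M0 implybT.
by rewrite le_eqVlt; apply/orP; left; apply/eqP; ring.
Qed.

End power_sums.

Section bump.
Variable R : realType.

(** An exponent of at least 2 makes the one-sided derivatives agree at the kink. *)
Lemma is_derive_pospart (k : nat) (t : R) :
  is_derive t 1 (fun t : R => Num.max 0 t ^+ k.+2) (k.+2%:R * Num.max 0 t ^+ k.+1).
Proof.
have [t0|t0|->] := ltgtP t 0.
- rewrite expr0n /= mulr0.
  have h0 : is_derive t 1 (fun _ : R => 0 : R) 0.
    by split; [exact: (derivable_cst (0 : R))|exact: (derive_cst (0 : R))].
  apply: near_eq_is_derive h0; near=> s.
  by rewrite (max_idPl _) ?expr0n//= ltW//; near: s; exact: lt_nbhsl.
- have h0 : is_derive t 1 (fun s : R => s ^+ k.+2) (k.+2%:R * t ^+ k.+1).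
    split; first exact: exprn_derivable.
    by rewrite exp_derive /GRing.scale /= mulr1.
  apply: near_eq_is_derive h0; near=> s.
  by rewrite (max_idPr _)//; near: s; exact: lt_le_nbhsr.
- rewrite expr0n /= mulr0.
  have H : (fun h : R => h^-1 *: (((fun t : R => Num.max 0 t ^+ k.+2) \o shift 0) (h *: 1) -
      Num.max 0 0 ^+ k.+2)) @ 0^' --> (0 : R).
    apply/cvgrPdist_lt => e e0; near=> h.
    rewrite /= maxxx expr0n /= subr0 addr0 sub0r normrN /GRing.scale /= mulr1.
    have h0 : h != 0 by near: h; exact: nbhs_dnbhs_neq.
    have hb : `|Num.max 0 h| <= `|h| by case: (leP 0 h) => // _; rewrite normr0.
    rewrite normrM normfV normrX mulrC ltr_pdivrMr ?normr_gt0//.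
    apply: (@le_lt_trans _ _ (`|h| ^+ k.+2)); first by rewrite lerXn2r ?nnegrE.
    rewrite exprSr ltr_pM2r ?normr_gt0//.
    have h1 : `|h| < 1 by near: h; apply: dnbhs0_lt; rewrite ltr01.
    have he : `|h| < e by near: h; exact: dnbhs0_lt.
    by rewrite (le_lt_trans _ he)// exprS ler_piMr// exprn_ile1// ltW.
  by split; [exact: cvgP H|exact: cvg_lim H].
Unshelve. all: by end_near. Qed.

Variables (m : nat) (c : 'rV[R]_m) (rho : R).
Hypothesis rho0 : 0 < rho.
Let B : set 'rV[R]_m := [set x | `|x - c| <= rho].

(** The positive part of a parabola. Its powers are cut-offs of finite smoothness, which is all that
    finitely many integrations by parts require. *)
Definition cap (i : 'I_m) (t : R) : R := Num.max 0 (rho ^+ 2 - (t - c 0 i) ^+ 2).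

Lemma cap_ge0 i t : 0 <= cap i t. Proof. by rewrite /cap le_max lexx. Qed.

Lemma cap_eq0 i t : rho <= `|t - c 0 i| -> cap i t = 0.
Proof.
move=> h; rewrite /cap (max_idPl _)// subr_le0 -[_ ^+ 2 in leRHS]real_normK ?num_real//.
by rewrite lerXn2r ?nnegrE// ltW.
Qed.

Lemma cap_gt0 i t : `|t - c 0 i| < rho -> 0 < cap i t.
Proof.
move=> h; rewrite /cap lt_max; apply/orP; right; rewrite subr_gt0.
by rewrite -[ltLHS]real_normK ?num_real// ltrXn2r// ?nnegrE// ltW.
Qed.

Lemma is_derive_cap k i (t : R) : is_derive t 1 (fun t : R => cap i t ^+ k.+2)
  (k.+2%:R * cap i t ^+ k.+1 * (- (2 * (t - c 0 i)))).
Proof.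
apply: (@is_derive1_comp R (fun u => Num.max 0 u ^+ k.+2) (fun t => rho ^+ 2 - (t - c 0 i) ^+ 2)).
  exact: is_derive_pospart.
pose p : {poly R} := (rho ^+ 2)%:P - ('X - (c 0 i)%:P) ^+ 2.
have -> : (fun t => rho ^+ 2 - (t - c 0 i) ^+ 2) = horner p.
  by apply/funext => s; rewrite !hornerE.
split; first exact: derivable_horner.
rewrite -derive1E -derivE /p derivB derivC deriv_exp derivXsubC !hornerE /=; ring.
Qed.

Lemma continuous_prod_cap (P : pred 'I_m) k : continuous (fun x : 'rV[R]_m => \prod_(i | P i) cap i (x 0 i) ^+ k.+2).
Proof.
have cc i : continuous (fun x : 'rV[R]_m => cap i (x 0 i) ^+ k.+2).
  move=> x; apply: (@continuous_comp _ _ _ (fun x : 'rV[R]_m => x 0 i) (fun t => cap i t ^+ k.+2)).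
    exact: coord_continuous.
  by apply: differentiable_continuous; apply/derivable1_diffP; have [] := is_derive_cap k i (x 0 i).
elim: (index_enum _) => [|i s IH] x.
  under eq_fun do rewrite big_nil; exact: cst_continuous.
under eq_fun do rewrite big_cons.
by case: (P i); [exact: (continuousM (cc i x) (IH x))|exact: IH].
Qed.

Lemma bounded_support (a : 'rV[R]_m -> R) : continuous a -> (forall x, ~ B x -> a x = 0) ->
  exists M : R, forall x, `|a x| <= M.
Proof.
move=> ca a0.
have := @continuous_compact _ _ a B (continuous_subspaceT ca) (@compact_ball_norm R m c rho).
move=> /(@compact_bounded R R) [M [_ hM]]; exists (Num.max 0 (M + 1)) => x.
rewrite le_max; have [Bx|/a0 ->] := pselect (B x); last by rewrite normr0 lexx.
by apply/orP; right; apply: (hM (M + 1)); [rewrite ltrDl|exists x].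
Qed.

Lemma prod_cap_eq0 k (x : 'rV[R]_m) : ~ B x -> exists2 i, rho < `|x 0 i - c 0 i| & cap i (x 0 i) ^+ k.+2 = 0.
Proof.
move=> nB; have [[i hi]|h] := pselect (exists i, rho < `|x 0 i - c 0 i|).
  by exists i => //; rewrite cap_eq0 ?expr0n// ltW.
case: nB; apply/rV_norm_le => [|i]; first exact: ltW.
by rewrite !mxE leNgt; apply/negP => hi; apply: h; exists i.
Qed.

Definition side (j : 'I_m) (K : nat) (x : 'rV[R]_m) := \prod_(i | i != j) cap i (x 0 i) ^+ K.+2.

Lemma side_line j K x (s : R) : side j K (x + s *: ev j) = side j K x.
Proof. by apply: eq_bigr => i ij; rewrite !mxE eqxx /= (negbTE ij) mulr0 addr0. Qed.

(** The polynomial factor closes the induction: differentiating [p cap^(k+3)] gives [q cap^(k+2)]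
    with [q] again a polynomial. The other coordinates enter through [side], which is constant along
    [ev j]. *)
Lemma bump_amplitude j K k (p : {poly R}) : exists M,
  amplitude B (ev j) k M (fun x => side j K x * (p.[x 0 j] * cap j (x 0 j) ^+ k.+2)).
Proof.
have ct k' (q : {poly R}) : continuous (fun x : 'rV[R]_m => side j K x * (q.[x 0 j] * cap j (x 0 j) ^+ k'.+2)).
  move=> x; apply: continuousM; first exact: (@continuous_prod_cap (fun i => i != j) K x).
  apply: (@continuous_comp _ _ _ (fun x : 'rV[R]_m => x 0 j) (fun t => q.[t] * cap j t ^+ k'.+2)).
    exact: coord_continuous.
  apply: continuousM; first exact: continuous_horner.
  by apply: differentiable_continuous; apply/derivable1_diffP; have [] := is_derive_cap k' j (x 0 j).
have zr k' (q : {poly R}) x : ~ B x -> side j K x * (q.[x 0 j] * cap j (x 0 j) ^+ k'.+2) = 0.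
  move=> nB; have [i hi hi0] := prod_cap_eq0 K nB.
  have [ij|ij] := eqVneq i j; last by rewrite /side (bigD1 i)//= hi0 !mul0r.
  by move: hi; rewrite ij => hi; rewrite cap_eq0 ?(ltW hi)// expr0n /= !mulr0.
elim: k p => [|k IH] p.
  have [M hM] := bounded_support (ct 0%N p) (zr 0%N p).
  by exists M; split; [exact: zr|exact: ct|exact: hM|].
(* With [Q] the parabola under [cap], this is the derivative of [p Q^(k+3)] divided by [Q^(k+2)]. *)
pose q : {poly R} := p^`() * ((rho ^+ 2)%:P - ('X - (c 0 j)%:P) ^+ 2) -
  (k.+3%:R * 2)%:P * (('X - (c 0 j)%:P) * p).
have [M1 hM1] := bounded_support (ct k.+1 p) (zr k.+1 p).
have [M2 hM2] := IH q.
have db (t : R) : is_derive t 1 (fun t : R => p.[t] * cap j t ^+ k.+3) (q.[t] * cap j t ^+ k.+2).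
  have [d1 e1] := is_derive_cap k.+1 j t.
  split; first by apply: derivableM => //; exact: derivable_horner.
  have capE : cap j t ^+ k.+3 = (rho ^+ 2 - (t - c 0 j) ^+ 2) * cap j t ^+ k.+2.
    (* [cap^2 = Q cap] holds on both sides of the zero of [Q], so no case distinction on the sign is
       left. *)
    set Q := rho ^+ 2 - _; have capQ : cap j t * cap j t = Q * cap j t.
      by rewrite /cap -/Q; case: (leP 0 Q) => _; rewrite ?mulr0.
    by rewrite [LHS]exprS [X in _ * X = _]exprS mulrA capQ -mulrA -exprS.
  set w := cap j t ^+ k.+2 in e1 capE *.
  transitivity (p.[t] * (k.+3%:R * w * (- (2 * (t - c 0 j)))) + cap j t ^+ k.+3 * p^`().[t]).
    rewrite deriveM; [|exact: derivable_horner|exact: d1].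
    by rewrite e1 -(derive1E (horner p)) -derivE.
  have qE : q.[t] = p^`().[t] * (rho ^+ 2 - (t - c 0 j) ^+ 2) - k.+3%:R * 2 * ((t - c 0 j) * p.[t]).
    by rewrite /q hornerD hornerN !hornerM hornerD hornerN !hornerC horner_exp hornerXsubC.
  rewrite capE qE; clear; move: k.+3%:R w => a b; ring.
have dB (x : 'rV[R]_m) : is_derive x (ev j) (fun x => side j K x * (p.[x 0 j] * cap j (x 0 j) ^+ k.+3))
    (side j K x * (q.[x 0 j] * cap j (x 0 j) ^+ k.+2)).
  have xE : x = x + 0 *: ev j by rewrite scale0r addr0.
  rewrite {1}xE; apply/is_derive_lineP.
  have -> : (fun s : R => side j K (x + s *: ev j) *
     (p.[(x + s *: ev j) 0 j] * cap j ((x + s *: ev j) 0 j) ^+ k.+3)) =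
     (fun s => side j K x * ((fun t : R => p.[t] * cap j t ^+ k.+3) \o shift (x 0 j)) s).
    by apply/funext => s; rewrite side_line /= !mxE !eqxx /= mulr1 [x 0 j + s]addrC.
  have := db (x 0 j); rewrite -{1}[x 0 j]add0r => hdb.
  have hs := @is_derive_shift R 0 1 (x 0 j).
  have := @is_derive1_comp R _ (shift (x 0 j)) 0 _ _ hdb hs; rewrite mulr1 => hc.
  exact: (@is_deriveZ _ _ _ _ (side j K x) _ _ _ hc).
exists (Num.max M1 M2); split.
- exact: zr.
- exact: ct.
- by move=> x; rewrite le_max hM1.
split; first by move=> x; have [] := dB x.
have -> : (fun x => 'D_(ev j) (fun x => side j K x * (p.[x 0 j] * cap j (x 0 j) ^+ k.+3)) x) =
   (fun x => side j K x * (q.[x 0 j] * cap j (x 0 j) ^+ k.+2)).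
  by apply/funext => x; have [_] := dB x.
by apply: amplitude_le hM2; rewrite le_max lexx orbT.
Qed.

Definition bump (N : nat) (x : 'rV[R]_m) := \prod_i cap i (x 0 i) ^+ N.+2.

Lemma bump_amp N j : exists M, amplitude B (ev j) N M (bump N).
Proof.
have [M hM] := bump_amplitude j N N 1; exists M.
rewrite (_ : bump N = (fun x => side j N x * (1.[x 0 j] * cap j (x 0 j) ^+ N.+2)))//.
by apply/funext => x; rewrite -polyC1 hornerC mul1r /bump /side (bigD1 j)//= [RHS]mulrC.
Qed.

Lemma bump_ge0 N x : 0 <= bump N x.
Proof. by apply: prodr_ge0 => i _; rewrite exprn_ge0// cap_ge0. Qed.

Lemma bump_center_gt0 N : 0 < bump N c.
Proof. by apply: prodr_gt0 => i _; rewrite exprn_gt0// cap_gt0// subrr normr0. Qed.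

Lemma bump_eq0 N x : ~ B x -> bump N x = 0.
Proof. by move=> /(prod_cap_eq0 N)[i _ hi]; rewrite /bump (bigD1 i)//= hi mul0r. Qed.

Lemma continuous_bump N : continuous (bump N).
Proof. exact: continuous_prod_cap. Qed.

End bump.

(** * Fourier decay on a curved graph *)

Section weyl_differencing.
Variables (R : realType) (m : nat).
Variable lam : {measure set (BorelR R m) -> \bar R}.
Hypothesis lam_trans : translation_invariant lam.
Hypothesis lam_fin : forall r : R, (lam [set x : 'rV[R]_m | (`|x| <= r)%R] < +oo)%E.

(* Translation invariance replaces [f] by the average of its shifts along [h];
   Cauchy-Schwarz then trades [f] for its correlations, whose phases are differences. *)
Lemma weyl_square (T : finType) (h : T -> 'rV[R]_m) (f : 'rV[R]_m -> R) (r M rho : R) :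
  nice r M f -> (forall s, `|h s| <= rho) ->
  (#|T|%:R * \int[lam]_x f x) ^+ 2 <=
  vol lam (r + rho) * \sum_s \sum_t \int[lam]_x (f (x + (h s - h t)) * f x).
Proof.
move=> nf hr.
have nfs s : nice (r + rho) M (fun x => f (x + h s)).
  by apply: (nice_le _ (lexx _) (nice_translate (h s) nf)); rewrite lerD2l.
have [nF EF] := Rintegral_nice_sum lam_fin nfs.
have -> : #|T|%:R * \int[lam]_x f x = \int[lam]_x \sum_s f (x + h s).
  rewrite EF (eq_bigr (fun=> \int[lam]_x f x)) => [|s _]; first by rewrite sumr_const mulr_natl.
  exact: (Rintegral_translate lam_trans lam_fin _ nf).
apply: le_trans (Rintegral_Cauchy_Schwarz lam_fin nF) _.
rewrite ler_wpM2l ?vol_ge0// le_eqVlt; apply/orP; left; apply/eqP.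
have nst s t : nice (r + rho) (M * M) (fun x => f (x + h s) * f (x + h t)).
  exact: niceM (nfs s) (nfs t).
have nin s := Rintegral_nice_sum lam_fin (nst s).
have [_ E2] := Rintegral_nice_sum lam_fin (fun s => (nin s).1).
transitivity (\int[lam]_x \sum_s \sum_t f (x + h s) * f (x + h t)).
  apply: eq_Rintegral => x _; rewrite expr2 mulr_suml.
  by apply: eq_bigr => s _; rewrite mulr_sumr.
rewrite E2; apply: eq_bigr => s _; rewrite (nin s).2; apply: eq_bigr => t _.
(* Translating by [h t] turns the second factor into [f x], so that only the difference [h s - h t]
   remains. *)
rewrite -(Rintegral_translate lam_trans lam_fin (h t) (niceM (nice_translate (h s - h t) nf) nf)).
by apply: eq_Rintegral => x _; rewrite -addrA [h t + _]addrC subrK.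
Qed.

End weyl_differencing.

Section phase_derivatives.
Variable R : realType.

Lemma is_derive_affine (a b t : R) : is_derive t 1 (fun s : R => a + s * b) b.
Proof.
pose p : {poly R} := a%:P + 'X * b%:P.
have -> : (fun s => a + s * b) = horner p by apply/funext => s; rewrite !hornerE.
split; first exact: derivable_horner.
by rewrite -derive1E -derivE /p derivD derivC derivM derivX derivC !hornerE.
Qed.

Lemma is_derive_dotp n (x eta : 'rV[R]_n) j : is_derive x (ev j) (fun x => dotp x eta) (eta 0 j).
Proof.
have {1}-> : x = x + 0 *: ev j by rewrite scale0r addr0.
apply/is_derive_lineP.
have -> : (fun s : R => dotp (x + s *: ev j) eta) = (fun s => dotp x eta + s * eta 0 j).
  apply/funext => s; rewrite /dotp (bigD1 j)//= [in RHS](bigD1 j)//= !mxE !eqxx mulr1 mulrDl.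
  rewrite (eq_bigr (fun i => x 0 i * eta 0 i)) => [|i ij]; first by rewrite addrAC.
  by rewrite !mxE eqxx /= (negbTE ij) mulr0 addr0.
exact: is_derive_affine.
Qed.

Lemma continuous_dotp n (eta : 'rV[R]_n) : continuous (fun x : 'rV[R]_n => dotp x eta).
Proof.
rewrite /dotp; elim: (index_enum _) => [|i s IH] x.
  under eq_fun do rewrite big_nil; exact: cst_continuous.
under eq_fun do rewrite big_cons.
have h : {for x, continuous (fun x : 'rV[R]_n => x 0 i * eta 0 i)}.
  by apply: continuousM; [exact: coord_continuous|exact: cst_continuous].
exact: (continuousD h (IH x)).
Qed.

Lemma lsubmx_norm n (x : 'rV[R]_(n + 1)) : `|lsubmx x| <= `|x|.
Proof. by apply/rV_norm_le => // i; rewrite mxE; exact: rV_norm_coord. Qed.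

Lemma is_derive_lsubmx n (f : 'rV[R]_n -> R) (x : 'rV[R]_(n + 1)) j df :
  is_derive (lsubmx x) (ev j) f df ->
  is_derive x (ev (lshift 1 j)) (fun x => f (lsubmx x)) df.
Proof.
move=> hf; have {1}-> : x = x + 0 *: ev (lshift 1 j) by rewrite scale0r addr0.
apply/is_derive_lineP.
have -> : (fun s : R => f (lsubmx (x + s *: ev (lshift 1 j)))) = (fun s => f (lsubmx x + s *: ev j)).
  apply/funext => s; congr f; apply/rowP => i; rewrite !mxE /=.
  by rewrite (inj_eq (@lshift_inj _ _)).
by apply/is_derive_lineP; rewrite scale0r addr0.
Qed.

Lemma is_derive_lsubmx_last n (f : 'rV[R]_n -> R) (x : 'rV[R]_(n + 1)) (j : 'I_1) :
  is_derive x (ev (rshift n j)) (fun x => f (lsubmx x)) 0.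
Proof.
have {1}-> : x = x + 0 *: ev (rshift n j) by rewrite scale0r addr0.
apply/is_derive_lineP.
have -> : (fun s : R => f (lsubmx (x + s *: ev (rshift n j)))) = (fun=> f (lsubmx x)).
  apply/funext => s; congr f; apply/rowP => i; rewrite !mxE /=.
  by rewrite (eq_lrshift) mulr0 addr0.
by split; [exact: (derivable_cst (f (lsubmx x)))|exact: (derive_cst (f (lsubmx x)))].
Qed.

Lemma continuous_lsubmx n (f : 'rV[R]_n -> R) (x : 'rV[R]_(n + 1)) :
  {for lsubmx x, continuous f} -> {for x, continuous (fun x : 'rV[R]_(n + 1) => f (lsubmx x))}.
Proof.
move=> /continuousP_norm H; apply/continuousP_norm => e /H [r r0 hr].
exists r => // y yx; apply: hr; rewrite -linearB; exact: le_lt_trans (lsubmx_norm _) yx.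
Qed.

(** Lets the successive derivatives be named in advance by [Fam], instead of being met as iterated
    ['D_v]. *)
Lemma multiplier_family m (O : set 'rV[R]_m) v (Fam : nat -> 'rV[R]_m -> R) (K : nat) (M : R) :
  open O ->
  (forall i x, (i <= K)%N -> O x -> {for x, continuous (Fam i)}) ->
  (forall i x, (i <= K)%N -> O x -> `|Fam i x| <= M) ->
  (forall i x, (i < K)%N -> O x -> is_derive x v (Fam i) (Fam i.+1 x)) ->
  forall k i, (i + k <= K)%N -> multiplier O v k M (Fam i).
Proof.
move=> oO h1 h2 h3; elim => [|k IH] i ik.
  by split => // x Ox; [apply: h1|apply: h2] => //; lia.
split; [by move=> x Ox; apply: h1 => //; lia|by move=> x Ox; apply: h2 => //; lia|].
split; first by move=> x Ox; have [] := h3 i x ltac:(lia) Ox.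
apply: (multiplier_ext oO) (IH i.+1 _); last by lia.
by move=> x Ox; have [_ ->] := h3 i x ltac:(lia) Ox.
Qed.

End phase_derivatives.

Section hessian.
Variables (R : realType) (n : nat).
Variables (V : set 'rV[R]_n) (g : 'rV[R]_n -> R) (y0 : 'rV[R]_n).
Hypotheses (oV : open V) (sg : smooth_on V g) (Vy0 : V y0).

Lemma smooth_is_derive js j y : V y ->
  is_derive y (ev j) (iter_partial js g) (iter_partial (j :: js) g y).
Proof. by move=> /(sg js)[h _]; exact: derivableP. Qed.

Lemma smooth_continuous js y : V y -> {for y, continuous (iter_partial js g)}.
Proof. by move=> /(sg js)[]. Qed.

Lemma smooth_ball : exists2 r : R, 0 < r & forall y, `|y - y0| <= r -> V y.
Proof.
have [r r0 hr] := (openP_norm _).1 oV _ Vy0; exists (r / 2); first by rewrite divr_gt0.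
by move=> y yr; apply: hr; apply: le_lt_trans yr _; lra.
Qed.

Lemma smooth_bounded (I : finType) (js : I -> seq 'I_n) (r : R) :
  (forall y, `|y - y0| <= r -> V y) ->
  exists2 L : R, 0 <= L & forall i y, `|y - y0| <= r -> `|iter_partial (js i) g y| <= L.
Proof.
move=> hr.
have bd i : exists M : R, forall y, `|y - y0| <= r -> `|iter_partial (js i) g y| <= M.
  have cw : {within [set y : 'rV[R]_n | `|y - y0| <= r], continuous (iter_partial (js i) g)}.
    by apply: continuous_in_subspaceT => y; rewrite inE => /hr; exact: smooth_continuous.
  have := continuous_compact cw (@compact_ball_norm R n y0 r).
  move=> /(@compact_bounded R R) [M [_ hM]]; exists (M + 1) => y hy.
  by apply: (hM (M + 1)); [rewrite ltrDl|exists y].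
have [M hM] := choice bd.
exists (\sum_i `|M i|); first by apply: sumr_ge0.
move=> i y hy; apply: le_trans (hM i y hy) _; apply: le_trans (ler_norm _) _.
by rewrite (bigD1 i)//= lerDl sumr_ge0.
Qed.

Lemma mulmx_norm (v : 'rV[R]_n) (A : 'M[R]_n) (K : R) : (forall i j, `|A i j| <= K) ->
  0 <= K -> `|v *m A| <= n%:R * K * `|v|.
Proof.
move=> hA K0; apply/rV_norm_le => [|j]; first by rewrite !mulr_ge0.
rewrite mxE (le_trans (ler_norm_sum _ _ _))//.
have -> : n%:R * K * `|v| = \sum_(i < n) (`|v| * K).
  by rewrite sumr_const card_ord -[RHS]mulr_natl; ring.
apply: ler_sum => i _; rewrite normrM ler_pM//; exact: rV_norm_coord.
Qed.

(* Invertibility of the Hessian: a shift by [v] moves some partial derivative of [g] by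
   about [|v|], with the same index [j] for all base points. *)
Lemma hessian_direction :
  \det (\matrix_(j < n, k < n) partial j (partial k g) y0) != 0 ->
  exists r c : R, [/\ 0 < r, 0 < c, forall y, `|y - y0| <= r -> V y &
    forall v : 'rV[R]_n, v != 0 -> exists j, forall y, `|y - y0| <= r -> `|y + v - y0| <= r ->
      c * `|v| <= `|partial j g (y + v) - partial j g y|].
Proof.
set H := \matrix_(j, k) _ => dH.
have uH : H \in unitmx by rewrite unitmxE unitfE.
pose K : R := 1 + \sum_i \sum_j `|invmx H i j|.
have K1 : 1 <= K by rewrite lerDl; apply: sumr_ge0 => i _; apply: sumr_ge0.
have hK i j : `|invmx H i j| <= K.
  rewrite /K (bigD1 i)//= (bigD1 j)//= addrCA -!addrA lerDl.
  rewrite addr_ge0// ?addr_ge0// ?sumr_ge0// => i' _; exact: sumr_ge0.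
have K0 : 0 < K by exact: lt_le_trans K1.
(* From [|v| <= n K |v H|] some coordinate of [v H] exceeds [2 c |v|]; half of it is spent on the
   variation of the Hessian. [n.+1] in place of [n] keeps the inverse meaningful for [n = 0]. *)
pose c : R := (4 * (n.+1%:R * K))^-1.
have c0 : 0 < c by rewrite invr_gt0 !mulr_gt0.
have [r1 r10 hr1] := smooth_ball.
pose e : R := c / n.+1%:R; have e0 : 0 < e by rewrite divr_gt0.
have near1 (l j : 'I_n) : exists2 r : R, 0 < r & forall y, `|y - y0| < r ->
    `|partial l (partial j g) y - H l j| < e.
  have [r r0 hr] := (continuousP_norm _ _).1 (smooth_continuous (js := [:: l; j]) Vy0) e e0.
  by exists r => // y yr; rewrite mxE; exact: hr.
have near2 : exists2 r : R, 0 < r & forall l j y, `|y - y0| < r ->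
    `|partial l (partial j g) y - H l j| < e.
  have near1' (lj : 'I_n * 'I_n) : exists r : R, 0 < r /\ forall y, `|y - y0| < r ->
      `|partial lj.1 (partial lj.2 g) y - H lj.1 lj.2| < e.
    by case: lj => l j; have [r r0 hr] := near1 l j; exists r.
  have [f hf] := choice near1'.
  exists (\big[Num.min/1]_lj f lj).
    by apply: lt_bigmin => // lj _; have [] := hf lj.
  move=> l j y hy; have [_ h] := hf (l, j); apply: (h y).
  apply: lt_le_trans hy _; exact: (bigmin_le_cond _ _ (isT : xpredT (l, j))).
have [r2 r20 hr2] := near2.
pose r := Num.min r1 (r2 / 2).
have r0 : 0 < r by rewrite lt_min r10 divr_gt0.
have rV y : `|y - y0| <= r -> V y by rewrite le_min => /andP[/hr1].
exists r, c; split => // v v0.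
have [j hj] : exists j, 2 * c * `|v| < `|(v *m H) 0 j|.
  apply: contrapT => hn.
  have hle : `|v *m H| <= 2 * c * `|v|.
    apply/rV_norm_le => [|j]; first by rewrite !mulr_ge0// ltW.
    by rewrite leNgt; apply/negP => hj; apply: hn; exists j.
  have := mulmx_norm (v *m H) hK (ltW K0); rewrite mulmxK// => hv.
  have v1 : 0 < `|v| by rewrite normr_gt0.
  have : `|v| <= n%:R * K * (2 * c * `|v|) by apply: le_trans hv _; rewrite ler_wpM2l// mulr_ge0// ltW.
  rewrite mulrA ler_pMl// => h1.
  have : n%:R * K * (2 * c) < 1; last by move=> h2; have := lt_le_trans h2 h1; rewrite ltxx.
  have -> : n%:R * K * (2 * c) = (n%:R / n.+1%:R) / 2.
    rewrite /c; field; rewrite ?gt_eqF//.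
  have : n%:R / n.+1%:R <= 1 :> R by rewrite ler_pdivrMr// mul1r ler_nat.
  by set z := n%:R / _; lra.
exists j => y yr yvr.
(* Removing the linear part, with the Hessian frozen at [y0], leaves a function whose partial
   derivatives are below [e = c / (n + 1)]; its increment over [v] is therefore at most [c |v|]. *)
pose F y := iter_partial [:: j] g y - dotp y (\row_l H l j).
have dF y' : `|y' - y0| <= r -> forall l, is_derive y' (ev l) F (partial l (partial j g) y' - H l j).
  move=> y'r l; have := is_derive_dotp y' (\row_l H l j) l; rewrite mxE => hd.
  have := smooth_is_derive [:: j] l (rV _ y'r) => hg.
  exact: is_deriveB.
have := @lipschitz_ball R n F y0 r e (ltW e0) _ y (y + v) yr yvr.
have -> : y + v - y = v by rewrite addrC addKr.
move=> /(_ _) hL.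
have {}hL : `|F (y + v) - F y| <= n%:R * e * `|v|.
  apply: hL => y' y'r l; have [d1 d2] := dF y' y'r l; split => //.
  rewrite /partial d2; apply/ltW/hr2; apply: le_lt_trans y'r _.
  by rewrite gt_min; apply/orP; right; lra.
have E : F (y + v) - F y = (partial j g (y + v) - partial j g y) - (v *m H) 0 j.
  rewrite /F /=; have -> : dotp (y + v) (\row_l H l j) = dotp y (\row_l H l j) + (v *m H) 0 j.
    by rewrite /dotp mxE -big_split /=; apply: eq_bigr => l _; rewrite !mxE mulrDl.
  ring.
have : `|(v *m H) 0 j| <= `|partial j g (y + v) - partial j g y| + `|F (y + v) - F y|.
  rewrite E -[in leLHS](subrK (partial j g (y + v) - partial j g y) ((v *m H) 0 j)).
  by rewrite addrC (le_trans (ler_normD _ _))// lerD2l distrC.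
have ne : n%:R * e <= c.
  by rewrite /e mulrCA ger_pMr// ler_pdivrMr// mul1r ler_nat.
have nev : n%:R * e * `|v| <= c * `|v| by rewrite ler_wpM2r.
move: hj hL nev; rewrite -mulrA; set cv := c * `|v|; lra.
Qed.

End hessian.

Section weights.
Variable R : realType.

Definition ndist (i j : nat) : nat := ((i - j) + (j - i))%N.

Lemma normr_ndist (i j : nat) : `|i%:R - j%:R| = (ndist i j)%:R :> R.
Proof.
rewrite /ndist; have [ij|ij] := leqP i j.
  have -> : (i - j + (j - i) = j - i)%N by lia.
  by rewrite natrB// distrC ger0_norm// subr_ge0 ler_nat.
have -> : (i - j + (j - i) = i - j)%N by lia.
by rewrite natrB ?(ltnW ij)// ger0_norm// subr_ge0 ler_nat ltnW.
Qed.

Lemma ndist_le m (i j : 'I_m) : (ndist i j <= m)%N.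
Proof. by rewrite /ndist; have := ltn_ord i; have := ltn_ord j; lia. Qed.

(** [i] is the coordinate of largest distance, so its weight is the smallest of all [n]. This
    converts decay in the sup-norm distance into product weights. *)
Lemma prod_wt_ge (a : R) (n M : nat) (s t : {ffun 'I_n -> 'I_M}) : 0 <= a -> s != t ->
  exists2 i, (0 < ndist (s i) (t i))%N &
    ((ndist (s i) (t i))%:R `^ (- a)) ^+ n <= \prod_j wt a (s j) (t j).
Proof.
move=> a0 st.
have [i1 hi1] : exists i, s i != t i.
  apply: contrapT => h; move/eqP : st; apply; apply/ffunP => i.
  by apply/eqP; apply: contrapT => /negP hi; apply: h; exists i.
pose d i := ndist (s i) (t i).
case: (@arg_maxnP _ i1 xpredT d isT) => i _ hmax.
have D1 : (1 <= d i)%N.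
  apply: leq_trans (hmax i1 isT); rewrite /d /ndist.
  by have : (s i1 : nat) != t i1 by []; lia.
exists i => //.
rewrite -[n in _ ^+ n]card_ord -prodr_const; apply: ler_prod => j _.
rewrite powR_ge0 /= /wt -/(ndist _ _).
rewrite !powRN lef_pV2 ?posrE ?powR_gt0 ?ltr0n ?leq_max//.
apply: ge0_ler_powR; rewrite ?nnegrE ?ler0n// ler_nat geq_max D1 /=.
exact: hmax.
Qed.

End weights.

Section surface_decay.
Variables (R : realType) (n : nat).
Variable lam : {measure set (BorelR R (n + 1)) -> \bar R}.
Hypothesis lam_trans : translation_invariant lam.
Hypothesis lam_fin : forall r : R, (lam [set x : 'rV[R]_(n + 1) | (`|x| <= r)%R] < +oo)%E.
Variables (V : set 'rV[R]_n) (g : 'rV[R]_n -> R) (y0 : 'rV[R]_n).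
Hypothesis sg : smooth_on V g.
Variables (r c : R).
Hypotheses (c0 : 0 < c) (rV : forall y, `|y - y0| <= r -> V y).
Hypothesis hdir : forall v : 'rV[R]_n, v != 0 -> exists j, forall y, `|y - y0| <= r ->
  `|y + v - y0| <= r -> c * `|v| <= `|partial j g (y + v) - partial j g y|.

(** Points of [O] lie within [2 rho] of the centre and shifts have length at most [rho], so every
    argument of [g] stays within [3 rho < r]. *)
Variable rho : R.
Hypotheses (rho0 : 0 < rho) (rE : r = 4 * rho).
Let x0 : 'rV[R]_(n + 1) := row_mx y0 0.
Let B : set 'rV[R]_(n + 1) := [set x | `|x - x0| <= rho].
Let O : set 'rV[R]_(n + 1) := [set x | `|x - x0| < 2 * rho].
Let Psi := bump x0 rho n.
Let dir (j : 'I_n) : 'rV[R]_(n + 1) := ev (lshift 1 j).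

(** [tau] is the frequency along the graph direction; [eta] collects the [n] base frequencies and
    the axial one. *)
Definition phase (eta : 'rV[R]_(n + 1)) (tau : R) (x : 'rV[R]_(n + 1)) : R :=
  2 * pi * (dotp x eta + tau * g (lsubmx x)).

Let cB : closed B. Proof. exact: closed_ball_norm. Qed.
Let oO : open O. Proof. exact: open_ball_norm. Qed.
Let BO : B `<=` O. Proof. by move=> x /= h; apply: le_lt_trans h _; move: rho0; lra. Qed.
Let Br x : B x -> `|x| <= `|x0| + rho.
Proof. by move=> h; rewrite -{1}(subrKC x0 x) (le_trans (ler_normD _ _))// lerD2l. Qed.

Let lsub_near (x : 'rV[R]_(n + 1)) : `|lsubmx x - y0| <= `|x - x0|.
Proof. by rewrite -{1}(row_mxKl y0 (0 : 'rV[R]_1)) -linearB; exact: lsubmx_norm. Qed.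

Let O_in x : O x -> `|lsubmx x - y0| <= r.
Proof. by move=> h; apply: le_trans (lsub_near x) _; apply: ltW; apply: lt_trans h _; rewrite rE; move: rho0; lra. Qed.

Let O_shift_in x (v : 'rV[R]_n) : `|v| <= rho -> O x -> `|lsubmx x + v - y0| <= r.
Proof.
move=> hv h; rewrite addrAC (le_trans (ler_normD _ _))//.
have h1 := le_lt_trans (lsub_near x) h; move: h1 hv rho0; rewrite rE; lra.
Qed.

Let Fam (j : 'I_n) (i : nat) (x : 'rV[R]_(n + 1)) := iter_partial (nseq i.+1 j) g (lsubmx x).

(** Besides the pure derivatives along [j] used in integration by parts, one more derivative in an
    arbitrary direction [l] is controlled: the mean value theorem needs it for shifts that are not
    along [j]. *)
Lemma partials_bound : exists2 L : R, 0 <= L & forall j i y, (i <= n)%N -> `|y - y0| <= r ->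
  `|iter_partial (nseq i.+1 j) g y| <= L /\
  forall l, `|iter_partial (l :: nseq i.+1 j) g y| <= L.
Proof.
pose js (t : option 'I_n * 'I_n * 'I_(n.+1)) : seq 'I_n :=
  (if t.1.1 is Some l then [:: l] else [::]) ++ nseq t.2.+1 t.1.2.
have [L L0 hL] := smooth_bounded sg js rV.
exists L => // j i y ni hy; split.
  by have := hL (None, j, Ordinal (ni : (i < n.+1)%N)) y hy.
by move=> l; have := hL (Some l, j, Ordinal (ni : (i < n.+1)%N)) y hy.
Qed.

Let Fam_derive j i x : O x -> is_derive x (dir j) (Fam j i) (Fam j i.+1 x).
Proof.
move=> Ox; apply: is_derive_lsubmx; exact: (smooth_is_derive sg (nseq i.+1 j) j (rV (O_in Ox))).
Qed.

Let g_derive j x : O x -> is_derive x (dir j) (fun x => g (lsubmx x)) (Fam j 0 x).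
Proof.
move=> Ox; apply: is_derive_lsubmx; exact: (smooth_is_derive sg [::] j (rV (O_in Ox))).
Qed.

Let Fam_continuous j i x : O x -> {for x, continuous (Fam j i)}.
Proof.
by move=> Ox; apply: continuous_lsubmx; exact: (smooth_continuous sg (rV (O_in Ox))).
Qed.

Let phase_continuous eta tau x : `|lsubmx x - y0| <= r -> {for x, continuous (phase eta tau)}.
Proof.
move=> hx; rewrite /phase.
have h1 : {for x, continuous (fun x : 'rV[R]_(n + 1) => g (lsubmx x))}.
  by apply: continuous_lsubmx; exact: (smooth_continuous sg (js := [::]) (rV hx)).
have h2 : {for x, continuous (fun x : 'rV[R]_(n + 1) => tau * g (lsubmx x))}.
  by apply: continuousM => //; exact: cst_continuous.
have h3 := continuousD (@continuous_dotp R _ eta x) h2.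
by apply: continuousM => //; exact: cst_continuous.
Qed.

Let phase_derive eta tau j x (dg : R) : is_derive x (ev j) (fun x => g (lsubmx x)) dg ->
  is_derive x (ev j) (phase eta tau) (2 * pi * (eta 0 j + tau * dg)).
Proof.
move=> hg; rewrite /phase.
have h1 := is_derive_dotp x eta j.
have h2 : is_derive x (ev j) (fun x => tau * g (lsubmx x)) (tau * dg) by exact: is_deriveZ.
have h3 : is_derive x (ev j) (fun x => dotp x eta + tau * g (lsubmx x)) (eta 0 j + tau * dg).
  exact: is_deriveD.
exact: is_deriveZ.
Qed.

Let two_pi_ge1 : 1 <= 2 * pi :> R.
Proof. by have := pi_ge2 R; lra. Qed.

Let absorb_2pi (C w : R) : w != 0 -> C / `|2 * pi * w| ^+ n <= `|C| / `|w| ^+ n.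
Proof.
move=> w0; have w1 : 0 < `|w| by rewrite normr_gt0.
have p0 : 0 < 2 * pi :> R by apply: lt_le_trans two_pi_ge1.
rewrite (le_trans (ler_norm _))// normrM normfV normrX normr_id ler_wpM2l//.
have w2 : 2 * pi * w != 0 by rewrite mulf_neq0// gt_eqF.
rewrite lef_pV2 ?posrE ?exprn_gt0 ?normr_gt0//.
by rewrite lerXn2r ?nnegrE// normrM ger0_norm ?(ltW p0)// ler_peMl.
Qed.

(** The phase has derivative [2 pi eta_j q] along [j], with [q = 1 + (tau / eta_j) dg] and [dg] the
    derivative of [g] along [j]. In the axial direction [dg = 0]. *)
Lemma decay_nonstationary : exists C1 C : R, [/\ 1 <= C1, 0 <= C & forall (eta : 'rV[R]_(n + 1)) (tau : R) j,
  eta 0 j != 0 -> C1 * `|tau| <= `|eta 0 j| ->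
  `|\int[lam]_x (Psi x * cos (phase eta tau x))| <= C / `|eta 0 j| ^+ n /\
  `|\int[lam]_x (Psi x * sin (phase eta tau x))| <= C / `|eta 0 j| ^+ n].
Proof.
have [L L0 hL] := partials_bound.
(* With [kap = tau / eta_j], the bound [|kap| C1 <= 1] gives [|kap dg| <= 1/2], hence [|q| >= 1/2];
   the summand 1 gives [|kap| <= 1]. *)
pose C1 := 2 * L + 1; have C11 : 1 <= C1 by rewrite /C1; lra.
pose Mq := 1 + 2 ^+ n * L.
have key j : exists C : R, forall (eta : 'rV[R]_(n + 1)) (tau : R), eta 0 j != 0 -> C1 * `|tau| <= `|eta 0 j| ->
    `|\int[lam]_x (Psi x * cos (phase eta tau x))| <= `|C| / `|eta 0 j| ^+ n /\
    `|\int[lam]_x (Psi x * sin (phase eta tau x))| <= `|C| / `|eta 0 j| ^+ n.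
  have [M hM] := bump_amp x0 rho0 n j.
  have [C hC] := nonstationary_phase lam_trans lam_fin (ev j) cB oO BO Br n M Mq (ltac:(lra) : 0 < 1 / 2 :> R).
  exists C => eta tau eta0 htau.
  pose kap := tau / eta 0 j.
  have e1 : 0 < `|eta 0 j| by rewrite normr_gt0.
  have kapL : `|kap| * C1 <= 1.
    by rewrite /kap normrM normfV mulrAC ler_pdivrMr// mul1r mulrC.
  have kap1 : `|kap| <= 1 by apply: le_trans kapL; rewrite ler_peMr.
  have w0 : 2 * pi * eta 0 j != 0.
    by rewrite mulf_neq0// gt_eqF// (lt_le_trans _ two_pi_ge1).
  have [dg hdg1 hdg2] : exists2 dg : 'rV[R]_(n + 1) -> R,
      multiplier O (ev j) n L dg &
      forall x, O x -> is_derive x (ev j) (fun x => g (lsubmx x)) (dg x).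
    case: (split_ordP j) => [j0 ->|j0 ->].
      exists (Fam j0 0); last by move=> x Ox; exact: g_derive.
      apply: (@multiplier_family R _ O (dir j0) (Fam j0) n L oO).
      - by move=> i x _; exact: Fam_continuous.
      - by move=> i x ni Ox; have [] := hL j0 i (lsubmx x) ni (O_in Ox).
      - by move=> i x _; exact: Fam_derive.
      - by rewrite add0n.
    exists (fun=> 0); last by move=> x _; exact: is_derive_lsubmx_last.
    by apply: multiplier_le (multiplier_cst O _ n 0); rewrite normr0.
  pose q x := 1 + kap * dg x.
  have hq : multiplier O (ev j) n Mq q.
    have h := multiplierD oO (multiplier_cst O (ev j) n 1)
      (multiplierM oO (multiplier_cst O (ev j) n kap) hdg1).
    apply: multiplier_le h; rewrite normr1 lerD2l ler_wpM2l ?exprn_ge0//.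
    by rewrite ler_piMl.
  have [_ hdgL _] := multiplier0 hdg1.
  have hq2 x : O x -> 1 / 2 <= `|q x|.
    move=> Ox; have h1 : `|kap * dg x| <= 1 / 2.
      rewrite normrM; apply: le_trans (_ : `|kap| * L <= _).
        by rewrite ler_wpM2l// hdgL.
      by move: kapL; rewrite /C1 mulrDr mulr1 mulrCA; have := normr_ge0 kap; lra.
    by move: h1; rewrite ler_norml /q => /andP[h1 h2]; rewrite ger0_norm; lra.
  have := hC (2 * pi * eta 0 j) Psi q (phase eta tau) w0 hM hq hq2.
  case.
  - by move=> x Ox; apply: phase_continuous; exact: O_in.
  - move=> x Ox; have := phase_derive eta tau (hdg2 x Ox).
    by congr is_derive; rewrite /q /kap; field.
  by move=> h1 h2; split; [apply: le_trans h1 _|apply: le_trans h2 _]; exact: absorb_2pi.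
have [C hC] := choice key.
exists C1, (\sum_j `|C j|); split => //; first exact: sumr_ge0.
move=> eta tau j eta0 htau; have [h1 h2] := hC j eta tau eta0 htau.
have le : `|C j| / `|eta 0 j| ^+ n <= (\sum_j `|C j|) / `|eta 0 j| ^+ n.
  rewrite ler_wpM2r ?invr_ge0 ?exprn_ge0//.
  by rewrite (bigD1 j)//= lerDl sumr_ge0.
by split; apply: le_trans le.
Qed.

(** The linear term of the phase difference is constant in [x], so its derivative along [j] is
    [2 pi tau] times the increment of the [j]-th partial derivative of [g], which is at least
    [c |v|] for the [j] attached to [v]. *)
Lemma decay_difference : exists2 C : R, 0 <= C & forall (eta : 'rV[R]_(n + 1)) (tau : R) (v : 'rV[R]_n),
  tau != 0 -> v != 0 -> `|v| <= rho ->
  `|\int[lam]_x (Psi x * Psi (x + row_mx v 0) *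
      cos (phase eta tau (x + row_mx v 0) - phase eta tau x))| <= C / (`|tau| * `|v|) ^+ n.
Proof.
have [L L0 hL] := partials_bound.
have key (j : 'I_n) : exists C : R, forall (eta : 'rV[R]_(n + 1)) (tau : R) (v : 'rV[R]_n),
    tau != 0 -> v != 0 -> `|v| <= rho ->
    (forall y, `|y - y0| <= r -> `|y + v - y0| <= r ->
      c * `|v| <= `|partial j g (y + v) - partial j g y|) ->
    `|\int[lam]_x (Psi x * Psi (x + row_mx v 0) *
        cos (phase eta tau (x + row_mx v 0) - phase eta tau x))| <= `|C| / (`|tau| * `|v|) ^+ n.
  have [M hM] := bump_amp x0 rho0 n (lshift 1 j).
  have M0 := amplitude_ge0 hM.
  have [C hC] := nonstationary_phase lam_trans lam_fin (dir j) cB oO BO Br n (2 ^+ n * (M * M)) (n%:R * L) c0.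
  exists C => eta tau v tau0 v0 vrho hv.
  set h : 'rV[R]_(n + 1) := row_mx v 0.
  have v1 : 0 < `|v| by rewrite normr_gt0.
  have lsh x : lsubmx (x + h) = lsubmx x + v by rewrite linearD /= /h row_mxKl.
  (* Division by [|v|] makes the lower bound [c] and the bounds on all derivatives independent of
     [v]; the large parameter is then [2 pi tau |v|]. *)
  pose Q i x := `|v|^-1 * (Fam j i (x + h) - Fam j i x).
  have Fsh_derive i x : O x -> is_derive x (dir j) (fun x => Fam j i (x + h)) (Fam j i.+1 (x + h)).
    move=> Ox; apply/is_derive_translate; apply: is_derive_lsubmx.
    by apply: (smooth_is_derive sg (nseq i.+1 j) j); rewrite lsh; apply: rV; exact: O_shift_in.
  have Q_derive i x : O x -> is_derive x (dir j) (Q i) (Q i.+1 x).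
    move=> Ox; have h1 := Fsh_derive i x Ox; have h2 := Fam_derive j i Ox.
    have h3 : is_derive x (dir j) (fun x => Fam j i (x + h) - Fam j i x) (Fam j i.+1 (x + h) - Fam j i.+1 x).
      exact: is_deriveB.
    exact: is_deriveZ.
  have Q_cont i x : O x -> {for x, continuous (Q i)}.
    move=> Ox; apply: continuousM; first exact: cst_continuous.
    apply: continuousB; last exact: Fam_continuous.
    apply: continuous_translate; apply: continuous_lsubmx.
    by apply: (smooth_continuous sg); rewrite lsh; apply: rV; exact: O_shift_in.
  have Q_bound i x : (i <= n)%N -> O x -> `|Q i x| <= n%:R * L.
    move=> ni Ox; rewrite /Q normrM normfV normr_id mulrC ler_pdivrMr//.
    have := @lipschitz_ball R n (iter_partial (nseq i.+1 j) g) y0 r L L0 _ (lsubmx x) (lsubmx x + v).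
    rewrite /Fam lsh [lsubmx x + v - lsubmx x]addrC addKr; apply.
    - move=> y hy l; have [_ b] := hL j i y ni hy; split; last exact: b.
      by have [d _] := smooth_is_derive sg (nseq i.+1 j) l (rV hy).
    - exact: O_in.
    - exact: O_shift_in.
  have hq : multiplier O (dir j) n (n%:R * L) (Q 0%N).
    apply: (@multiplier_family R _ O (dir j) Q n (n%:R * L) oO).
    - by move=> i x _; exact: Q_cont.
    - exact: Q_bound.
    - by rewrite add0n.
  have hamp : amplitude B (dir j) n (2 ^+ n * (M * M)) (fun x => Psi x * Psi (x + h)).
    exact: (amplitudeM cB BO M0 hM (amplitude_translate O h hM)).
  have w0 : 2 * pi * (tau * `|v|) != 0.
    have p0 : 2 * pi != 0 :> R by rewrite gt_eqF// (lt_le_trans _ two_pi_ge1).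
    have tv0 : tau * `|v| != 0 by rewrite mulf_neq0// gt_eqF.
    by rewrite mulf_neq0.
  pose Phi x := phase eta tau (x + h) - phase eta tau x.
  have [] := hC (2 * pi * (tau * `|v|)) (fun x => Psi x * Psi (x + h)) (Q 0%N) Phi w0 hamp hq.
  - move=> x Ox; have := hv (lsubmx x) (O_in Ox) (O_shift_in vrho Ox).
    by rewrite /Q normrM normfV normr_id [_^-1 * _]mulrC ler_pdivlMr// /Fam lsh.
  - move=> x Ox; apply: continuousB.
      by apply: continuous_translate; apply: phase_continuous; rewrite lsh; exact: O_shift_in.
    by apply: phase_continuous; exact: O_in.
  - move=> x Ox.
    have h1 : is_derive (x + h) (dir j) (phase eta tau) (2 * pi * (eta 0 (lshift 1 j) + tau * Fam j 0 (x + h))).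
      apply: phase_derive; apply: is_derive_lsubmx.
      by apply: (smooth_is_derive sg [::] j); rewrite lsh; apply: rV; exact: O_shift_in.
    move/is_derive_translate : h1 => h1.
    have h2 := phase_derive eta tau (g_derive j Ox).
    have : is_derive x (dir j) Phi (2 * pi * (eta 0 (lshift 1 j) + tau * Fam j 0 (x + h)) -
        2 * pi * (eta 0 (lshift 1 j) + tau * Fam j 0 x)) by exact: is_deriveB.
    by congr is_derive; rewrite /Q; field; rewrite gt_eqF.
  move=> h1 _; apply: le_trans h1 _; 
  have -> : `|tau| * `|v| = `|tau * `|v| | by rewrite normrM normr_id.
  by apply: absorb_2pi; rewrite mulf_neq0// gt_eqF.
have [C hC] := choice key.
(* The direction [j] depends on [v], but only [n] constants can occur. *)
exists (\sum_j `|C j|); first exact: sumr_ge0.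
move=> eta tau v tau0 v0 vrho; have [j hj] := hdir v0.
apply: le_trans (hC j eta tau v tau0 v0 vrho hj) _.
rewrite ler_wpM2r ?invr_ge0 ?exprn_ge0 ?mulr_ge0//.
by rewrite (bigD1 j)//= lerDl sumr_ge0.
Qed.

(** Cosine and sine integrals are estimated together: only the sum of their squares produces, after
    differencing, the cosine of a phase difference. *)
Lemma surface_decay (s : R) : (0 < n)%N -> 0 < s < n%:R -> exists C : R,
  forall (eta : 'rV[R]_(n + 1)) (tau : R),
  Num.max `|eta| `|tau| `^ s * ((\int[lam]_x (Psi x * cos (phase eta tau x))) ^+ 2 +
    (\int[lam]_x (Psi x * sin (phase eta tau x))) ^+ 2) <= C.
Proof.
move=> n0 /andP[s0 sn].
have [C1 [CA [C11 CA0 hA]]] := decay_nonstationary.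
have [CB CB0 hB] := decay_difference.
have [M hM] := bump_amp x0 rho0 n (lshift 1 (Ordinal n0)).
have M0 := amplitude_ge0 hM.
pose rB := `|x0| + rho.
have bc (t : R) : `|cos t| <= 1 by rewrite ler_norml cos_geN1 cos_le1.
have bs (t : R) : `|sin t| <= 1 by rewrite ler_norml sin_geN1 sin_le1.
have cph eta tau x : O x -> {for x, continuous (phase eta tau)}.
  by move=> Ox; apply: phase_continuous; exact: O_in.
pose M' := 2 ^+ 0 * (M * 1).
have nc eta tau : nice rB M' (fun x => Psi x * cos (phase eta tau x)).
  apply: (amplitude_nice Br) (amplitudeM cB BO ler01 (amplitude0 hM) _).
  by apply: oscillation_multiplier => //; [exact: continuous_cos|exact: cph].
have ns eta tau : nice rB M' (fun x => Psi x * sin (phase eta tau x)).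
  apply: (amplitude_nice Br) (amplitudeM cB BO ler01 (amplitude0 hM) _).
  by apply: oscillation_multiplier => //; [exact: continuous_sin|exact: cph].
pose W := vol lam rB; pose W2 := vol lam (rB + rho).
have W0 : 0 <= W by exact: vol_ge0.
have W20 : 0 <= W2 by exact: vol_ge0.
have M'0 : 0 <= M' by rewrite /M' expr0 mul1r mulr1.
(* The decay [D^-n] is weakened to [D^-s = (D^-a)^n]; [a < 1] is what avoids the logarithm in the
   row sums. *)
pose a := s / n%:R.
have nR : 0 < n%:R :> R by rewrite ltr0n.
have a0 : 0 <= a by rewrite divr_ge0// ltW.
have a1 : a < 1 by rewrite ltr_pdivrMr// mul1r.
(* The first term serves pairs of distinct shifts, the second the diagonal, where only the trivial
   bound is available. *)
pose C' := CB * (2 / rho) ^+ n + 2 * (M' * M' * W).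
have C'0 : 0 <= C' by rewrite addr_ge0// ?mulr_ge0// exprn_ge0// divr_ge0// ltW.
pose C2 := 2 * (1 + (1 - a)^-1).
have C20 : 0 <= C2 by rewrite mulr_ge0// addr_ge0// invr_ge0 subr_ge0 ltW.
(* [E0], [EA] and [EB] bound the three regimes: small frequencies, dominant [eta], dominant
   [tau]. *)
pose E0 := C1 `^ s * (2 * (M' * W) ^+ 2).
pose EA := 2 * CA ^+ 2.
pose EB := C1 `^ s * (W2 * (C' * C2 ^+ n)).
have E00 : 0 <= E0 by rewrite mulr_ge0 ?powR_ge0// mulr_ge0// sqr_ge0.
have EA0 : 0 <= EA by rewrite mulr_ge0// sqr_ge0.
have EB0 : 0 <= EB by rewrite mulr_ge0 ?powR_ge0// !mulr_ge0// exprn_ge0.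
exists (E0 + EA + EB) => eta tau; set X := Num.max _ _.
set I1 := \int[lam]_x _; set I2 := \int[lam]_x _.
have X0 : 0 <= X by rewrite le_max normr_ge0.
have sqle (x y : R) : `|x| <= y -> x ^+ 2 <= y ^+ 2.
  move=> xy; rewrite -[x ^+ 2]real_normK ?num_real// lerXn2r ?nnegrE//.
  exact: le_trans xy.
have [XC|XC] := leP X C1.
  apply: le_trans (_ : E0 <= _); last by move: E00 EA0 EB0; lra.
  apply: ler_pM; rewrite ?powR_ge0 ?addr_ge0 ?sqr_ge0//.
    by apply: ge0_ler_powR; rewrite ?nnegrE// ltW// (lt_le_trans _ C11).
  rewrite mulr_natl mulr2n; apply: lerD; apply: sqle.
    exact: (nice_Rintegral_le lam_fin (nc eta tau)).
  exact: (nice_Rintegral_le lam_fin (ns eta tau)).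
have X1 : 1 <= X by apply: le_trans (ltW XC).
have [etau|etau] := leP (C1 * `|tau|) `|eta|.
  apply: le_trans (_ : EA <= _); last by move: E00 EA0 EB0; lra.
  have XE : X = `|eta|.
    apply/max_idPl; apply: le_trans etau; by rewrite ler_peMl.
  have Xn0 : `|eta| != 0 by rewrite -XE gt_eqF// (lt_le_trans _ X1).
  have [[i1 j] /= ej] := mx_norm_neq0 (Xn0 : mx_norm eta != 0).
  have {}ej : `|eta 0 j| = X by rewrite XE -[`|eta| in RHS]/(mx_norm eta) ej (ord1 i1).
  have [|| h1 h2] := hA eta tau j.
  - by rewrite -normr_gt0 ej (lt_le_trans _ X1).
  - by rewrite ej XE.
  rewrite ej in h1 h2.
  have Xn1 : 1 <= X ^+ n by exact: exprn_ege1.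
  have XnP : 0 < X ^+ n by exact: lt_le_trans Xn1.
  apply: le_trans (_ : X ^+ n * (2 * (CA / X ^+ n) ^+ 2) <= _).
    apply: ler_pM; rewrite ?powR_ge0 ?addr_ge0 ?sqr_ge0//.
      by rewrite -powR_mulrn//; apply: ler_powR => //; exact: ltW.
    by rewrite mulr_natl mulr2n; apply: lerD; exact: sqle.
  have -> : X ^+ n * (2 * (CA / X ^+ n) ^+ 2) = EA / X ^+ n.
    by rewrite /EA; field; rewrite gt_eqF.
  by rewrite ler_pdivrMr// ler_peMr.
apply: le_trans (_ : EB <= _); last by move: E00 EA0 EB0; lra.
have Xtau : X <= C1 * `|tau|.
  by rewrite ge_max (ltW etau) ler_peMl.
have tau1 : 1 < `|tau|.
  rewrite -(ltr_pM2l (_ : 0 < C1)) ?mulr1; first exact: lt_le_trans XC Xtau.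
  exact: lt_le_trans C11.
have tau0 : tau != 0 by rewrite -normr_gt0 (lt_trans _ tau1).
(* Grid steps of length [rho / m], comparable to [1 / |tau|], the scale at which the correlations
   begin to decay. *)
pose m := (Num.truncn `|tau|).+1.
have m1 : `|tau| < m%:R by rewrite truncnS_gt.
have m2 : m%:R <= 2 * `|tau|.
  have := truncn_le `|tau|; rewrite normr_ge0 /m -natr1; move: tau1; lra.
have mP : 0 < m%:R :> R by rewrite ltr0n.
pose T := {ffun 'I_n -> 'I_m}.
pose vv (p : T) : 'rV[R]_n := \row_i (rho / m%:R * (p i)%:R).
pose h (p : T) : 'rV[R]_(n + 1) := row_mx (vv p) 0.
have row_norm (v : 'rV[R]_n) : `|row_mx v (0 : 'rV[R]_1)| <= `|v|.
  apply/rV_norm_le => // i; case: (split_ordP i) => k ->.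
    by rewrite row_mxEl; exact: rV_norm_coord.
  by rewrite row_mxEr mxE normr0.
have vd (p q : T) i : (vv p - vv q) 0 i = rho / m%:R * ((p i)%:R - (q i)%:R).
  by rewrite !mxE mulrBr.
have rm0 : 0 < rho / m%:R by rewrite divr_gt0.
have vdn (p q : T) i : `|(vv p - vv q) 0 i| = rho / m%:R * (ndist (p i) (q i))%:R.
  by rewrite vd normrM normr_ndist gtr0_norm.
have vle (p q : T) : `|vv p - vv q| <= rho.
  apply/rV_norm_le => [|i]; first exact: ltW.
  rewrite vdn mulrAC ler_pdivrMr// ler_wpM2l ?(ltW rho0)// ler_nat.
  exact: ndist_le.
have hle (p : T) : `|h p| <= rho.
  apply: le_trans (row_norm _) _; apply/rV_norm_le => [|i]; first exact: ltW.
  rewrite mxE normrM (gtr0_norm rm0) ger0_norm// mulrAC ler_pdivrMr//.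
  by rewrite ler_wpM2l ?(ltW rho0)// ler_nat ltnW.
have hE (p q : T) : h p - h q = row_mx (vv p - vv q) 0.
  by rewrite /h opp_row_mx add_row_mx oppr0 addr0.
have w1 := weyl_square lam_trans lam_fin (nc eta tau) hle.
have w2 := weyl_square lam_trans lam_fin (ns eta tau) hle.
have J (p q : T) : \int[lam]_x (Psi (x + (h p - h q)) * cos (phase eta tau (x + (h p - h q))) *
     (Psi x * cos (phase eta tau x))) +
   \int[lam]_x (Psi (x + (h p - h q)) * sin (phase eta tau (x + (h p - h q))) *
     (Psi x * sin (phase eta tau x))) <= C' * \prod_i wt a (p i) (q i).
  have n1 := niceM (nice_translate (h p - h q) (nc eta tau)) (nc eta tau).
  have n2 := niceM (nice_translate (h p - h q) (ns eta tau)) (ns eta tau).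
  have [pq|pq] := eqVneq p q.
    have -> : \prod_i wt a (p i) (q i) = 1.
      by rewrite pq big1// => i _; rewrite /wt subnn powR1.
    rewrite mulr1 pq subrr; under eq_Rintegral do rewrite addr0.
    under [X in _ + X <= _]eq_Rintegral do rewrite addr0.
    have b1 := nice_Rintegral_le lam_fin (niceM (nc eta tau) (nc eta tau)).
    have b2 := nice_Rintegral_le lam_fin (niceM (ns eta tau) (ns eta tau)).
    have CBp : 0 <= CB * (2 / rho) ^+ n by rewrite mulr_ge0// exprn_ge0// divr_ge0// ltW.
    have l1 := le_trans (ler_norm _) b1; have l2 := le_trans (ler_norm _) b2.
    apply: le_trans (lerD l1 l2) _; rewrite /C' -/W; move: CBp; set z := CB * _; lra.
  have [i D0 hD'] := prod_wt_ge a0 pq.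
  set D := ndist (p i) (q i) in D0 hD'.
  have hD : (D%:R ^+ n)^-1 <= \prod_i wt a (p i) (q i).
    apply: le_trans hD'; rewrite -exprVn lerXn2r ?nnegrE ?invr_ge0 ?powR_ge0//.
    by rewrite -powR_inv1//; apply: ler_powR; rewrite ?ler1n// lerN2 ltW.
  have v0 : vv p - vv q != 0.
    apply/eqP => v0; have := vdn p q i; rewrite v0 mxE normr0 => /esym/eqP.
    by rewrite mulf_eq0 (gt_eqF rm0) pnatr_eq0 (gtn_eqF D0).
  have := hB eta tau _ tau0 v0 (vle p q); rewrite -hE => hJ.
  (* The two correlations combine through [cos A cos B + sin A sin B = cos (A - B)]. *)
  have EJ : \int[lam]_x (Psi (x + (h p - h q)) * cos (phase eta tau (x + (h p - h q))) *
     (Psi x * cos (phase eta tau x))) +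
   \int[lam]_x (Psi (x + (h p - h q)) * sin (phase eta tau (x + (h p - h q))) *
     (Psi x * sin (phase eta tau x))) = \int[lam]_x (Psi x * Psi (x + (h p - h q)) *
      cos (phase eta tau (x + (h p - h q)) - phase eta tau x)).
    rewrite -RintegralD//; [|exact: (nice_integrable lam_fin n1)|exact: (nice_integrable lam_fin n2)].
    by apply: eq_Rintegral => x _; rewrite cosB; ring.
  rewrite EJ; apply: le_trans (ler_norm _) _; apply: le_trans hJ _.
  have DP : 0 < D%:R :> R by rewrite ltr0n.
  have tv : rho / 2 * D%:R <= `|tau| * `|vv p - vv q|.
    apply: le_trans (_ : `|tau| * (rho / m%:R * D%:R) <= _).
      rewrite mulrA ler_wpM2r ?(ltW DP)// mulrCA ler_wpM2l ?(ltW rho0)//.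
      by rewrite ler_pdivlMr// mulrC ler_pdivrMr// mulrC.
    by rewrite ler_wpM2l// -vdn; exact: rV_norm_coord.
  apply: le_trans (_ : CB * (2 / rho) ^+ n * (D%:R ^+ n)^-1 <= _).
    rewrite -mulrA ler_wpM2l// -exprVn -exprMn -exprVn lerXn2r ?nnegrE//.
      by rewrite mulr_ge0 ?invr_ge0 ?ler0n// divr_ge0// ltW.
    have -> : 2 / rho / D%:R = (rho / 2 * D%:R)^-1 by field; rewrite !gt_eqF.
    have P1 : 0 < rho / 2 * D%:R by rewrite !mulr_gt0.
    by rewrite lef_pV2 ?posrE// (lt_le_trans P1).
  apply: ler_pM => //.
  - by rewrite mulr_ge0// exprn_ge0// divr_ge0// ltW.
  - by rewrite /C' lerDl !mulr_ge0.
have cT : #|{: T}|%:R = m%:R ^+ n :> R by rewrite card_ffun !card_ord natrX.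
(* Differencing gains the square of the number [m^n] of shifts, while the weights sum to
   [O(m^((2-a)n)) = O(m^(2n-s))]; the quotient is [m^-s]. *)
have tot : (m%:R ^+ n) ^+ 2 * (I1 ^+ 2 + I2 ^+ 2) <= W2 * (C' * (C2 ^+ n * (m%:R `^ (2 - a)) ^+ n)).
  rewrite mulrDr -!exprMn -cT.
  apply: le_trans (lerD w1 w2) _; rewrite -mulrDr ler_wpM2l// -big_split /=.
  apply: le_trans (_ : \sum_(p : T) \sum_(q : T) C' * \prod_i wt a (p i) (q i) <= _).
    by apply: ler_sum => p _; rewrite -big_split /=; apply: ler_sum => q _; exact: J.
  under eq_bigr do rewrite -mulr_sumr.
  rewrite -mulr_sumr ler_wpM2l//.
  by rewrite exprMn; apply: sum_wt_ffun; rewrite a0 a1.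
have mE : (m%:R `^ (2 - a)) ^+ n = (m%:R ^+ n) ^+ 2 * m%:R `^ (- s) :> R.
  rewrite -powR_mulrn ?powR_ge0// -powRrM.
  have -> : (2 - a) * n%:R = (n * 2)%:R + - s.
    by rewrite /a natrM; field; rewrite gt_eqF.
  rewrite powRD; last by rewrite (gt_eqF mP) implybT.
  by rewrite powR_mulrn ?ler0n// exprM.
have mn0 : 0 < (m%:R ^+ n) ^+ 2 :> R by rewrite !exprn_gt0.
have tot2 : I1 ^+ 2 + I2 ^+ 2 <= W2 * (C' * C2 ^+ n) * m%:R `^ (- s).
  rewrite -(ler_pM2l mn0) (le_trans tot)// mE le_eqVlt; apply/orP; left; apply/eqP; ring.
apply: le_trans (_ : (C1 `^ s * m%:R `^ s) * (W2 * (C' * C2 ^+ n) * m%:R `^ (- s)) <= _).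
  apply: ler_pM; rewrite ?powR_ge0 ?addr_ge0 ?sqr_ge0//.
  have C1p : 0 <= C1 by apply: le_trans C11.
  rewrite -powRM ?(ltW mP)//; apply: ge0_ler_powR; rewrite ?nnegrE ?mulr_ge0 ?(ltW mP) ?(ltW s0)//.
  apply: le_trans Xtau _; by rewrite ler_wpM2l// ltW.
rewrite powRN; have ms : m%:R `^ s != 0 :> R by rewrite gt_eqF// powR_gt0.
rewrite le_eqVlt; apply/orP; left; apply/eqP; rewrite /EB; field.
exact: ms.
Qed.

End surface_decay.

(** * Lower bound: pushing a density forward to the cylinder *)

Section trigonometric_measurability.
Variables (R : realType) (m : nat).
Implicit Types z : 'rV[R]_m.

Let measurable_phase z :
  measurable_fun (setT : set (BorelR R m)) (fun x : 'rV[R]_m => 2 * pi * dotp x z).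
Proof.
apply: continuous_measurableB => x.
have h : {for x, continuous (fun y : 'rV[R]_m => dotp y z)} by exact: (@continuous_dotp R _ z x).
exact: (continuousM (@cst_continuous _ _ (2 * pi : R) x) h).
Qed.

Lemma measurable_cos_dotp z :
  measurable_fun (setT : set (BorelR R m)) (fun x : 'rV[R]_m => cos (2 * pi * dotp x z)).
Proof.
apply: (measurableT_comp _ (measurable_phase z)).
by apply: continuous_measurable_fun => t; exact: continuous_cos.
Qed.

Lemma measurable_sin_dotp z :
  measurable_fun (setT : set (BorelR R m)) (fun x : 'rV[R]_m => sin (2 * pi * dotp x z)).
Proof.
apply: (measurableT_comp _ (measurable_phase z)).
by apply: continuous_measurable_fun => t; exact: continuous_sin.
Qed.

End trigonometric_measurability.

Lemma sqr_powR_half (R : realType) (x s : R) : (x `^ (s / 2)) ^+ 2 = x `^ s.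
Proof. by rewrite -powR_mulrn ?powR_ge0// -powRrM divfK. Qed.

Section insertion.
Variables (R : realType) (n : nat) (i : 'I_n.+1).

Definition insert_coord (y : 'rV[R]_n) (t : R) : 'rV[R]_n.+1 :=
  \row_k (if unlift i k is Some j then y 0 j else t).

Lemma insert_coord_eq y t : insert_coord y t 0 i = t.
Proof. by rewrite mxE unlift_none. Qed.

Lemma insert_coord_lift y t j : insert_coord y t 0 (lift i j) = y 0 j.
Proof. by rewrite mxE liftK. Qed.

Lemma drop_insert_coord y t : drop_coord i (insert_coord y t) = y.
Proof. by apply/rowP => j; rewrite mxE insert_coord_lift. Qed.

Lemma insert_coord_drop (x : 'rV[R]_n.+1) : insert_coord (drop_coord i x) (x 0 i) = x.
Proof. by apply/rowP => k; rewrite mxE; case: unliftP => [j ->|->] //; rewrite mxE. Qed.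

Lemma drop_norm (x : 'rV[R]_n.+1) : `|drop_coord i x| <= `|x|.
Proof. by apply/rV_norm_le => // j; rewrite mxE; exact: rV_norm_coord. Qed.

Lemma drop_coordB (x y : 'rV[R]_n.+1) : drop_coord i (x - y) = drop_coord i x - drop_coord i y.
Proof. by apply/rowP => j; rewrite !mxE. Qed.

Lemma insert_coord_norm_lt y t (x : 'rV[R]_n.+1) (e : R) : 0 < e ->
  `|y - drop_coord i x| < e -> `|t - x 0 i| < e -> `|insert_coord y t - x| < e.
Proof.
move=> e0 hy ht; apply/rV_norm_lt => // k; rewrite [_ 0 k]mxE [(- x) 0 k]mxE.
case: (unliftP i k) => [j ->|->]; last by rewrite insert_coord_eq.
rewrite insert_coord_lift; apply: le_lt_trans hy.
by have := rV_norm_coord (y - drop_coord i x) j; rewrite !mxE.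
Qed.

End insertion.

Section lower_bound.
Variables (R : realType) (n : nat) (S : set 'rV[R]_n.+1).
Variables (i : 'I_n.+1) (V : set 'rV[R]_n) (g : 'rV[R]_n -> R) (y0 : 'rV[R]_n).
Hypotheses (n0 : (0 < n)%N) (oV : open V) (sg : smooth_on V g) (Vy0 : V y0).
Hypothesis hess : \det (\matrix_(j < n, k < n) partial j (partial k g) y0) != 0.
Variable r1 : R.
Hypotheses (r10 : 0 < r1) (graphS : forall y, V y -> `|y - y0| <= r1 -> S (insert_coord i y (g y))).

(** [g] is regular on [V] only, whereas a pushforward needs a map that is measurable everywhere;
    hence the extension by zero. *)
Let gV := g \_ V.

Definition graph_map (x : BorelR R (n + 1)) : BorelR R (n.+1 + 1) :=
  row_mx (insert_coord i (lsubmx (x : 'rV[R]_(n + 1))) (gV (lsubmx (x : 'rV[R]_(n + 1))))) (rsubmx (x : 'rV[R]_(n + 1))).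

Lemma measurable_graph_map : measurable_fun setT graph_map.
Proof.
have mgV : measurable_fun (setT : set (BorelR R n)) gV.
  apply/measurable_restrict => //; first exact: open_measurableB.
  rewrite setTI; apply: open_continuous_measurableB => // y Vy.
  exact: (smooth_continuous sg (js := [::]) Vy).
have ml : measurable_fun setT (fun x : BorelR R (n + 1) => lsubmx (x : 'rV[R]_(n + 1)) : BorelR R n).
  apply: measurable_fun_rV => j.
  rewrite (_ : (fun _ => _) = (fun x : 'rV[R]_(n + 1) => x 0 (lshift 1 j))); first exact: coord_measurableB.
  by apply/funext => x; rewrite mxE.
apply: measurable_fun_rV => k; case: (split_ordP k) => [k1 ->|k1 ->].
  case: (unliftP i k1) => [j ->|->].
    rewrite (_ : (fun _ => _) = (fun x : 'rV[R]_(n + 1) => x 0 (lshift 1 j))); first exact: coord_measurableB.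
    by apply/funext => x; rewrite row_mxEl insert_coord_lift mxE.
  rewrite (_ : (fun _ => _) = gV \o (fun x : 'rV[R]_(n + 1) => lsubmx x)).
    exact: measurableT_comp mgV ml.
  by apply/funext => x; rewrite row_mxEl insert_coord_eq.
rewrite (_ : (fun _ => _) = (fun x : 'rV[R]_(n + 1) => x 0 (rshift n k1))); first exact: coord_measurableB.
by apply/funext => x; rewrite row_mxEr mxE.
Qed.

Definition frequency (z : 'rV[R]_(n.+1 + 1)) : 'rV[R]_(n + 1) :=
  row_mx (drop_coord i (lsubmx z)) (rsubmx z).

Lemma dotp_graph_map (x : 'rV[R]_(n + 1)) z : V (lsubmx x) ->
  dotp (graph_map x) z = dotp x (frequency z) + z 0 (lshift 1 i) * g (lsubmx x).
Proof.
move=> Vx; have gVE : gV (lsubmx x) = g (lsubmx x) by rewrite /gV /patch mem_set.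
rewrite /dotp [LHS]big_split_ord /= [X in _ = X + _]big_split_ord /=.
rewrite [X in X + _](bigD1_ord i)//=.
rewrite /graph_map row_mxEl insert_coord_eq gVE mulrC -addrA addrC; congr (_ + _); congr (_ + _).
  by apply: eq_bigr => j _; rewrite row_mxEl insert_coord_lift /frequency row_mxEl !mxE.
by apply: eq_bigr => j _; rewrite row_mxEr /frequency row_mxEr !mxE.
Qed.

Lemma enorm_le_frequency z : enorm z <=
  n.+2%:R * Num.max `|frequency z| `|z 0 (lshift 1 i)|.
Proof.
set X := Num.max _ _; have X0 : 0 <= X by rewrite le_max normr_ge0.
have hk k : `|z 0 k| <= X.
  rewrite le_max; case: (split_ordP k) => [k1 ->|k1 ->].
    case: (unliftP i k1) => [j ->|->]; last by rewrite lexx orbT.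
    apply/orP; left; have := rV_norm_coord (frequency z) (lshift 1 j).
    by rewrite /frequency row_mxEl !mxE.
  apply/orP; left; have := rV_norm_coord (frequency z) (rshift n k1).
  by rewrite /frequency row_mxEr !mxE.
rewrite /enorm -[leRHS]ger0_norm ?mulr_ge0// -sqrtr_sqr ler_wsqrtr//.
apply: le_trans (_ : \sum_(k < n.+1 + 1) X ^+ 2 <= _).
  by apply: ler_sum => k _; rewrite -[_ ^+ 2]real_normK ?num_real// lerXn2r ?nnegrE.
rewrite sumr_const card_ord -[leLHS]mulr_natl exprMn ler_wpM2r ?sqr_ge0//.
by rewrite addn1 expr2 ler_peMl// ler1n.
Qed.

(** [mu] is the pushforward of [Psi lam] under [graph_map]. Its transform at [z] is the oscillatory
    integral of [surface_decay] with [eta = frequency z] and [tau] the component of [z] in the graph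
    direction [i]. *)
Lemma fourier_exponent_graph (s : R) : 0 < s < n%:R -> fourier_exponents (cylinder S) s.
Proof.
move=> hs; have /andP[s0 sn] := hs.
have [lam [lam_trans lam_fin lam_pos]] := lebesgue_rV_exists R (n + 1).
have [r2 [c [r20 c0 rV2 hdir2]]] := hessian_direction oV sg Vy0 hess.
pose r := Num.min r1 r2.
have r0 : 0 < r by rewrite lt_min r10 r20.
have rr1 : r <= r1 by rewrite ge_min lexx.
have rr2 : r <= r2 by rewrite ge_min lexx orbT.
have rV y : `|y - y0| <= r -> V y by move=> h; apply: rV2; exact: le_trans rr2.
have hdir v : v != 0 -> exists j, forall y, `|y - y0| <= r -> `|y + v - y0| <= r ->
    c * `|v| <= `|partial j g (y + v) - partial j g y|.
  move=> /hdir2[j hj]; exists j => y h1 h2; apply: hj; exact: le_trans rr2.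
have [rho rho0 rE] : exists2 rho : R, 0 < rho & r = 4 * rho.
  by exists (r / 4); [rewrite divr_gt0|field].
clearbody r.
have [C hC] := surface_decay lam_trans lam_fin sg c0 rV hdir rho0 rE n0 hs.
set x0 : 'rV[R]_(n + 1) := row_mx y0 0 in hC.
set Psi := bump x0 rho n in hC.
have cPsi : continuous Psi by exact: continuous_bump.
have mPsi : measurable_fun (setT : set (BorelR R (n + 1))) Psi by exact: continuous_measurableB.
have Psi0 x : 0 <= Psi x by exact: bump_ge0.
have PsiB x : ~ (`|x - x0| <= rho) -> Psi x = 0 by exact: bump_eq0.
have Psi_in x : Psi x != 0 -> `|lsubmx x - y0| <= rho.
  move=> px; have : `|x - x0| <= rho by apply: contrapT => /PsiB; exact/eqP.
  apply: le_trans; rewrite -{1}(row_mxKl y0 (0 : 'rV[R]_1)) -linearB; exact: lsubmx_norm.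
have nPsi : exists rr M, nice rr M Psi.
  have [M hM] := bump_amp x0 rho0 n (lshift 1 (Ordinal n0)).
  exists (`|x0| + rho), M; apply: (amplitude_nice _) hM => x /= h.
  by rewrite -{1}(subrKC x0 x) (le_trans (ler_normD _ _))// lerD2l.
have [rr [M niceP]] := nPsi.
have iPsi := nice_integrable lam_fin niceP.
have [nu [nuE nuI]] := density_measure_exists lam mPsi Psi0.
have mG := measurable_graph_map.
pose mu := image_measure nu mG.
have muE A : measurable A -> mu A = (\int[lam]_(x in graph_map @^-1` A) (Psi x)%:E)%E.
  by move=> mA; rewrite -nuE//; have := measurable_graph_map measurableT mA; rewrite setTI.
have muT : mu setT = (\int[lam]_x (Psi x)%:E)%E by rewrite muE// preimage_setT.
have muT_fin : (mu setT < +oo)%E.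
  have := integrable_fin_num measurableT iPsi; rewrite muT ge0_fin_numE//.
  by apply: integral_ge0 => x _; rewrite lee_fin.
have muI (F : BorelR R (n.+1 + 1) -> R) : measurable_fun setT F -> (forall z, 0 <= F z) ->
    (\int[mu]_z (F z)%:E = \int[lam]_x (F (graph_map x) * Psi x)%:E)%E.
  move=> mF F0; have mFE : measurable_fun setT (EFin \o F) by exact/measurable_EFinP.
  rewrite [LHS](ge0_integral_pushforward mG nu measurableT mFE); last by move=> z _; rewrite lee_fin.
  rewrite preimage_setT nuI; first by apply: eq_integral => x _; rewrite EFinM.
    exact: measurableT_comp mFE mG.
  by move=> x; rewrite lee_fin.
(* [muI] is for nonnegative integrands, so it is applied to [u + 1] and to 1, and the results are
   subtracted. *)
have muR (u : BorelR R (n.+1 + 1) -> R) : measurable_fun setT u -> (forall z, `|u z| <= 1) ->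
    \int[mu]_z u z = \int[lam]_x (u (graph_map x) * Psi x).
  move=> mu_ u1.
  have muG : measurable_fun setT (u \o graph_map) by exact: measurableT_comp mu_ mG.
  have i1 : mu.-integrable setT (EFin \o u).
    apply: measurable_bounded_integrable => //.
    by exists 1; split => [|M' M1 z _]; [exact: num_real|exact: le_trans (u1 z) (ltW M1)].
  have i2 : mu.-integrable setT (EFin \o fun=> 1).
    apply: measurable_bounded_integrable => //.
    by exists 1; split => [|M' M1 z _]; [exact: num_real|rewrite normr1 ltW].
  have i3 : lam.-integrable setT (EFin \o (fun x => u (graph_map x) * Psi x)).
    apply: le_integrable iPsi => //.
      by apply/measurable_EFinP; exact: measurable_funM.
    by move=> x _; rewrite /= lee_fin normrM ler_piMl.
  have e1 : (\int[mu]_z (1 : R)%:E = \int[lam]_x (1 * Psi x)%:E)%E.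
    by apply: (muI (fun=> 1)) => //; exact: measurable_cst.
  have e2 : (\int[mu]_z (u z + 1)%:E = \int[lam]_x ((u (graph_map x) + 1) * Psi x)%:E)%E.
    apply: (muI (fun z => u z + 1)); first exact: measurable_funD.
    by move=> z; have := u1 z; rewrite ler_norml => /andP[h _]; move: h; lra.
  have f1 : \int[mu]_z 1 = \int[lam]_x Psi x.
    by rewrite /Rintegral e1; congr fine; apply: eq_integral => x _; rewrite mul1r.
  have f2 : \int[mu]_z (u z + 1) = \int[lam]_x (u (graph_map x) * Psi x + Psi x).
    by rewrite /Rintegral e2; congr fine; apply: eq_integral => x _; rewrite mulrDl mul1r.
  by move: f2; rewrite RintegralD// RintegralD// f1 => /addIr.
(* Where [Psi] vanishes the value of [gV] does not matter; elsewhere the base point is in [V] and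
   [gV] is [g]. *)
have PsiE (T : R -> R) z x : T (2 * pi * dotp (graph_map x) z) * Psi x =
    Psi x * T (phase g (frequency z) (z 0 (lshift 1 i)) x).
  have [->|px] := eqVneq (Psi x) 0; first by rewrite mulr0 mul0r.
  rewrite mulrC; congr (_ * T _); rewrite /phase dotp_graph_map//.
  by apply: rV; apply: le_trans (Psi_in x px) _; rewrite rE; move: rho0; lra.
have re z : fourier_re mu z = \int[lam]_x (Psi x * cos (phase g (frequency z) (z 0 (lshift 1 i)) x)).
  rewrite /fourier_re muR; last 2 first.
  - exact: measurable_cos_dotp.
  - by move=> x; rewrite ler_norml cos_geN1 cos_le1.
  by apply: eq_Rintegral => x _; exact: (PsiE cos).
have im z : fourier_im mu z = - \int[lam]_x (Psi x * sin (phase g (frequency z) (z 0 (lshift 1 i)) x)).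
  rewrite /fourier_im muR; last 2 first.
  - exact: measurable_sin_dotp.
  - by move=> x; rewrite ler_norml sin_geN1 sin_le1.
  by congr (- _); apply: eq_Rintegral => x _; exact: (PsiE sin).
split.
  by rewrite (ltW s0) /= (le_trans (ltW sn))// ler_nat addn1; do 2 apply: leqW.
exists mu; split.
  split => //.
  - have [d d0 hd] := (continuousP_norm _ _).1 (cPsi x0) (Psi x0 / 2) ltac:(by rewrite divr_gt0// bump_center_gt0).
    have P0 : 0 < Psi x0 by exact: bump_center_gt0.
    pose A : set (BorelR R (n + 1)) := [set x : 'rV[R]_(n + 1) | `|x - x0| < d].
    have mA : measurable A by apply: open_measurableB; exact: open_ball_norm.
    have lA : (0 < lam A)%E.
      have := lam_trans x0 A mA => <-.
      have := lam_pos d d0; congr (0 < lam _)%E.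
      by apply/funext => x; rewrite /A /= addrK.
    rewrite muT gt_eqF//.
    apply: (@lt_le_trans _ _ (\int[lam]_(x in A) (Psi x0 / 2)%:E)%E).
      by rewrite integral_cst// mule_gt0// lte_fin divr_gt0.
    apply: (@le_trans _ _ (\int[lam]_(x in A) (Psi x)%:E)%E).
      apply: ge0_le_integral => //.
      - by move=> x _; rewrite lee_fin ltW// divr_gt0.
      - by apply/measurable_EFinP; exact: measurable_funTS.
      - move=> x /hd; rewrite lee_fin ltr_norml => /andP[h _]; move: h; lra.
    apply: ge0_subset_integral => //; first exact/measurable_EFinP.
    by move=> x _; rewrite lee_fin.
  - move=> z hz; apply: contrapT => nS.
    (* If the image of [Psi != 0] kept a distance [e] from [z], the ball of radius [e] about [z]
       would be null. A point off the cylinder has such a distance, either in its base point or in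
       its height. *)
    have key (e : R) : 0 < e -> (forall x, Psi x != 0 -> e <= `|(graph_map x : 'rV[R]_(n.+1 + 1)) - z|) -> False.
      move=> e0 he; have oW := @open_ball_norm R _ z e.
      have := hz _ oW; rewrite /= subrr normr0 => /(_ e0).
      rewrite muE; last exact: open_measurableB.
      rewrite (_ : integral _ _ _ = 0%E) ?ltxx//; apply: integral0_eq => x /= hx.
      have [->//|px] := eqVneq (Psi x) 0.
      by have := he x px; rewrite leNgt hx.
    set y := drop_coord i (lsubmx z).
    have near x : `|lsubmx x - y| <= `|(graph_map x : 'rV[R]_(n.+1 + 1)) - z|.
      apply: le_trans (lsubmx_norm _); apply: le_trans (drop_norm i _).
      by rewrite linearB /= drop_coordB /graph_map row_mxKl drop_insert_coord.
    have [yr|yr] := leP `|y - y0| rho; last first.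
      apply: (key (`|y - y0| - rho)); first by rewrite subr_gt0.
      move=> x /Psi_in px; apply: le_trans (near x).
      have : `|y - y0| <= `|lsubmx x - y| + `|lsubmx x - y0|.
        by rewrite (distrC _ y) -{1}(subrKA (lsubmx x)) ler_normD.
      by move: px; lra.
    have yr' : `|y - y0| <= r by rewrite rE; move: yr rho0; lra.
    have Vy : V y by exact: rV.
    pose e := `|(lsubmx z) 0 i - g y|.
    have e0 : 0 < e.
      rewrite normr_gt0 subr_eq0; apply/eqP => ze; apply: nS.
      rewrite /cylinder /= -(insert_coord_drop i (lsubmx z)) ze; apply: graphS => //.
      exact: le_trans yr' rr1.
    have [d d0 hd] := (continuousP_norm _ _).1 (smooth_continuous sg (js := [::]) Vy) (e / 2) ltac:(by rewrite divr_gt0).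
    (* Over base points within [d] of [y] the graph stays within [e / 2] of [g y], hence more than
       [e / 2] away from the height of [z]. *)
    apply: (key (Num.min d (e / 2))); first by rewrite lt_min d0 divr_gt0.
    move=> x px; rewrite leNgt lt_min; apply/negP => /andP[h1 h2].
    have hx := hd _ (le_lt_trans (near x) h1).
    have gx : gV (lsubmx x) = g (lsubmx x).
      rewrite /gV /patch mem_set//; apply: rV; apply: le_trans (Psi_in x px) _.
      by rewrite rE; move: rho0; lra.
    have hz2 : `|g (lsubmx x) - (lsubmx z) 0 i| < e / 2.
      apply: le_lt_trans h2.
      have := rV_norm_coord ((graph_map x : 'rV[R]_(n.+1 + 1)) - z) (lshift 1 i).
      by rewrite [(_ - z) 0 _]mxE [(- z) 0 _]mxE /graph_map row_mxEl insert_coord_eq gx [lsubmx z 0 i]mxE.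
    have : e <= `|g (lsubmx x) - (lsubmx z) 0 i| + `|g (lsubmx x) - g y|.
      by rewrite (distrC _ ((lsubmx z) 0 i)) /e -{1}(subrKA (g (lsubmx x))) ler_normD.
    by move: hx hz2 => /=; lra.
have [n1 C0] : 0 <= n.+2%:R :> R /\ 0 <= C.
  split => //; apply: le_trans (hC 0 0).
  by rewrite mulr_ge0 ?powR_ge0// addr_ge0 ?sqr_ge0.
exists (Num.sqrt (n.+2%:R `^ s * C)) => z.
rewrite /fourier_abs re im sqrrN.
set X := Num.max `|frequency z| `|z 0 (lshift 1 i)|.
have X0 : 0 <= X by rewrite le_max normr_ge0.
have := hC (frequency z) (z 0 (lshift 1 i)); rewrite -/X.
set Q := _ ^+ 2 + _ ^+ 2 => hQ.
have Q0 : 0 <= Q by rewrite addr_ge0 ?sqr_ge0.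
have en0 : 0 <= enorm z by exact: sqrtr_ge0.
have -> : enorm z `^ (s / 2) = Num.sqrt (enorm z `^ s).
  by rewrite -(sqr_powR_half (enorm z) s) sqrtr_sqr ger0_norm ?powR_ge0.
rewrite -sqrtrM ?powR_ge0//; apply: ler_wsqrtr.
apply: le_trans (_ : n.+2%:R `^ s * X `^ s * Q <= _).
  rewrite ler_wpM2r// -powRM//; apply: ge0_ler_powR; rewrite ?nnegrE ?mulr_ge0 ?(ltW s0)//.
  exact: enorm_le_frequency.
by rewrite -mulrA ler_wpM2l ?powR_ge0.
Qed.

End lower_bound.

(** * Energy of a measure with Fourier decay *)

Section supports.
Variables (R : realType) (m : nat).
Variable mu : {measure set (BorelR R m) -> \bar R}.

Lemma null_bigsetU (T : Type) (f : T -> set (BorelR R m)) (s : seq T) :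
  (forall x, measurable (f x) /\ mu (f x) = 0%E) ->
  measurable (\big[setU/set0]_(x <- s) f x) /\ mu (\big[setU/set0]_(x <- s) f x) = 0%E.
Proof.
move=> H; elim: s => [|x s [IH1 IH2]]; first by rewrite big_nil measure0.
rewrite big_cons; have [mx nx] := H x; split; first exact: measurableU.
apply/eqP; rewrite eq_le measure_ge0 andbT.
rewrite (@le_trans _ _ (mu (f x) + mu (\big[setU/set0]_(x <- s) f x))%E)//; first exact: measureU2.
by rewrite nx IH2 adde0.
Qed.

(** [supported_on] speaks of neighbourhoods of single points; a finite subcover by null open sets
    turns this into a statement about measure. *)
Lemma compact_null (K : set (BorelR R m)) : compact (K : set 'rV[R]_m) -> measurable K ->
  (forall x : 'rV[R]_m, K x -> exists U : set 'rV[R]_m, [/\ open U, U x & ~ (0 < mu U)%E]) ->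
  mu K = 0%E.
Proof.
move=> cK mK H.
have H' (x : 'rV[R]_m) : exists U : set 'rV[R]_m, [/\ open U, K x -> U x & mu U = 0%E].
  have [Kx|nK] := pselect (K x); last by exists set0; split => //; exact: open0.
  have [U [oU Ux nU]] := H x Kx; exists U; split => //.
  by apply/eqP; rewrite eq_le measure_ge0 andbT leNgt; apply/negP.
have [f hf] := choice H'.
have : compact (K : set 'rV[R]_m) by [].
rewrite compact_cover => /(_ 'rV[R]_m setT f).
case.
- by move=> x _; have [] := hf x.
- by move=> x Kx; exists x => //; have [_ h _] := hf x; exact: h.
move=> D _ KD.
have hf' x : measurable (f x : set (BorelR R m)) /\ mu (f x) = 0%E.
  by have [oU _ nU] := hf x; split => //; exact: open_measurableB.
have [mU nU] := null_bigsetU (finmap.enum_fset D) hf'.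
apply/eqP; rewrite eq_le measure_ge0 andbT -nU; apply: le_measure; rewrite ?inE//.
by move=> x /KD [y Dy fy]; rewrite -bigcup_seq; exists y.
Qed.

(** Otherwise every closed ball about 0 would be null by compactness, and these balls exhaust the
    space. *)
Lemma support_nonempty : mu setT != 0%E ->
  exists z : 'rV[R]_m, forall U : set 'rV[R]_m, open U -> U z -> (0 < mu U)%E.
Proof.
move=> mu0; apply: contrapT => H.
have null k : mu.-negligible ([set x : 'rV[R]_m | `|x| <= k%:R] : set (BorelR R m)).
  have mB : measurable ([set x : 'rV[R]_m | `|x| <= k%:R] : set (BorelR R m)).
    exact: measurable_ball0.
  apply/negligibleP => //; apply: compact_null => //.
    have := @compact_ball_norm R m 0 k%:R; congr compact.
    by apply/funext => x /=; rewrite subr0.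
  move=> x _; apply: contrapT => hx; apply: H; exists x => U oU Ux.
  by apply: contrapT => nU; apply: hx; exists U.
have := negligible_bigcup null.
rewrite (_ : \bigcup_k _ = setT); last first.
  apply/seteqP; split => // x _; exists (Num.truncn `|x : 'rV[R]_m|).+1 => //=.
  by apply/ltW; rewrite truncnS_gt.
by move=> /negligibleP-/(_ measurableT) /eqP; exact/negP.
Qed.

Lemma closed_lipschitz_le (f : 'rV[R]_m -> R) (c : R) :
  (forall x y, `|f x - f y| <= `|x - y|) -> closed [set x | f x <= c].
Proof.
move=> hf; rewrite -[X in closed X]setCK; apply: open_closedC; apply/openP_norm => x /= /negP.
rewrite -ltNge => xr; exists (f x - c); rewrite ?subr_gt0// => y yx.
apply/negP; rewrite -ltNge; have := hf y x; rewrite ler_norml => /andP[h _].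
by move: h yx; lra.
Qed.

End supports.

Section energy.
Variables (R : realType) (m : nat).
Variable mu : {measure set (BorelR R m) -> \bar R}.
Hypothesis mu_fin : (mu setT < +oo)%E.
Implicit Types u : 'rV[R]_m -> R.

Definition bounded_meas u := measurable_fun (setT : set (BorelR R m)) u /\
  exists M : R, forall x, `|u x| <= M.

Lemma bm_integrable u : bounded_meas u -> mu.-integrable setT (EFin \o u).
Proof.
move=> [mu_ [M hM]]; apply: measurable_bounded_integrable => //.
by exists M; split => [|M' M1 z _]; [exact: num_real|exact: le_trans (hM z) (ltW M1)].
Qed.

Lemma bm_cst (c : R) : bounded_meas (fun=> c).
Proof. by split; [exact: measurable_cst|exists `|c|]. Qed.

Lemma bmM u1 u2 : bounded_meas u1 -> bounded_meas u2 -> bounded_meas (fun x => u1 x * u2 x).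
Proof.
move=> [h1 [M1 b1]] [h2 [M2 b2]]; split; first exact: measurable_funM.
by exists (M1 * M2) => x; rewrite normrM ler_pM.
Qed.

Lemma bmD u1 u2 : bounded_meas u1 -> bounded_meas u2 -> bounded_meas (fun x => u1 x + u2 x).
Proof.
move=> [h1 [M1 b1]] [h2 [M2 b2]]; split; first exact: measurable_funD.
by exists (M1 + M2) => x; rewrite (le_trans (ler_normD _ _))// lerD.
Qed.

Lemma bm_RintegralZr u (c : R) : bounded_meas u ->
  \int[mu]_x (u x * c) = (\int[mu]_x u x) * c.
Proof. by move=> bu; rewrite RintegralZr//; exact: bm_integrable. Qed.

Lemma bm_sum (I : Type) (s : seq I) (F : I -> 'rV[R]_m -> R) : (forall i, bounded_meas (F i)) ->
  bounded_meas (fun x => \sum_(i <- s) F i x) /\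
  \int[mu]_x (\sum_(i <- s) F i x) = \sum_(i <- s) \int[mu]_x F i x.
Proof.
move=> H; elim: s => [|i s [IH1 IH2]].
  have -> : (fun x => \sum_(i <- [::]) F i x) = (fun=> 0) by apply/funext => x; rewrite big_nil.
  by split; [exact: bm_cst|rewrite big_nil Rintegral_cst// mul0r].
have -> : (fun x => \sum_(i0 <- i :: s) F i0 x) = (fun x => F i x + \sum_(i0 <- s) F i0 x).
  by apply/funext => x; rewrite big_cons.
split; first exact: bmD.
by rewrite big_cons -IH2 RintegralD//; exact: bm_integrable.
Qed.

(** The mean value theorem gives [cos t >= 1 - |t|]. *)
Lemma cos_ge_half (t : R) : `|t| <= 2^-1 -> 2^-1 <= cos t.
Proof.
wlog t0 : t / 0 <= t.
  move=> H ht; have [t0|t0] := leP 0 t; first exact: H.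
  by rewrite -cosN; apply: H; rewrite ?oppr_ge0 ?(ltW t0)// normrN.
rewrite ger0_norm// => ht.
have [|c _ h] := @MVT_segment R cos (fun t => - sin t) 0 t t0.
  by apply: continuous_subspaceT => x; exact: continuous_cos.
move: h; rewrite cos0 subr0 => h.
have : sin c * t <= t by rewrite ler_piMl// sin_le1.
by move: h ht; rewrite mulNr; lra.
Qed.

Lemma dotpBl (x y z : 'rV[R]_m) : dotp (x - y) z = dotp x z - dotp y z.
Proof. by rewrite /dotp -sumrB; apply: eq_bigr => i _; rewrite !mxE mulrBl. Qed.

Lemma dotpBr (x y z : 'rV[R]_m) : dotp x (y - z) = dotp x y - dotp x z.
Proof. by rewrite /dotp -sumrB; apply: eq_bigr => i _; rewrite !mxE mulrBr. Qed.

Variables (T : finType) (P : T -> 'rV[R]_m).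

(** The real part of the sum over [p], [q] of [e^(2 pi i z.(P p - P q)) mu^(P p - P q)]. Integrating
    it against [mu] gives the sum of [|mu^(P p - P q)|^2]. *)
Definition energy_density (z : 'rV[R]_m) : R := \sum_p \sum_q
  (cos (2 * pi * dotp z (P p - P q)) * fourier_re mu (P p - P q) -
   sin (2 * pi * dotp z (P p - P q)) * fourier_im mu (P p - P q)).

Let bcos z : bounded_meas (fun x => cos (2 * pi * dotp x z)).
Proof. by split; [exact: measurable_cos_dotp|exists 1 => x; rewrite ler_norml cos_geN1 cos_le1]. Qed.

Let bsin z : bounded_meas (fun x => sin (2 * pi * dotp x z)).
Proof. by split; [exact: measurable_sin_dotp|exists 1 => x; rewrite ler_norml sin_geN1 sin_le1]. Qed.

Let bterm p q : bounded_meas (fun z =>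
  cos (2 * pi * dotp z (P p - P q)) * fourier_re mu (P p - P q) +
  sin (2 * pi * dotp z (P p - P q)) * - fourier_im mu (P p - P q)).
Proof. exact: (bmD (bmM (bcos _) (bm_cst _)) (bmM (bsin _) (bm_cst _))). Qed.

Let edE : energy_density = fun z => \sum_p \sum_q
  (cos (2 * pi * dotp z (P p - P q)) * fourier_re mu (P p - P q) +
   sin (2 * pi * dotp z (P p - P q)) * - fourier_im mu (P p - P q)).
Proof.
apply/funext => z; rewrite /energy_density.
by apply: eq_bigr => p _; apply: eq_bigr => q _; rewrite -mulrN.
Qed.

Lemma energy_density_bm : bounded_meas energy_density.
Proof. by rewrite edE; apply: (bm_sum _ _).1 => p; exact: (bm_sum _ (bterm p)).1. Qed.

Lemma energy_density_integral :
  \int[mu]_z energy_density z = \sum_p \sum_q fourier_abs mu (P p - P q) ^+ 2.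
Proof.
rewrite edE (bm_sum _ (fun p => (bm_sum _ (bterm p)).1)).2.
apply: eq_bigr => p _; rewrite (bm_sum _ (bterm p)).2; apply: eq_bigr => q _.
rewrite RintegralD//; [|exact: bm_integrable (bmM (bcos _) (bm_cst _))|
  exact: bm_integrable (bmM (bsin _) (bm_cst _))].
rewrite (bm_RintegralZr _ (bcos _)) (bm_RintegralZr _ (bsin _)).
rewrite /fourier_abs sqr_sqrtr ?addr_ge0 ?sqr_ge0//.
rewrite -[X in X * _ + _]/(fourier_re mu (P p - P q)).
have -> : \int[mu]_x sin (2 * pi * dotp x (P p - P q)) = - fourier_im mu (P p - P q).
  by rewrite /fourier_im opprK.
by rewrite mulrNN !expr2.
Qed.

Let kernel (u : 'rV[R]_m) : R := \sum_p \sum_q cos (2 * pi * dotp u (P p - P q)).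

Let kernelE (u : 'rV[R]_m) : kernel u = (\sum_p cos (2 * pi * dotp u (P p))) ^+ 2 +
  (\sum_p sin (2 * pi * dotp u (P p))) ^+ 2.
Proof.
have E p q : cos (2 * pi * dotp u (P p - P q)) =
    cos (2 * pi * dotp u (P p)) * cos (2 * pi * dotp u (P q)) +
    sin (2 * pi * dotp u (P p)) * sin (2 * pi * dotp u (P q)) by rewrite dotpBr mulrBr cosB.
rewrite /kernel; under eq_bigr => p _ do under eq_bigr => q _ do rewrite E.
move: (fun p => cos (2 * pi * dotp u (P p))) (fun p => sin (2 * pi * dotp u (P p))) => c s.
rewrite !expr2 [in RHS]mulr_suml [X in _ = _ + X]mulr_suml -big_split /=; apply: eq_bigr => p _.
by rewrite !mulr_sumr -big_split.
Qed.

Let density_kernel z : bounded_meas (fun w => kernel (z - w)) /\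
  energy_density z = \int[mu]_w kernel (z - w).
Proof.
have E p q : (fun w => cos (2 * pi * dotp (z - w) (P p - P q))) =
   (fun w => cos (2 * pi * dotp w (P p - P q)) * cos (2 * pi * dotp z (P p - P q)) +
     sin (2 * pi * dotp w (P p - P q)) * sin (2 * pi * dotp z (P p - P q))).
  apply/funext => w; rewrite dotpBl mulrBr cosB.
  by rewrite [in RHS]mulrC [X in _ + X = _]mulrC.
have bE p q : bounded_meas (fun w => cos (2 * pi * dotp (z - w) (P p - P q))).
  rewrite E; exact: (bmD (bmM (bcos _) (bm_cst _)) (bmM (bsin _) (bm_cst _))).
split; first by apply: (bm_sum _ _).1 => p; exact: (bm_sum _ (bE p)).1.
rewrite (bm_sum _ (fun p => (bm_sum _ (bE p)).1)).2; apply: eq_bigr => p _.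
rewrite (bm_sum _ (bE p)).2; apply: eq_bigr => q _; rewrite E.
rewrite RintegralD//; [|exact: bm_integrable (bmM (bcos _) (bm_cst _))|
  exact: bm_integrable (bmM (bsin _) (bm_cst _))].
rewrite (bm_RintegralZr _ (bcos _)) (bm_RintegralZr _ (bsin _)).
by rewrite -[X in _ = X * _ + _]/(fourier_re mu (P p - P q)) /fourier_im mulrN opprK mulrC
  [X in _ + X]mulrC.
Qed.

(* The density is the convolution of [mu] with the squared modulus of the Dirichlet kernel of
   [P], which is nonnegative, and at least [#|T| ^ 2 / 4] near the origin. *)
Lemma energy_density_ge (z : 'rV[R]_m) (A : set (BorelR R m)) : measurable A ->
  (forall (w : 'rV[R]_m) p, A w -> `|2 * pi * dotp (z - w) (P p)| <= 2^-1) ->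
  (#|T|%:R / 2) ^+ 2 * fine (mu A) <= energy_density z.
Proof.
move=> mA hA; have [bk ->] := density_kernel z.
have iT := bm_integrable bk.
have muA : (mu A < +oo)%E by apply: le_lt_trans mu_fin; apply: le_measure; rewrite ?inE.
have iA : mu.-integrable A (EFin \o fun w => kernel (z - w)) by apply: integrableS iT.
apply: le_trans (_ : \int[mu]_(w in A) kernel (z - w) <= _); last first.
  rewrite Rintegral_mkcond; apply: le_Rintegral => //.
    by rewrite -restrict_EFin; exact/(integrable_mkcond _ mA).
  move=> w _; rewrite /patch; case: ifP => // _.
  by rewrite kernelE addr_ge0 ?sqr_ge0.
have -> : (#|T|%:R / 2) ^+ 2 * fine (mu A) = \int[mu]_(w in A) ((#|T|%:R / 2) ^+ 2).
  by rewrite Rintegral_cst.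
apply: le_Rintegral => //.
  apply: measurable_bounded_integrable => //.
  by exists `|(#|T|%:R / 2) ^+ 2|; split => [|M' MM' x _]; [exact: num_real|exact: ltW].
move=> w Aw; rewrite kernelE; apply: le_trans (_ : (\sum_p cos (2 * pi * dotp (z - w) (P p))) ^+ 2 <= _).
  have h : #|T|%:R / 2 <= \sum_p cos (2 * pi * dotp (z - w) (P p)).
    have -> : #|T|%:R / 2 = \sum_(p : T) (2^-1 : R) by rewrite sumr_const mulr_natl.
    by apply: ler_sum => p _; apply: cos_ge_half; exact: hA.
  by rewrite lerXn2r ?nnegrE// (le_trans _ h)// divr_ge0.
by rewrite lerDl sqr_ge0.
Qed.

Lemma energy_density_ge0 z : 0 <= energy_density z.
Proof. by have := @energy_density_ge z set0 measurable0 (fun _ _ => False_ind _); rewrite measure0 mulr0. Qed.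

Lemma energy_markov (t : R) : 0 < t ->
  t * fine (mu [set z | t <= energy_density z]) <=
  \sum_p \sum_q fourier_abs mu (P p - P q) ^+ 2.
Proof.
move=> t0; have [mE [M bE]] := energy_density_bm; rewrite -energy_density_integral.
set A : set (BorelR R m) := [set z | _].
have mA : measurable A.
  rewrite (_ : A = setT `&` energy_density @^-1` `[t, +oo[).
    exact: mE.
  by rewrite setTI; apply/seteqP; split => z /=; rewrite in_itv /= andbT.
have iT := bm_integrable energy_density_bm.
have muA : (mu A < +oo)%E by apply: le_lt_trans mu_fin; apply: le_measure; rewrite ?inE.
have -> : t * fine (mu A) = \int[mu]_(w in A) t by rewrite Rintegral_cst.
apply: le_trans (_ : \int[mu]_(w in A) energy_density w <= _).
  apply: le_Rintegral => //; last exact: integrableS iT.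
  apply: measurable_bounded_integrable => //.
  by exists `|t|; split => [|M' MM' x _]; [exact: num_real|exact: ltW].
rewrite Rintegral_mkcond; apply: le_Rintegral => //.
  by rewrite -restrict_EFin; apply/(integrable_mkcond _ mA); exact: integrableS iT.
by move=> w _; rewrite /patch; case: ifP => // _; exact: energy_density_ge0.
Qed.

End energy.

Lemma coord_le_enorm (R : realType) (m : nat) (x : 'rV[R]_m) k : `|x 0 k| <= enorm x.
Proof.
rewrite /enorm -sqrtr_sqr ler_wsqrtr// (bigD1 k)//= lerDl sumr_ge0// => j _.
exact: sqr_ge0.
Qed.

Section grid_energy.
Variables (R : realType) (d : nat).
Variable mu : {measure set (BorelR R (d + 1)) -> \bar R}.

Definition grid_freq (N : nat) (p : {ffun 'I_d -> 'I_N}) : 'rV[R]_(d + 1) :=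
  row_mx (\row_k (p k : nat)%:R) 0.

Lemma grid_freqB_norm N (p q : {ffun 'I_d -> 'I_N}) i :
  (ndist (p i) (q i))%:R <= enorm (grid_freq p - grid_freq q).
Proof.
apply: le_trans (coord_le_enorm _ (lshift 1 i)).
rewrite [(grid_freq p - grid_freq q) 0 _]mxE [(- grid_freq q) 0 _]mxE /grid_freq !row_mxEl !mxE.
by rewrite normr_ndist.
Qed.

Lemma sqr_fourier_decay (s s' C D : R) xi : 0 <= s' <= s -> 1 <= D -> D <= enorm xi ->
  enorm xi `^ (s / 2) * fourier_abs mu xi <= C -> fourier_abs mu xi ^+ 2 <= C ^+ 2 * D `^ (- s').
Proof.
move=> /andP[s0 ss] D1 De h.
have D0 : 0 < D by exact: lt_le_trans D1.
have f0 : 0 <= fourier_abs mu xi by exact: sqrtr_ge0.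
have h2 : enorm xi `^ s * fourier_abs mu xi ^+ 2 <= C ^+ 2.
  rewrite -sqr_powR_half -exprMn lerXn2r// nnegrE ?mulr_ge0 ?powR_ge0//.
  by apply: le_trans h; rewrite mulr_ge0 ?powR_ge0.
rewrite powRN ler_pdivlMr ?powR_gt0// mulrC; apply: le_trans h2; rewrite ler_wpM2r ?sqr_ge0//.
apply: (le_trans (ler_powR D1 ss)); apply: ge0_ler_powR => //; rewrite ?nnegrE ?(ltW D0)//.
- exact: le_trans ss.
- exact: le_trans (ltW D0) De.
Qed.

(** A pair of frequencies at largest coordinate distance [D] contributes [O(D^-s')], which product
    weights with [a = s' / d] dominate; [s' < d] gives [a < 1]. The diagonal, where decay says
    nothing, is absorbed through [mu^(0)] in [C0]. *)
Lemma grid_energy_le (s s' C : R) : (0 < d)%N -> 0 <= s' <= s -> s' < d%:R ->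
  (forall xi, enorm xi `^ (s / 2) * fourier_abs mu xi <= C) ->
  exists2 C3 : R, 0 <= C3 & forall N, (0 < N)%N ->
    \sum_(p : {ffun 'I_d -> 'I_N}) \sum_(q : {ffun 'I_d -> 'I_N})
       fourier_abs mu (grid_freq p - grid_freq q) ^+ 2 <= C3 * N%:R `^ (2 * d%:R - s').
Proof.
move=> d0 hs sd hC; have /andP[s0 ss] := hs.
have dR : 0 < d%:R :> R by rewrite ltr0n.
pose a := s' / d%:R.
have a0 : 0 <= a by rewrite divr_ge0// ltW.
have a1 : a < 1 by rewrite /a ltr_pdivrMr// mul1r.
have adE : a * d%:R = s' by rewrite /a divfK// gt_eqF.
pose C0 := fourier_abs mu 0 ^+ 2 + C ^+ 2.
have C00 : 0 <= C0 by rewrite addr_ge0 ?sqr_ge0.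
clearbody a.
have term N (p q : {ffun 'I_d -> 'I_N}) :
    fourier_abs mu (grid_freq p - grid_freq q) ^+ 2 <= C0 * \prod_i wt a (p i) (q i).
  have [->|npq] := eqVneq p q.
    rewrite subrr big1 => [|i _]; first by rewrite mulr1 lerDl sqr_ge0.
    by rewrite /wt subnn powR1.
  have [i Di hD] := prod_wt_ge a0 npq.
  apply: le_trans (sqr_fourier_decay hs _ (grid_freqB_norm p q i) (hC _)) _; first by rewrite ler1n.
  apply: ler_pM; rewrite ?sqr_ge0 ?powR_ge0//; first by rewrite /C0 lerDr sqr_ge0.
  apply: le_trans hD; rewrite -powR_mulrn ?powR_ge0// -powRrM.
  by rewrite mulNr adE.
pose C3 := C0 * (2 * (1 + (1 - a)^-1)) ^+ d.
have c2 : 0 <= 2 * (1 + (1 - a)^-1) by rewrite mulr_ge0// addr_ge0// invr_ge0 subr_ge0 ltW.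
exists C3; first by rewrite mulr_ge0// exprn_ge0.
move=> N N0.
apply: le_trans (_ : \sum_(p : {ffun 'I_d -> 'I_N}) \sum_(q : {ffun 'I_d -> 'I_N})
    C0 * \prod_i wt a (p i) (q i) <= _).
  by apply: ler_sum => p _; apply: ler_sum => q _; exact: term.
under eq_bigr do rewrite -mulr_sumr.
rewrite -mulr_sumr -mulrA ler_wpM2l//.
apply: le_trans (@sum_wt_ffun R a d N _) _; first by rewrite a0 a1.
rewrite ler_wpM2l ?exprn_ge0// -powR_mulrn ?powR_ge0// -powRrM.
by rewrite mulrBl adE.
Qed.

End grid_energy.

(** * Upper bound: thin boxes around the hypersurface *)

Section thin_cover.
Variables (R : realType) (n : nat) (S : set 'rV[R]_n.+1).
Variable mu : {measure set (BorelR R (n.+1 + 1)) -> \bar R}.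
Hypothesis muS : supported_on mu (cylinder S).

(** Interior and boundary charts are treated alike: for a covering, it is enough that [S] is locally
    contained in a graph. *)
Lemma local_graph (p : 'rV[R]_n.+1) : smooth_hypersurface S -> S p ->
  exists (i : 'I_n.+1) (U : set 'rV[R]_n.+1) (V : set 'rV[R]_n) (g : 'rV[R]_n -> R),
  [/\ open U, U p, open V, smooth_on V g &
    forall x, S x -> U x -> V (drop_coord i x) /\ x 0 i = g (drop_coord i x)].
Proof.
move=> hS Sp; have [] := hS p Sp.
  move=> [i [U [V [g [oU Up oV sg E]]]]]; exists i, U, V, g; split => // x Sx Ux.
  by have : (S `&` U) x by []; rewrite E => -[].
move=> [i [U [V [g [h [[oU Up oV sg sh] [_ [_ E]]]]]]]]; exists i, U, V, g; split => // x Sx Ux.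
by have : (S `&` U) x by []; rewrite E => -[].
Qed.

Variables (p : 'rV[R]_(n.+1 + 1)) (i : 'I_n.+1) (U : set 'rV[R]_n.+1).
Variables (V : set 'rV[R]_n) (g : 'rV[R]_n -> R).
Hypotheses (oU : open U) (Up : U (lsubmx p)) (oV : open V) (sg : smooth_on V g).
Hypothesis SU : forall x, S x -> U x -> V (drop_coord i x) /\ x 0 i = g (drop_coord i x).
Hypothesis Sp : S (lsubmx p).

Let base (z : 'rV[R]_(n.+1 + 1)) : 'rV[R]_n := drop_coord i (lsubmx z).

Let base_lipschitz (c : 'rV[R]_n) (z w : 'rV[R]_(n.+1 + 1)) :
  `| `|base z - c| - `|base w - c| | <= `|z - w|.
Proof.
apply: le_trans (ler_dist_dist _ _) _.
rewrite opprB addrA subrK /base -drop_coordB -linearB /=.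
exact: le_trans (drop_norm _ _) (lsubmx_norm _).
Qed.

Let height_lipschitz (c : R) (z w : 'rV[R]_(n.+1 + 1)) :
  `| `|lsubmx z 0 i - c| - `|lsubmx w 0 i - c| | <= `|z - w|.
Proof.
apply: le_trans (ler_dist_dist _ _) _; rewrite opprB addrA subrK.
have := rV_norm_coord (z - w) (lshift 1 i).
by rewrite [(z - w) 0 _]mxE [(- w) 0 _]mxE [lsubmx z 0 i]mxE [lsubmx w 0 i]mxE.
Qed.

(** Rounding down to a mesh of [N] cells; the endpoint [t = rho] has index [N], hence the type
    ['I_N.+1]. *)
Lemma grid_floor (N : nat) (rho t : R) : (0 < N)%N -> 0 < rho -> `|t| <= rho ->
  exists b : 'I_N.+1, `|t - (b%:R * (2 * rho / N%:R) - rho)| <= 2 * rho / N%:R.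
Proof.
move=> N0 rho0 ht; have NR : 0 < N%:R :> R by rewrite ltr0n.
have l0 : 0 < 2 * rho / N%:R by rewrite divr_gt0// mulr_gt0.
set l := 2 * rho / N%:R in l0 *.
have lE : l * N%:R = 2 * rho by rewrite /l divfK// gt_eqF.
clearbody l.
move: ht; rewrite ler_norml => /andP[t1 t2].
have x0 : 0 <= (t + rho) / l by rewrite divr_ge0 ?(ltW l0)//; move: t1; lra.
have xN : (t + rho) / l <= N%:R by rewrite ler_pdivrMr// mulrC lE; move: t2; lra.
have bN : (Num.truncn ((t + rho) / l) < N.+1)%N.
  by rewrite ltnS -(ler_nat R) (le_trans _ xN)// truncn_le.
exists (Ordinal bN) => /=.
have h1 : (Num.truncn ((t + rho) / l))%:R * l <= t + rho.
  by rewrite -ler_pdivlMr// truncn_le.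
have h2 : t + rho <= (Num.truncn ((t + rho) / l))%:R * l + l.
  have -> : (Num.truncn ((t + rho) / l))%:R * l + l = (Num.truncn ((t + rho) / l)).+1%:R * l.
    by move: (Num.truncn _) => q; rewrite -natr1 mulrDl mul1r.
  rewrite -ler_pdivrMr//; apply/ltW; exact: truncnS_gt.
rewrite ler_norml; move: h1 h2 l0; lra.
Qed.

(* The null set [K] collects the parts of the boxes lying off the graph: they are compact and
   miss the support of [mu]. *)
Lemma thin_cover (delta : R) : 0 < delta ->
  exists (rho : R) (Q : nat), 0 < rho /\ forall N, (0 < N)%N ->
  exists (A : {ffun 'I_n -> 'I_(N * Q).+1} -> set (BorelR R (n.+1 + 1)))
         (K : set (BorelR R (n.+1 + 1))),
  [/\ forall b, measurable (A b), measurable K, mu K = 0%E,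
      forall z : 'rV[R]_(n.+1 + 1), `|z - p| <= rho -> K z \/ exists b, A b z &
      forall b (z w : 'rV[R]_(n.+1 + 1)), A b z -> A b w ->
        forall k, `|lsubmx z 0 k - lsubmx w 0 k| <= delta / N%:R].
Proof.
move=> delta0.
have [Vp _] := SU Sp Up.
have [rV rV0 hrV] := smooth_ball oV Vp.
have [rU rU0 hrU] := (openP_norm _).1 oU _ Up.
pose rho := Num.min rV (rU / 2).
have rho0 : 0 < rho by rewrite lt_min rV0 divr_gt0.
have rhoV : rho <= rV by rewrite ge_min lexx.
have rhoU : rho < rU by rewrite gt_min; apply/orP; right; move: rU0; lra.
clearbody rho.
have inV y : `|y - drop_coord i (lsubmx p)| <= rho -> V y.
  by move=> h; apply: hrV; exact: le_trans rhoV.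
have [L L0 hL] := smooth_bounded sg (fun l : 'I_n => [:: l]) inV.
have glip := @lipschitz_ball R n g (drop_coord i (lsubmx p)) rho L L0
  (fun x xr j => conj ((sg [::] (inV x xr)).1 j) (hL j x xr)).
(* One more than the Lipschitz constant of [g]: graph points over a cell then lie strictly closer
   than [Lam l] to the height at its node, so they miss the closed sets [H b]. *)
have [Lam LamE] : exists Lam, Lam = n%:R * L + 1 by eexists.
have Lam1 : 1 <= Lam by rewrite LamE lerDr mulr_ge0.
(* With [N Q] cells per side the mesh is [l = 2 rho / (N Q)], and this [Q] makes the box extent
   [2 Lam l] at most [delta / N]. *)
pose Q := (Num.truncn (4 * Lam * rho / delta)).+1.
have Q0 : 0 < Q%:R :> R by rewrite ltr0n.
have QE : 4 * Lam * rho <= delta * Q%:R.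
  by rewrite -ler_pdivrMl// mulrC; apply/ltW; exact: truncnS_gt.
exists rho, Q; split => // N N0.
have NR : 0 < N%:R :> R by rewrite ltr0n.
have NQ0 : (0 < N * Q)%N by rewrite muln_gt0 N0.
have NQR : 0 < (N * Q)%:R :> R by rewrite ltr0n.
have l0 : 0 < 2 * rho / (N * Q)%:R by rewrite divr_gt0// mulr_gt0.
have l2 : 2 * Lam * (2 * rho / (N * Q)%:R) <= delta / N%:R.
  rewrite natrM.
  have -> : 2 * Lam * (2 * rho / (N%:R * Q%:R)) = (4 * Lam * rho) / Q%:R / N%:R.
    by field; rewrite !gt_eqF.
  by rewrite ler_wpM2r ?invr_ge0 ?(ltW NR)// ler_pdivrMr.
have lE : (N * Q)%:R * (2 * rho / (N * Q)%:R) = 2 * rho by rewrite mulrC divfK// gt_eqF.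
have floor := @grid_floor (N * Q) rho _ NQ0 rho0.
move: l0 l2 lE floor; move: (2 * rho / (N * Q)%:R) => l l0 l2 lE floor.
pose yb (b : {ffun 'I_n -> 'I_(N * Q).+1}) : 'rV[R]_n :=
  drop_coord i (lsubmx p) + \row_k ((b k : nat)%:R * l - rho).
have ybr b : `|yb b - drop_coord i (lsubmx p)| <= rho.
  rewrite /yb addrC addKr; apply/rV_norm_le; first exact: ltW.
  move=> k; rewrite mxE ler_norml.
  have h1 : 0 <= (b k : nat)%:R * l by rewrite mulr_ge0// ltW.
  have h2 : (b k : nat)%:R * l <= 2 * rho.
    by rewrite -lE ler_wpM2r ?(ltW l0)// ler_nat -ltnS.
  by move: h1 h2; lra.
pose Z : set 'rV[R]_(n.+1 + 1) := [set z | `|z - p| <= rho].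
pose D b : set 'rV[R]_(n.+1 + 1) := [set z | `|base z - yb b| <= l].
pose G b : set 'rV[R]_(n.+1 + 1) := [set z | `|lsubmx z 0 i - g (yb b)| <= Lam * l].
(* The points at height distance at least [Lam l], with both sides negated so that
   [closed_lipschitz_le] applies. *)
pose H b : set 'rV[R]_(n.+1 + 1) := [set z | - `|lsubmx z 0 i - g (yb b)| <= - (Lam * l)].
have cZ : compact Z by exact: compact_ball_norm.
have clZ : closed Z by exact: closed_ball_norm.
have clD b : closed (D b) by apply: (@closed_lipschitz_le R _ (fun z => `|base z - yb b|)).
have clG b : closed (G b).
  by apply: (@closed_lipschitz_le R _ (fun z => `|lsubmx z 0 i - g (yb b)|)).
have clH b : closed (H b).
  apply: (@closed_lipschitz_le R _ (fun z => - `|lsubmx z 0 i - g (yb b)|)) => x y.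
  by rewrite -opprD normrN.
pose A b : set (BorelR R (n.+1 + 1)) := Z `&` (D b `&` G b).
pose B b : set (BorelR R (n.+1 + 1)) := Z `&` (D b `&` H b).
have mB b : measurable (B b) by apply: closed_measurableB; do 2 apply: closedI => //.
have nB b : mu (B b) = 0%E.
  apply: compact_null => //.
    apply: (@subclosed_compact _ _ Z) => //; last by move=> z [].
    by do 2 apply: closedI => //.
  move=> z [Zz [Dz Hz]]; apply: contrapT => nz.
  have : cylinder S z.
    apply: muS => W oW Wz; apply: contrapT => nW; apply: nz.
    by exists W.
  move=> Sz; have Uz : U (lsubmx z).
    apply: hrU; apply: le_lt_trans rhoU; apply: le_trans Zz.
    by rewrite -linearB; exact: lsubmx_norm.
  have [Vz zE] := SU Sz Uz.
  have bz : `|base z - drop_coord i (lsubmx p)| <= rho.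
    rewrite /base -drop_coordB -linearB /=.
    exact: le_trans (drop_norm _ _) (le_trans (lsubmx_norm _) Zz).
  have h := glip _ _ (ybr b) bz.
  move: Hz; rewrite /H /= lerN2 zE -/(base z) leNgt => /negP; apply.
  apply: (le_lt_trans h); apply: (@le_lt_trans _ _ (n%:R * L * l)).
    by rewrite ler_wpM2l// mulr_ge0.
  by rewrite ltr_pM2r// LamE ltrDl.
have [mK nK] := @null_bigsetU R _ mu _ B (index_enum _) (fun b => conj (mB b) (nB b)).
exists A, (\big[setU/set0]_b B b); split => //.
- by move=> b; apply: closed_measurableB; do 2 apply: closedI => //.
- move=> z Zz.
  have bz : `|base z - drop_coord i (lsubmx p)| <= rho.
    rewrite /base -drop_coordB -linearB /=.
    exact: le_trans (drop_norm _ _) (le_trans (lsubmx_norm _) Zz).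
  have fl k : exists c : 'I_(N * Q).+1,
      `|(base z - drop_coord i (lsubmx p)) 0 k - (c%:R * l - rho)| <= l.
    by apply: floor; apply: le_trans bz; exact: rV_norm_coord.
  have [f hf] := choice fl.
  have Dz : D [ffun k => f k] z.
    apply/rV_norm_le; first exact: ltW.
    move=> k; have -> : (base z - yb [ffun k => f k]) 0 k =
        (base z - drop_coord i (lsubmx p)) 0 k - ((f k : nat)%:R * l - rho).
      by rewrite /yb !mxE ffunE opprD addrA.
    exact: hf.
  have [h|h] := leP `|lsubmx z 0 i - g (yb [ffun k => f k])| (Lam * l).
    by right; exists [ffun k => f k].
  left; rewrite (bigD1 [ffun k => f k])//=; left; split => //; split => //.
  by rewrite /H /= lerN2 ltW.
- move=> b z w [_ [Dz Gz]] [_ [Dw Gw]] k; apply: le_trans l2.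
  case: (unliftP i k) => [j ->|->]; last first.
    have : `|lsubmx z 0 i - lsubmx w 0 i| <= `|lsubmx z 0 i - g (yb b)| + `|lsubmx w 0 i - g (yb b)|.
      by rewrite (distrC (lsubmx w 0 i)) -{1}(subrKA (g (yb b))) ler_normD.
    move=> h; apply: (le_trans h); rewrite -mulrA mulr_natl mulr2n; exact: lerD Gz Gw.
  have h1 := rV_norm_coord (base z - yb b) j; have h2 := rV_norm_coord (base w - yb b) j.
  have e1 : (base z - yb b) 0 j - (base w - yb b) 0 j = lsubmx z 0 (lift i j) - lsubmx w 0 (lift i j).
    by move: (yb b) => y; rewrite /base !mxE; ring.
  rewrite -e1; apply: le_trans (ler_normB _ _) _.
  apply: le_trans (lerD (le_trans h1 Dz) (le_trans h2 Dw)) _.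
  by rewrite -mulr2n -(mulr_natl l 2) ler_wpM2r ?(ltW l0)// ler_peMr.
Qed.

End thin_cover.

Section upper_bound.
Variables (R : realType) (n : nat).

Lemma fine_measureU (d : measure_display) (T : measurableType d) (mu : {measure set T -> \bar R}) (A B : set T) :
  (mu setT < +oo)%E -> measurable A -> measurable B ->
  fine (mu (A `|` B)) <= fine (mu A) + fine (mu B).
Proof.
move=> fin mA mB.
have ff C : measurable C -> mu C \is a fin_num.
  move=> mC; rewrite ge0_fin_numE//; apply: le_lt_trans fin; apply: le_measure; rewrite ?inE//.
rewrite -fineD ?ff// fine_le ?fin_numD ?ff//; first exact: measurableU.
exact: measureU2.
Qed.

Lemma fine_measure_bigsetU (d : measure_display) (T : measurableType d) (mu : {measure set T -> \bar R})
    (I : Type) (s : seq I) (A : I -> set T) (c : R) :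
  (mu setT < +oo)%E -> (forall i, measurable (A i)) -> (forall i, fine (mu (A i)) <= c) ->
  measurable (\big[setU/set0]_(i <- s) A i) /\
  fine (mu (\big[setU/set0]_(i <- s) A i)) <= (size s)%:R * c.
Proof.
move=> fin mA hA; elim: s => [|i s [IH1 IH2]].
  by rewrite big_nil measure0 mul0r; split.
rewrite big_cons; split; first exact: measurableU.
apply: le_trans (fine_measureU fin (mA i) IH1) _.
by rewrite /= -natr1 mulrDl mul1r addrC lerD.
Qed.

(** Frequency coordinates below [N] cancel the factor [1 / N]. The frequency has no axial component,
    so the axial length of a box is irrelevant. *)
Lemma grid_dotp (N : nat) (delta : R) (p : {ffun 'I_n.+1 -> 'I_N}) (z w : 'rV[R]_(n.+1 + 1)) :
  (forall k, `|lsubmx z 0 k - lsubmx w 0 k| <= delta / N%:R) ->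
  `|dotp (z - w) (grid_freq R p)| <= n.+1%:R * delta.
Proof.
move=> h; rewrite /dotp big_split_ord /=.
rewrite [X in _ + X]big1 ?addr0 => [|j _]; last first.
  by rewrite (_ : grid_freq R p 0 (rshift _ j) = 0) ?mulr0// /grid_freq row_mxEr mxE.
apply: le_trans (ler_norm_sum _ _ _) _.
apply: le_trans (_ : \sum_(k < n.+1) delta <= _); last by rewrite sumr_const card_ord mulr_natl.
apply: ler_sum => k _; rewrite /grid_freq row_mxEl [(\row_k _) 0 k]mxE normrM.
have := h k; rewrite [lsubmx z 0 k]mxE [lsubmx w 0 k]mxE => hk.
rewrite [(z - w) 0 _]mxE [(- w) 0 _]mxE.
have N0 : (0 < N)%N by apply: leq_ltn_trans (ltn_ord (p k)).
have NR : 0 < N%:R :> R by rewrite ltr0n.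
rewrite ler_pdivlMr// in hk; apply: le_trans hk; rewrite ler_wpM2l// ger0_norm// ler_nat.
exact: ltnW.
Qed.

(** Near a point of the support, the mass splits into the part where the energy density is large,
    small by Markov's inequality, and boxes meeting the region of small density, each light by
    [energy_density_ge]. Both shares tend to 0 as [N] grows. *)
Lemma fourier_exponent_le (S : set 'rV[R]_n.+1) (s : R) : smooth_hypersurface S ->
  fourier_exponents (cylinder S) s -> s <= n%:R.
Proof.
move=> hS [/andP[s0 _] [mu [[fin mu0 muS] [C hC]]]]; rewrite leNgt; apply/negP => ns.
have [p hp] := support_nonempty mu0.
have Sp : S (lsubmx p) by exact: muS.
have [i [U [V [g [oU Up oV sg SU]]]]] := local_graph hS Sp.
(* The exponent is lowered below [d = n + 1], as [grid_energy_le] requires; [1/2] could be any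
   number strictly between 0 and 1. *)
pose s' := Num.min s (n%:R + 2^-1).
have s's : s' <= s by rewrite ge_min lexx.
have ns' : n%:R < s' by rewrite lt_min ns /= ltrDl invr_gt0 ltr0n.
have s'd : s' < n.+1%:R by rewrite gt_min; apply/orP; right; rewrite -(natr1 n) ltrD2l invf_lt1// ltr1n.
have s'0 : 0 <= s' by apply: le_trans (ltW ns').
clearbody s'.
have [C3 C30 hC3] := @grid_energy_le R n.+1 mu s s' C isT ltac:(by rewrite s'0) s'd hC.
have dpi0 : 0 < 4 * pi * n.+1%:R :> R by rewrite !mulr_gt0// pi_gt0.
(* Chosen so that phases vary by at most [2 pi (n + 1) delta = 1/2] over a box, the tolerance of
   [energy_density_ge]. *)
pose delta : R := (4 * pi * n.+1%:R)^-1.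
have delta0 : 0 < delta by rewrite invr_gt0.
have deltaE : 2 * pi * (n.+1%:R * delta) = 2^-1.
  have pi0 : pi != 0 :> R by rewrite gt_eqF// pi_gt0.
  have d0 : n.+1%:R != 0 :> R by rewrite pnatr_eq0.
  rewrite /delta; move: pi0 d0; move: (pi : R) (n.+1%:R : R) => P m P0 m0.
  by field; rewrite ?P0 ?m0.
have [rho [Q [rho0 cov]]] := thin_cover muS oU Up oV sg SU Sp delta0.
pose Z : set (BorelR R (n.+1 + 1)) := [set z : 'rV[R]_(n.+1 + 1) | `|z - p| <= rho].
have mZ : measurable Z by apply: closed_measurableB; exact: closed_ball_norm.
have ff A : measurable A -> mu A \is a fin_num.
  by move=> mA; rewrite ge0_fin_numE//; apply: le_lt_trans fin; apply: le_measure; rewrite ?inE.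
have Zpos : 0 < fine (mu Z).
  rewrite fine_gt0//; apply/andP; split; last by move: (ff _ mZ); rewrite ge0_fin_numE.
  have oB := @open_ball_norm R _ p rho.
  have : (0 < mu [set z : 'rV[R]_(n.+1 + 1) | `|z - p| < rho]%R)%E.
    by apply: hp => //=; rewrite subrr normr0.
  move=> h; apply: (lt_le_trans h); apply: le_measure; rewrite ?inE//.
    exact: open_measurableB.
  by move=> z /= /ltW.
pose kap := (s' - n%:R) / 2.
have kap0 : 0 < kap by rewrite divr_gt0// subr_gt0.
have s'E : s' = n%:R + 2 * kap by rewrite /kap; field.
clearbody kap delta.
pose K' := C3 + 4 * Q.+1%:R ^+ n.
have K'0 : 0 <= K' by rewrite addr_ge0// mulr_ge0// exprn_ge0.
have main N : (0 < N)%N -> N%:R `^ kap * fine (mu Z) <= K'.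
  move=> N0; have NR : 0 < N%:R :> R by rewrite ltr0n.
  have [A [K [mA mK nK ZA dA]]] := cov N N0.
  (* With [s' = n + 2 kap] this level balances the two losses: the set above it has mass
     [O(N^(2d - s') / t) = O(N^-kap)], and the [O(N^n)] boxes have mass [O(t / N^(2d))] each off
     that set, again [O(N^-kap)] in all. *)
  pose t : R := N%:R `^ (2 * n.+1%:R - (n%:R + kap)).
  have t0 : 0 < t by exact: powR_gt0.
  pose P := @grid_freq R n.+1 N.
  have mark := energy_markov fin P t0.
  have [mF _] := energy_density_bm fin P.
  set F := energy_density mu P in mark mF.
  have mE : measurable ([set z | t <= F z] : set (BorelR R (n.+1 + 1))).
    rewrite (_ : [set z | _] = setT `&` F @^-1` `[t, +oo[); first exact: mF.
    by rewrite setTI; apply/seteqP; split => z /=; rewrite in_itv /= andbT.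
  set E : set (BorelR R (n.+1 + 1)) := [set z | t <= F z] in mE mark.
  pose c : R := 4 * t / (N%:R ^+ n.+1) ^+ 2.
  have mAE b : measurable (A b `\` E) by exact: measurableD.
  have c0 : 0 <= c by rewrite divr_ge0 ?mulr_ge0 ?(ltW t0)// !exprn_ge0.
  (* If anything of the box remains off [E], the density at one such point [z] is below [t] and
     bounds the mass of the whole remainder. *)
  have hA b : fine (mu (A b `\` E)) <= c.
    have [e|/set0P[z [Az nEz]]] := eqVneq (A b `\` E) set0; first by rewrite e measure0.
    have hz : (#|{: {ffun 'I_n.+1 -> 'I_N}}|%:R / 2) ^+ 2 * fine (mu (A b `\` E)) <= F z.
      apply: energy_density_ge => // w q [Aw _].
      have := grid_dotp q (dA b z w Az Aw) => hd.
      rewrite normrM gtr0_norm ?mulr_gt0 ?pi_gt0//.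
      by rewrite -deltaE ler_wpM2l// mulr_ge0// pi_ge0.
    have Fz : F z < t by rewrite ltNge; apply/negP.
    move: hz; rewrite card_ffun !card_ord natrX => hz.
    have := le_trans hz (ltW Fz); rewrite expr_div_n -mulrA => hz2.
    rewrite /c ler_pdivlMr ?exprn_gt0// -ler_pdivrMl//.
    by apply: le_trans hz2; rewrite le_eqVlt; apply/orP; left; apply/eqP; field.
  have [mU hU] := @fine_measure_bigsetU _ _ mu _ (index_enum _) _ c fin mAE hA.
  have : fine (mu Z) <= fine (mu K) + (fine (mu E) +
      fine (mu (\big[setU/set0]_b (A b `\` E)))).
    apply: le_trans (_ : fine (mu (K `|` (E `|` \big[setU/set0]_b (A b `\` E)))) <= _).
      apply: fine_le; rewrite ?ff//; first by do 2 apply: measurableU => //.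
      apply: le_measure; rewrite ?inE//; first by do 2 apply: measurableU => //.
      move=> z /ZA [Kz|[b Az]]; first by left.
      right; have [Ez|nEz] := pselect (E z); first by left.
      by right; rewrite (bigD1 b)//=; left.
    apply: le_trans (fine_measureU fin mK _) _; first exact: measurableU.
    by rewrite lerD2l; exact: fine_measureU.
  rewrite nK /= add0r => hZ.
  have h1 : fine (mu E) <= C3 * N%:R `^ (2 * n.+1%:R - s') / t.
    by rewrite ler_pdivlMr// mulrC (le_trans mark)// hC3.
  have h2 : fine (mu (\big[setU/set0]_b (A b `\` E))) <= ((N * Q).+1 ^ n)%:R * c.
    apply: le_trans hU _.
    have -> : size (index_enum {ffun 'I_n -> 'I_(N * Q).+1}) = ((N * Q).+1 ^ n)%N.
      by rewrite [index_enum _]unlock -enumT -cardT card_ffun !card_ord.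
    exact: lexx.
  have h3 : ((N * Q).+1 ^ n)%:R * c <= (N%:R * Q.+1%:R) ^+ n * c.
    by rewrite ler_wpM2r// natrX lerXn2r ?nnegrE// -natrM ler_nat mulnS -add1n leq_add2r.
  have ex1 : N%:R `^ kap * (C3 * N%:R `^ (2 * n.+1%:R - s') / t) = C3.
    rewrite /t -powRN mulrC -!mulrA -!powRD ?(gt_eqF NR) ?implybT//.
    rewrite [X in _ `^ X](_ : _ = 0) ?powRr0 ?mulr1// s'E; ring.
  have ex2 : N%:R `^ kap * ((N%:R * Q.+1%:R) ^+ n * c) = 4 * Q.+1%:R ^+ n.
    have tE : N%:R `^ kap * t * N%:R ^+ n = (N%:R ^+ n.+1) ^+ 2.
      rewrite /t -powRD ?(gt_eqF NR) ?implybT// -powR_mulrn ?(ltW NR)// -powRD ?(gt_eqF NR) ?implybT//.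
      rewrite -exprM -[RHS]powR_mulrn ?(ltW NR)//; congr (_ `^ _); rewrite natrM; ring.
    have N2 : (N%:R ^+ n.+1) ^+ 2 != 0 :> R by rewrite !expf_neq0// gt_eqF.
    rewrite /c exprMn; apply: (mulIf N2); rewrite -[in RHS]tE.
    move: N2; move: ((N%:R ^+ n.+1) ^+ 2) => X X0; field; exact: X0.
  have := ler_wpM2l (powR_ge0 N%:R kap) (le_trans hZ (lerD h1 (le_trans h2 h3))).
  by rewrite mulrDr ex1 ex2.
(* For [N >= x] the factor [N^kap] exceeds [K' / mu(Z)], which contradicts [main]. *)
pose x := (K' / fine (mu Z) + 1) `^ kap^-1.
have b0 : 0 <= K' / fine (mu Z) + 1 by rewrite addr_ge0// divr_ge0// ltW.
have := main (Num.truncn x).+1 isT; rewrite leNgt => /negP; apply.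
rewrite -ltr_pdivrMr//; apply: lt_le_trans (_ : K' / fine (mu Z) + 1 <= _); first by rewrite ltrDl.
apply: le_trans (_ : x `^ kap <= _).
  by rewrite /x -powRrM mulVf ?gt_eqF// powRr1.
apply: ge0_ler_powR; rewrite ?nnegrE ?powR_ge0 ?(ltW kap0)//.
by apply/ltW; exact: truncnS_gt.
Qed.

End upper_bound.

(** * The Fourier dimension of the cylinder *)

Section curved_graph.
Variable R : realType.

Lemma derivative_sign m (h : 'rV[R]_m -> R) (y v : 'rV[R]_m) (e : R) :
  derivable h y v -> 'D_v h y != 0 -> h y = 0 -> 0 < e ->
  exists2 t : R, `|t| < e & 0 < h (y + t *: v).
Proof.
move=> dh c0 hy e0.
have {c0 dh}[c [c0 cv]] : exists c : R, c != 0 /\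
    (fun t : R => t^-1 *: (h (t *: v + y) - h y)) @ 0^' --> c by exists ('D_v h y).
have cp : 0 < `|c| by rewrite normr_gt0.
have [r /= r0 hr] := (cvgrPdist_lt _ _).1 cv _ cp.
(* [t] has the sign of the derivative [c]. The quotient [h (y + t v) / t] is within [|c|] of [c], so
   it has that sign too, and [h] is positive there. *)
pose t := Num.sg c * (Num.min e r / 2).
have m0 : 0 < Num.min e r by rewrite lt_min e0 r0.
have st : `|t| = Num.min e r / 2.
  by rewrite normrM normr_sg c0 mul1r gtr0_norm// divr_gt0.
have tl : `|t| < Num.min e r by rewrite st ltr_pdivrMr// ltr_pMr// ltr1n.
move: tl; rewrite lt_min => /andP[te tr].
have t0 : t != 0 by rewrite -normr_gt0 st divr_gt0.
exists t => //.
have := hr t; rewrite /= sub0r normrN => /(_ tr t0).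
rewrite hy subr0 [t *: v + y]addrC => hq.
have : 0 < c * (t^-1 * h (y + t *: v)).
  move: hq; rewrite -[_ *: _]/(t^-1 * h (y + t *: v)); move: (t^-1 * _) => q.
  have [cp'|cn'|c0'] := ltgtP 0 c.
  - rewrite (gtr0_norm cp') ltr_norml => /andP[h1 h2]; rewrite mulr_gt0//; move: h2; lra.
  - rewrite (ltr0_norm cn') ltr_norml => /andP[h1 h2]; rewrite nmulr_rgt0//; move: h1; lra.
  - by rewrite -c0' eqxx in c0.
have -> : c = Num.sg c * `|c| by rewrite -numEsg.
have -> : t^-1 = Num.sg c * (Num.min e r / 2)^-1.
  by rewrite invfM /t invr_sg.
rewrite mulrACA -!mulrA [Num.sg c * _]mulrCA.
have sgsg : Num.sg c * Num.sg c = 1 by rewrite -expr2 sqr_sg c0.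
move=> h1.
have : 0 < `|c| * (Num.min e r / 2)^-1 * h (y + t *: v).
  move: h1; congr (0 < _); rewrite -[RHS]mul1r -sgsg; ring.
by rewrite pmulr_rgt0// mulr_gt0// invr_gt0 divr_gt0.
Qed.

Variables (n : nat) (S : set 'rV[R]_n.+1).

Lemma graph_near (U : set 'rV[R]_n.+1) (g : 'rV[R]_n -> R) (i : 'I_n.+1) (p : 'rV[R]_n.+1) :
  open U -> U p -> {for drop_coord i p, continuous g} -> p 0 i = g (drop_coord i p) ->
  exists2 e : R, 0 < e & forall y, `|y - drop_coord i p| < e -> U (insert_coord i y (g y)).
Proof.
move=> oU Up cg pE.
have [r r0 hr] := (openP_norm _).1 oU _ Up.
have [e e0 he] := (continuousP_norm _ _).1 cg r r0.
exists (Num.min e r); first by rewrite lt_min e0 r0.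
move=> y; rewrite lt_min => /andP[ye yr]; apply: hr; apply: insert_coord_norm_lt => //.
by rewrite pE; exact: he.
Qed.

(** The curvature condition speaks of interior charts. From a boundary point one moves slightly into
    [h > 0], where the same [g] gives such a chart. *)
Lemma exists_interior_chart : S !=set0 -> smooth_hypersurface S ->
  exists p i U V g, S p /\ interior_chart S p i U V g.
Proof.
move=> [p Sp] hS; have [|] := hS p Sp.
  by move=> [i [U [V [g H]]]]; exists p, i, U, V, g.
move=> [i [U [V [g [h [[oU Up oV sg sh] [h0 [[j hj] E]]]]]]]].
have [_ Vp _ pE] : [/\ U p, V (drop_coord i p), 0 <= h (drop_coord i p) & p 0 i = g (drop_coord i p)].
  by have : (S `&` U) p by []; rewrite E.
pose V' := [set y : 'rV[R]_n | V y /\ 0 < h y].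
have oV' : open V'.
  apply/openP_norm => y [Vy hy].
  have [r r0 hr] := (openP_norm _).1 oV _ Vy.
  have [e e0 he] := (continuousP_norm _ _).1 (smooth_continuous sh (js := [::]) Vy) _ hy.
  exists (Num.min e r); first by rewrite lt_min e0 r0.
  move=> x; rewrite lt_min => /andP[xe xr]; split; first exact: hr.
  by have := he x xe; rewrite /= ltr_norml => /andP[h1 _]; move: h1; lra.
pose U' := [set x : 'rV[R]_n.+1 | U x /\ V' (drop_coord i x)].
have oU' : open U'.
  apply/openP_norm => x [Ux Vx].
  have [r r0 hr] := (openP_norm _).1 oU _ Ux.
  have [e e0 he] := (openP_norm _).1 oV' _ Vx.
  exists (Num.min e r); first by rewrite lt_min e0 r0.
  move=> z; rewrite lt_min => /andP[ze zr]; split; first exact: hr.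
  by apply: he; rewrite -drop_coordB; exact: le_lt_trans (drop_norm _ _) ze.
have sg' : smooth_on V' g by move=> js y [Vy _]; exact: sg.
have [e e0 he] := graph_near oU Up (smooth_continuous sg (js := [::]) Vp) pE.
have [r r0 hr] := (openP_norm _).1 oV _ Vp.
have er0 : 0 < Num.min e r by rewrite lt_min e0 r0.
(* The nonzero partial derivative of [h] provides points with [h > 0] as close to the base point as
   needed to remain in the chart. *)
have [t te ht] := derivative_sign ((sh [::] _ Vp).1 j) hj h0 er0.
have tn : `|drop_coord i p + t *: ev j - drop_coord i p| < Num.min e r.
  rewrite addrC addKr normrZ; apply: le_lt_trans te; rewrite ler_piMr//.
  apply/rV_norm_le => // k; rewrite mxE; case: (_ && _); by rewrite ?normr1 ?normr0.
set y := drop_coord i p + t *: ev j in ht tn.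
move: tn; rewrite lt_min => /andP[ye yr].
have Vy : V y by exact: hr.
have Uy := he y ye.
have Sy : S (insert_coord i y (g y)).
  have : (S `&` U) (insert_coord i y (g y)) by rewrite E /= drop_insert_coord insert_coord_eq; split => //; exact: ltW.
  by case.
exists (insert_coord i y (g y)), i, U', V', g; split => //; split => //.
  by split => //; rewrite drop_insert_coord.
apply/seteqP; split => x.
  move=> [Sx [Ux Vx]]; have : (S `&` U) x by [].
  by rewrite E => -[_ _ _ xE].
move=> [[Ux Vx] _ xE]; split => //.
have : (S `&` U) x by rewrite E /=; case: Vx => ? ?; split => //; exact: ltW.
by case.
Qed.

(** The Hessian determinant is the numerator of the graph curvature, so it inherits the
    non-vanishing. *)
Lemma exists_curved_graph : S !=set0 -> smooth_hypersurface S -> nonvanishing_gauss_curvature S ->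
  exists (i : 'I_n.+1) (V : set 'rV[R]_n) (g : 'rV[R]_n -> R) (y0 : 'rV[R]_n) (r : R),
  [/\ open V, smooth_on V g, V y0, \det (\matrix_(j < n, k < n) partial j (partial k g) y0) != 0 &
    0 < r /\ forall y, V y -> `|y - y0| <= r -> S (insert_coord i y (g y))].
Proof.
move=> S0 hS kS; have [p [i [U [V [g [Sp chart]]]]]] := exists_interior_chart S0 hS.
have := kS p i U V g Sp chart; rewrite /graph_gauss_curvature => kp.
have [oU Up oV sg E] := chart.
have [_ Vp pE] : [/\ U p, V (drop_coord i p) & p 0 i = g (drop_coord i p)].
  by have : (S `&` U) p by []; rewrite E.
have [e e0 he] := graph_near oU Up (smooth_continuous sg (js := [::]) Vp) pE.
exists i, V, g, (drop_coord i p), (e / 2); split => //.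
  by apply/eqP => d0; move: kp; rewrite d0 mul0r eqxx.
split; first by rewrite divr_gt0.
move=> y Vy ye; have Uy : U (insert_coord i y (g y)).
  by apply: he; apply: le_lt_trans ye _; move: e0; lra.
have : (S `&` U) (insert_coord i y (g y)) by rewrite E /= drop_insert_coord insert_coord_eq.
by case.
Qed.

End curved_graph.

Theorem mainTheorem2 (R : realType) (d : nat) (S : set 'rV[R]_d) :
  (2 <= d)%N ->
  S !=set0 ->
  smooth_hypersurface S ->
  nonvanishing_gauss_curvature S ->
  fourier_dim (cylinder S) = ((d.-1)%:R : R)%:E.
Proof.
case: d S => // n S n0 S0 hS kS /=.
have nR : 0 < n%:R :> R by rewrite ltr0n.
apply/eqP; rewrite eq_le; apply/andP; split.
  by apply: ge_ereal_sup => _ [s hs <-]; rewrite lee_fin; exact: fourier_exponent_le hs.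
have [i [V [g [y0 [r [oV sg Vy0 hess [r0 graphS]]]]]]] := exists_curved_graph S0 hS kS.
apply/lee_addgt0Pr => e e0.
(* [n - e] approaches the supremum; the maximum with [n / 2] keeps the exponent positive when [e] is
   large. *)
pose s := Num.max (n%:R / 2) (n%:R - e).
have hs : 0 < s < n%:R.
  rewrite lt_max divr_gt0//= gt_max; apply/andP; split; last by rewrite ltrBlDr ltrDl.
  by rewrite ltr_pdivrMr// ltr_pMr// ltr1n.
have hexp := fourier_exponent_graph n0 oV sg Vy0 hess r0 graphS hs.
apply: (@le_trans _ _ (s%:E + e%:E)%E).
  by rewrite -EFinD lee_fin -lerBlDr le_max lexx orbT.
by rewrite leeD2r//; apply: ereal_sup_ubound; exists s.
Qed.
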